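(* There exist universal constants $c,C_1,C_2>0$ such that for every dimension $d\ge1$, every $n\ge1$ and every $\boldsymbol\lambda\in[0,1]^n$ with $m_d(\boldsymbol\lambda):=\min_{t\in[0,1]}\big(t^2+\frac d{N(t)}\big)\le c$, \[ \frac{C_1}{\sqrt d}\,m_d(\boldsymbol\lambda)\le L_{\mathsf{PAC}}(\boldsymbol\lambda,\mathcal D^{\mathcal N}_d)\le C_2\,m_d(\boldsymbol\lambda). \] Moreover, with $t^*\in\arg\min_{t\in[0,1]}\big(t^2+\frac d{N(t)}\big)$, the estimator $\hat\mu_{\mathsf S}(\mathbf Z,t^* )$ satisfies $\Pr[\|\hat\mu_{\mathsf S}(\mathbf Z,t^* )-\mu_P\|_2^2\ge C_2\,m_d(\boldsymbol\lambda)]\le1/5$ for every $P\in\mathcal D^{\mathcal N}_d$ and every adversary.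
   Context: $\boldsymbol\lambda$-contamination: $Z_i=(1-B_i)X_i+B_i\tilde X_i$ with $X_i$ i.i.d. from $P$, $B_i\sim\mathrm{Bernoulli}(\lambda_i)$ independent and independent of the $X_i$, outliers $(\tilde X_i)$ drawn from an arbitrary joint distribution (adversary) that may depend on all $X_j,B_j$; write $\mathbf Z\sim_{\boldsymbol\lambda}P$. $\mathcal D^{\mathcal N}_d=\{\mathcal N(\mu,I_d):\mu\in\mathbb R^d\}$, $\mu_P$ its mean. Minimax PAC rate: $L_{\mathsf{PAC}}(\boldsymbol\lambda,\mathcal D)=\inf\{s:\inf_M\sup\Pr[\|M(\mathbf Z)-\mu_P\|_2^2\ge s]\le 1/5\}$, infimum over estimators $M$, supremum over $P\in\mathcal D$ and all adversaries. $N(t)=|\{i:\lambda_i\le t\}|$, with $d/0=+\infty$. Weighted Tukey depth $D_w(\eta,\mathbf Z)=\min_{v\in\mathbb S^{d-1}}\sum_iw_i\mathbb I\{v^\top(Z_i-\eta)\ge0\}$ for $w$ in the probability simplex, $\hat\mu_{\mathsf{TM}}(\mathbf Z,w)\in\arg\max_\eta D_w(\eta,\mathbf Z)$; threshold weights $w(t)_i=\mathbb I\{\lambda_i\le t\}/N(t)$ and $\hat\mu_{\mathsf S}(\mathbf Z,t)=\hat\mu_{\mathsf{TM}}(\mathbf Z,w(t))$. *)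

(* Defs.v *)
From HB Require Import structures.
From mathcomp Require Import all_boot all_order all_algebra.
From mathcomp Require Import all_classical all_reals all_analysis.
From mathcomp Require Import normal_distribution.
Set Implicit Arguments. Unset Strict Implicit. Unset Printing Implicit Defensive.
Import Order.TTheory GRing.Theory Num.Theory.
Local Open Scope classical_set_scope.
Local Open Scope ring_scope.

Section Defs.
Variable R : realType.

Definition sqdist (d : nat) (u v : 'I_d -> R) : R := \sum_(k < d) (u k - v k) ^+ 2.
Definition dotp (d : nat) (u v : 'I_d -> R) : R := \sum_(k < d) u k * v k.
Definition sphere (d : nat) : set ('I_d -> R) := [set v | dotp v v = 1].

Definition Ncount (n : nat) (lam : 'I_n -> R) (t : R) : nat :=
  #|[set i : 'I_n | lam i <= t]|.

Definition mobj (n d : nat) (lam : 'I_n -> R) (t : R) : \bar R :=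
  if Ncount lam t == 0%N then +oo%E else (t ^+ 2 + d%:R / (Ncount lam t)%:R)%:E.

Definition m_d (n d : nat) (lam : 'I_n -> R) : \bar R :=
  ereal_inf [set mobj d lam t | t in `[0, 1]%classic].

Definition wthr (n : nat) (lam : 'I_n -> R) (t : R) : 'I_n -> R :=
  fun i => if lam i <= t then ((Ncount lam t)%:R)^-1 else 0.

Definition tukey_depth (n d : nat) (w : 'I_n -> R) (Z : 'I_n -> 'I_d -> R)
  (eta : 'I_d -> R) : R :=
  inf [set \sum_(i < n) w i * (if 0 <= dotp v (fun k => Z i k - eta k) then 1 else 0)
      | v in @sphere d].

Definition is_tukey_median (n d : nat) (w : 'I_n -> R) (Z : 'I_n -> 'I_d -> R)
  (eta : 'I_d -> R) : Prop :=
  forall eta' : 'I_d -> R, tukey_depth w Z eta' <= tukey_depth w Z eta.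

Definition estimator (n d : nat) := ('I_n -> 'I_d -> R) -> ('I_d -> R).

(* Borel measurability of an estimator (R^{n x d} -> R^d), expressed as:
   it maps measurable random samples to measurable random vectors. *)
Definition measurable_estimator (n d : nat) (M : estimator n d) : Prop :=
  forall (dO : measure_display) (Om : measurableType dO)
         (Z : Om -> 'I_n -> 'I_d -> R),
    (forall i k, measurable_fun setT (fun w => Z w i k)) ->
    forall k, measurable_fun setT (fun w => M (Z w) k).

Definition mutually_independent (dO : measure_display) (Om : measurableType dO)
  (P : probability Om R) (I : finType) (Y : I -> Om -> R) : Prop :=
  forall A : I -> set R, (forall j, measurable (A j)) ->
    fine (P [set w | forall j, A j (Y j w)])
    = \prod_(j : I) fine (P [set w | A j (Y j w)]).

Definition contaminate (n d : nat) (Om : Type) (X : Om -> 'I_n -> 'I_d -> R)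
  (B : Om -> 'I_n -> bool) (Xt : Om -> 'I_n -> 'I_d -> R) :
  Om -> 'I_n -> 'I_d -> R :=
  fun w i => if B w i then Xt w i else X w i.

(* lambda-contamination setup with clean distribution N(mu, I_d):
   X_i i.i.d. N(mu, I_d) (i.e. all coordinates X_{i,k} independent, X_{i,k} ~ N(mu_k, 1)),
   B_i ~ Bernoulli(lambda_i), all of these mutually independent;
   the outliers Xt are arbitrary (measurable) random vectors on the same
   probability space, so their joint law with (X, B) is arbitrary (adversary). *)
Definition contam_setup (n d : nat) (lam : 'I_n -> R) (mu : 'I_d -> R)
  (dO : measure_display) (Om : measurableType dO) (P : probability Om R)
  (X : Om -> 'I_n -> 'I_d -> R) (B : Om -> 'I_n -> bool)
  (Xt : Om -> 'I_n -> 'I_d -> R) : Prop :=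
  [/\ [/\ (forall i k, measurable_fun setT (fun w => X w i k)),
      (forall i, measurable [set w | B w i]) &
      (forall i k, measurable_fun setT (fun w => Xt w i k))],
      (forall i k (A : set R), measurable A ->
         P [set w | A (X w i k)] = normal_prob (mu k) 1 A),
      (forall i, P [set w | B w i] = (lam i)%:E) &
      mutually_independent P
        (fun (j : ('I_n * 'I_d) + 'I_n) w =>
           match j with
           | inl ik => X w ik.1 ik.2
           | inr i => (B w i)%:R
           end)].

Definition worst_risk (n d : nat) (lam : 'I_n -> R) (M : estimator n d) (s : R)
  : \bar R :=
  ereal_sup [set p | exists (mu : 'I_d -> R) (dO : measure_display)
      (Om : measurableType dO) (P : probability Om R)
      (X : Om -> 'I_n -> 'I_d -> R) (B : Om -> 'I_n -> bool)
      (Xt : Om -> 'I_n -> 'I_d -> R),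
      contam_setup lam mu P X B Xt /\
      p = P [set w | s <= sqdist (M (contaminate X B Xt w)) mu]].

Definition L_PAC (n d : nat) (lam : 'I_n -> R) : \bar R :=
  ereal_inf [set s%:E | s in
    [set s : R | (ereal_inf [set worst_risk lam M s | M in
                    [set M : estimator n d | measurable_estimator M]]
                  <= (5%:R^-1)%:E)%E]].

End Defs.

(* Main.v *)
Require Import Defs.
From HB Require Import structures.
From mathcomp Require Import all_boot all_order all_algebra.
From mathcomp Require Import all_classical all_reals all_analysis.
From mathcomp Require Import normal_distribution.
From mathcomp Require Import measurable_realfun.
From mathcomp Require Import ring lra.
Set Implicit Arguments. Unset Strict Implicit. Unset Printing Implicit Defensive.
Import Order.TTheory GRing.Theory Num.Theory.
Import numFieldNormedType.Exports.
Local Open Scope classical_set_scope.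
Local Open Scope ring_scope.

(** Write [m] for [m_d]. For the upper bound, keep only the [N] samples with [lam i <= t] and put [sigma = sqrt (d / N)].
    Chaining over nets of the sphere, with Bernstein's inequality at each level, shows that the halfspaces of a given
    offset contain the Gaussian fraction of the clean points up to [O(sigma)], uniformly in the direction; by Markov's
    inequality the fraction of outliers is [O(sigma + t)].
    Hence any point close to the mean has depth at least [1/2 - O(sigma + t)], while a point at distance [r] from the mean has depth at most
    [1/2 - c r + O(sigma + t)], so every point of near-maximal depth lies within [O(sigma + t)] of the mean. For the minimax
    bound a point of large depth is selected measurably among the rational ones, so that no exact Tukey median is needed.

    For the lower bound the mean is a vertex of a hypercube [{-gam, gam}^K], [K ~ sqrt d] and [gam^2 ~ m / d]. When
    [lam i > K gam] the adversary can make the contaminated sample look like a centred Gaussian with variance [1 + gam] on the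
    [K] coordinates, which dominates each [N(+-gam, 1)] up to a factor [exp gam], so such samples carry no information.
    The other samples are too few to decide the sign of a coordinate (chi-square bound), and averaging over the vertices
    gives an error of order [K gam^2 ~ m / sqrt d] with probability at least [1/4]. *)

(** * Products of probability measures on tuples *)

(** A single net of mesh about [sigma] would cost a factor log(1 / sigma) in the union bound. Along
    the chain, the half-spaces of neighbours at level k differ with probability of order 16^-k; this
    small variance pays for the entropy of the net, of order d (k + 1), and leaves deviations of
    order sigma 2^-k, which are summable. Uniformity in the direction suffices: only the two offsets
    [- sigma] (points near the mean are deep) and [radius] (distant points are not) occur.

    In the lower bound, hiding one coordinate costs a factor exp(- gam), so hiding K of them takes
    contamination about K gam. The constraints (K gam)^2 <= O(m), from hiding, and gam^2 <= O(m /
    d), from the clean samples, make the error K gam^2 largest at K of order sqrt d; this choice is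
    the source of the gap sqrt d between the two bounds.

    The level 1/5 separates the two sides: the bad events of the upper bound have total probability
    3/20, while the hypercube forces failure with probability 1/4. *)

Section TupleProduct.
Context {d0 : measure_display} {T : measurableType d0} {R : realType}.

Lemma measurable_tuple_prod n (f : 'I_n -> T -> R) :
  (forall i, measurable_fun setT (f i)) ->
  measurable_fun [set: n.-tuple T] (fun t => \prod_(i < n) f i (tnth t i)).
Proof.
move=> mf; apply: measurable_prod => i _.
by apply: measurableT_comp => //; exact: measurable_tnth.
Qed.

(** Induction on [n]: push the binary product forward along [cons] and apply Tonelli. Stating it for
    products of nonnegative functions covers rectangles (indicators) and exponential moments at
    once. *)
Lemma tuple_product_exists n (P : 'I_n -> probability T R) :
  exists Q : probability (n.-tuple T) R,
    forall (f : 'I_n -> T -> R) (c : 'I_n -> R),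
    (forall i, measurable_fun setT (f i)) -> (forall i x, 0 <= f i x) ->
    (forall i, (\int[P i]_x (f i x)%:E = (c i)%:E)%E) ->
    (\int[Q]_t (\prod_(i < n) f i (tnth t i))%:E = (\prod_(i < n) c i)%:E)%E.
Proof.
elim: n P => [|n IH] P.
  exists (\d_ ([tuple] : 0.-tuple T)) => f c mf f0 fc.
  rewrite (eq_integral (fun=> 1%E)); last by move=> x _; rewrite big_ord0.
  by rewrite integral_cst//= diracT mul1e big_ord0.
have [Q HQ] := IH (fun i => P (lift ord0 i)).
pose phi (x : T * n.-tuple T) := [tuple of x.1 :: x.2].
have mphi : measurable_fun setT phi by apply: measurable_cons.
pose mphi' := isMeasurableFun.Build _ _ _ _ _ mphi.
pose phi' : {mfun _ >-> _} := HB.pack phi mphi'.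
exists (distribution (P ord0 \x Q)%E phi') => f c mf f0 fc.
rewrite ge0_integral_distribution; last 2 first.
- by apply/measurable_EFinP; exact: measurable_tuple_prod.
- by move=> y; rewrite lee_fin prodr_ge0.
rewrite fubini_tonelli1/=; last 2 first.
- apply/measurable_EFinP.
  apply: (measurableT_comp (measurable_tuple_prod mf)) => //.
- by move=> y; rewrite lee_fin prodr_ge0.
rewrite /fubini_F /=.
transitivity (\int[P ord0]_x ((f ord0 x)%:E * (\prod_(i < n) c (lift ord0 i))%:E))%E.
  apply: eq_integral => x _.
  have phiS y i : tnth (phi (x, y)) (lift ord0 i) = tnth y i.
    by rewrite !(tnth_nth x)/=.
  have phi0 y : tnth (phi (x, y)) ord0 = x by rewrite (tnth_nth x).
  under eq_integral => y _.
    rewrite big_ord_recl phi0 EFinM.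
    under eq_bigr => i _ do rewrite phiS.
    over.
  rewrite ge0_integralZl//.
  - congr (_ * _)%E.
    by apply: (HQ (fun i => f (lift ord0 i)) (fun i => c (lift ord0 i))).
  - by apply/measurable_EFinP; exact: (measurable_tuple_prod (f:=fun i => f (lift ord0 i))).
  - by move=> y _; rewrite lee_fin prodr_ge0.
  - by rewrite lee_fin.
have c0 i : 0 <= c i.
  by rewrite -lee_fin -fc; apply: integral_ge0 => x _; rewrite lee_fin.
rewrite ge0_integralZr//.
- by rewrite fc big_ord_recl EFinM.
- by apply/measurable_EFinP.
- by move=> x _; rewrite lee_fin.
- by rewrite lee_fin prodr_ge0.
Qed.

(** Chosen from the existence statement; the product formula determines it, by
    [tuple_measure_unique] below. *)
Definition tuple_product n (P : 'I_n -> probability T R) : probability (n.-tuple T) R :=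
  projT1 (cid (tuple_product_exists P)).

Lemma integral_tuple_product n (P : 'I_n -> probability T R) (f : 'I_n -> T -> R) (c : 'I_n -> R) :
    (forall i, measurable_fun setT (f i)) -> (forall i x, 0 <= f i x) ->
    (forall i, (\int[P i]_x (f i x)%:E = (c i)%:E)%E) ->
    (\int[tuple_product P]_t (\prod_(i < n) f i (tnth t i))%:E = (\prod_(i < n) c i)%:E)%E.
Proof. exact: (projT2 (cid (tuple_product_exists P))). Qed.

Definition rect n (A : 'I_n -> set T) : set (n.-tuple T) := [set t | forall i, A i (tnth t i)].

Lemma rect_indic n (A : 'I_n -> set T) t :
  \1_(rect A) t = \prod_(i < n) \1_(A i) (tnth t i) :> R.
Proof.
have [h|h] := pselect (rect A t).
  rewrite indicE mem_set// big1// => i _; rewrite indicE mem_set//; exact: h.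
rewrite indicE memNset//.
have [i Ai] : exists i, ~ A i (tnth t i) by apply/existsNP.
by rewrite (bigD1 i)//= indicE memNset// mul0r.
Qed.


Lemma measurable_forall d (U : measurableType d) (I : finType) (A : I -> set U) :
  (forall i, measurable (A i)) -> measurable [set x | forall i, A i x].
Proof.
move=> mA; rewrite (_ : [set x | _] = \bigcap_(i in [set: I]) A i).
  by apply: fin_bigcap_measurable => //; exact: finite_finset.
by apply/seteqP; split => t /=; [move=> h i _; apply: h|move=> h i; apply: h].
Qed.

Lemma measurable_exists d (U : measurableType d) (I : finType) (A : I -> set U) :
  (forall i, measurable (A i)) -> measurable [set x | exists i, A i x].
Proof.
move=> mA; rewrite (_ : [set x | _] = \bigcup_(i in [set: I]) A i).
  by apply: fin_bigcup_measurable => //; exact: finite_finset.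
by apply/seteqP; split => t /= [i]; [exists i|move=> _ ?; exists i].
Qed.

Lemma measurable_rect n (A : 'I_n -> set T) : (forall i, measurable (A i)) -> measurable (rect A).
Proof.
move=> mA; apply: measurable_forall => i.
by rewrite -[X in measurable X]setTI; exact: measurable_tnth.
Qed.

Lemma tuple_product_rect n (P : 'I_n -> probability T R) (A : 'I_n -> set T) :
  (forall i, measurable (A i)) ->
  tuple_product P (rect A) = (\prod_(i < n) fine (P i (A i)))%:E.
Proof.
move=> mA; have := integral_indic (tuple_product P) measurableT (measurable_rect mA).
rewrite setIT => <-.
under eq_integral do rewrite rect_indic.
apply: (@integral_tuple_product n P (fun i => \1_(A i))) => //.
by move=> i; rewrite integral_indic// setIT fineK// fin_num_measure.
Qed.

(** A cylinder over one coordinate is the rectangle with [setT] elsewhere, hence the condition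
    [G setT]. *)
Lemma tuple_sigma_algebra_rect n (G : set (set T)) : measurable = <<s G >> -> G setT ->
  (@measurable _ (n.-tuple T)) = <<s [set rect A | A in [set A : 'I_n -> set T | forall i, G (A i)]] >>.
Proof.
move=> mG GT; apply/seteqP; split; last first.
  apply: smallest_sub; first exact: sigma_algebra_measurable.
  move=> _ [A GA <-]; apply: measurable_rect => i; rewrite mG; exact: sub_sigma_algebra.
pose S := [set rect A | A in [set A : 'I_n -> set T | forall i, G (A i)]].
apply: smallest_sub; first exact: smallest_sigma_algebra.
rewrite -bigcup_seq => _ [i _ [A mA <-]].
have mt : measurable_fun [set: g_sigma_algebraType S] (fun t : g_sigma_algebraType S => tnth (t : n.-tuple T) i).
  apply: (measurability G) => // _ [B GB <-].
  apply: sub_sigma_algebra; exists (fun j => if j == i then B else setT).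
    by move=> j /=; case: ifP.
  rewrite setTI; apply/seteqP; split => t /=.
    by move=> /(_ i); rewrite eqxx.
  by move=> Bt j; case: ifP => // /eqP ->.
exact: mt.
Qed.

(** Rectangles over an intersection-stable generator form a generating pi-system. A general [G],
    rather than all measurable sets, allows nesting for tuples of tuples. *)
Lemma tuple_measure_unique n (G : set (set T)) (m1 m2 : {measure set (n.-tuple T) -> \bar R}) :
  measurable = <<s G >> -> G setT -> setI_closed G -> (m1 setT < +oo)%E ->
  (forall A : 'I_n -> set T, (forall i, G (A i)) -> m1 (rect A) = m2 (rect A)) ->
  forall E, measurable E -> m1 E = m2 E.
Proof.
move=> mG GT GI m1T m12 E mE.
have rT : rect (fun=> setT) = [set: n.-tuple T] by apply/seteqP; split.
apply: (measure_unique _ (fun=> setT) (tuple_sigma_algebra_rect n mG GT)) => //.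
- move=> _ _ [A GA <-] [B GB <-]; exists (fun i => A i `&` B i).
    by move=> i; apply: GI.
  apply/seteqP; split => t /=.
    by move=> h; split => i; case: (h i).
  by move=> [h1 h2] i; split; [exact: h1|exact: h2].
- by move=> _; exists (fun=> setT).
- by rewrite bigcup_const//; exists 0%N.
- by move=> _ [A GA <-]; apply: m12.
Qed.

End TupleProduct.

Section TupleProduct2.
Context {d0 : measure_display} {T : measurableType d0} {R : realType}.

Lemma tuple2_measure_unique n d (m1 m2 : {measure set (n.-tuple (d.-tuple T)) -> \bar R}) :
  (m1 setT < +oo)%E ->
  (forall A : 'I_n -> 'I_d -> set T, (forall i k, measurable (A i k)) ->
     m1 [set t | forall i k, A i k (tnth (tnth t i) k)] =
     m2 [set t | forall i k, A i k (tnth (tnth t i) k)]) ->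
  forall E, measurable E -> m1 E = m2 E.
Proof.
move=> m1T m12; have mT : (@measurable _ T) = <<s measurable >>.
  by rewrite sigma_algebra_id//; exact: sigma_algebra_measurable.
apply: (tuple_measure_unique (tuple_sigma_algebra_rect d mT measurableT)) => //.
- by exists (fun=> setT) => //; apply/seteqP; split.
- move=> _ _ [A mA <-] [B mB <-]; exists (fun i => A i `&` B i).
    by move=> i; apply: measurableI.
  apply/seteqP; split => t /=.
    by move=> h; split => i; case: (h i).
  by move=> [h1 h2] i; split; [exact: h1|exact: h2].
- move=> A hA; have /choice[B hB] : forall i, exists B : 'I_d -> set T, (forall k, measurable (B k)) /\ rect B = A i.
    by move=> i; case: (hA i) => B mB <-; exists B.
  rewrite (_ : rect A = [set t | forall i k, B i k (tnth (tnth t i) k)]).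
    by apply: m12 => i k; exact: (hB i).1.
  apply/seteqP; split => t /=.
    by move=> h i k; have := h i; rewrite -(hB i).2; apply.
  by move=> h i; rewrite -(hB i).2; apply: h.
Qed.

(** Both sides are measures in [E] and agree on rectangles, where the integral factors. *)
Lemma tuple_product_density n (P P' : 'I_n -> probability T R) (l : 'I_n -> T -> R) :
  (forall i, measurable_fun setT (l i)) -> (forall i x, 0 <= l i x) ->
  (forall i A, measurable A -> P' i A = (\int[P i]_(x in A) (l i x)%:E)%E) ->
  forall E, measurable E ->
  tuple_product P' E = (\int[tuple_product P]_(t in E) (\prod_(i < n) l i (tnth t i))%:E)%E.
Proof.
move=> ml l0 Pl E mE.
pose L (t : n.-tuple T) := (\prod_(i < n) l i (tnth t i))%:E.
have mL : measurable_fun setT L by apply/measurable_EFinP; exact: measurable_tuple_prod.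
have L0 t : (0 <= L t)%E by rewrite lee_fin prodr_ge0.
pose m2 (A : set (n.-tuple T)) := (\int[tuple_product P]_(t in A) L t)%E.
have m20 : m2 set0 = 0%E by rewrite /m2 integral_set0.
have m2ge A : (0 <= m2 A)%E by apply: integral_ge0.
have m2s : semi_sigma_additive m2.
  move=> F mF tF mUF; rewrite /m2; apply: cvg_toP.
    apply: ereal_nondecreasing_is_cvgn => m k mk.
    by apply: lee_sum_nneg_natr => // j _ _; exact: integral_ge0.
  rewrite ge0_integral_bigcup//=; exact: measurable_funTS.
pose m2M := isMeasure.Build _ _ _ m2 m20 m2ge m2s.
pose m2' : {measure set _ -> \bar R} := HB.pack m2 m2M.
have mT : (@measurable _ T) = <<s measurable >>.
  by rewrite sigma_algebra_id//; exact: sigma_algebra_measurable.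
have := (@tuple_measure_unique _ _ _ _ _ (tuple_product P') m2' mT measurableT).
apply => //.
- exact: measurableI.
- exact: (le_lt_trans (probability_le1 _ _) (ltry _)).
- move=> A mA; transitivity (\prod_(i < n) fine (P' i (A i)))%:E; first exact: tuple_product_rect.
  rewrite /m2' /= /m2 integral_mkcond/=; apply/esym.
  rewrite (eq_integral (fun t => (\prod_(i < n) (l i (tnth t i) * \1_(A i) (tnth t i)))%:E)).
    rewrite (integral_tuple_product (f := fun i x => l i x * \1_(A i) x) (c := fun i => fine (P' i (A i))))//.
    + by move=> i; apply: measurable_funM.
    + by move=> i x; rewrite mulr_ge0.
    + move=> i; rewrite fineK ?fin_num_measure// Pl// [RHS]integral_mkcond.
      apply: eq_integral => x _; rewrite epatch_indic.
      by rewrite EFinM.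
  move=> t _; rewrite epatch_indic /L -EFinM big_split; congr (_ * _)%:E; exact: rect_indic.
Qed.

End TupleProduct2.

(** * Gaussian vectors and their halfspaces *)

Section Density.
Context d (T : measurableType d) (R : realType).
Variables (mu nu : {measure set T -> \bar R}) (g : T -> R).
Hypotheses (mg : measurable_fun setT g) (g0 : forall x, 0 <= g x).
Hypothesis nuE : forall A, measurable A -> nu A = (\int[mu]_(x in A) (g x)%:E)%E.

Import HBNNSimple.

(** Monotone convergence along simple functions reduces the claim to indicators, where it is
    [nuE]. *)
Lemma integral_density (f : T -> \bar R) : measurable_fun setT f -> (forall x, 0 <= f x)%E ->
  (\int[nu]_x f x = \int[mu]_x (f x * (g x)%:E))%E.
Proof.
move=> mf f0.
pose f_ := nnsfun_approx measurableT mf.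
have gge x : (0 <= (g x)%:E)%E by rewrite lee_fin.
have mgE : measurable_fun setT (EFin \o g) by exact/measurable_EFinP.
have mfE n : measurable_fun setT (EFin \o f_ n) by exact/measurable_EFinP.
transitivity (lim (\int[nu]_x (f_ n x)%:E @[n --> \oo])%E).
  rewrite -monotone_convergence//=.
  - apply: eq_integral => ? /[!inE] xD; apply/esym/cvg_lim => //=.
    exact: cvg_nnsfun_approx.
  - by move=> n ? _; rewrite lee_fin.
  - by move=> ? _ ? ? mn; rewrite lee_fin; exact/lefP/nd_nnsfun_approx.
transitivity (lim (\int[mu]_x ((f_ n x)%:E * (g x)%:E) @[n --> \oo])%E); last first.
  rewrite -monotone_convergence//=.
  - apply: eq_integral => x /[!inE] xD; apply/cvg_lim => //.
    apply: (@cvgeZr _ _ _ (fun n => (f_ n x)%:E) (f x) (g x)%:E) => //; exact: cvg_nnsfun_approx.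
  - by move=> n; exact: (emeasurable_funM (mfE n) mgE).
  - by move=> n ? _; rewrite mule_ge0// lee_fin.
  - by move=> x _ ? ? ?; rewrite lee_wpmul2r// lee_fin; exact/lefP/nd_nnsfun_approx.
apply: congr_lim; apply/funext => n /=.
under [LHS]eq_integral do rewrite fimfunE -fsumEFin//.
rewrite [LHS]ge0_integral_fsum//; last 2 first.
  - by move=> r; exact/measurable_EFinP/measurableT_comp.
  - by move=> m x _; rewrite EFinM nnfun_muleindic_ge0.
under [RHS]eq_integral => x _.
  rewrite fimfunE -fsumEFin// ge0_mule_fsuml; last first.
    by move=> r; rewrite EFinM nnfun_muleindic_ge0.
  over.
rewrite [RHS]ge0_integral_fsum//; last 2 first.
  - move=> r; apply: emeasurable_funM => //; exact/measurable_EFinP/measurableT_comp.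
  - by move=> m x _; rewrite mule_ge0// EFinM nnfun_muleindic_ge0.
apply: eq_fsbigr => r _.
(* Negative values have empty preimage, so both summands vanish; what remains has a nonnegative
   scalar to pull out. *)
have [r0|r0] := ltP r 0.
  transitivity (0%E : \bar R); [|apply/esym]; apply: integral0_eq => x _;
    by rewrite preimage_nnfun0// indic0 mulr0 ?mul0e.
under [RHS]eq_integral do rewrite EFinM -muleA.
under [LHS]eq_integral do rewrite EFinM.
rewrite !ge0_integralZl//; last 3 first.
- by apply: emeasurable_funM => //; exact/measurable_EFinP.
- by move=> x _; rewrite mule_ge0// lee_fin.
- exact/measurable_EFinP.
rewrite integral_indic// setIT nuE//; congr (_ * _)%E.
rewrite integral_mkcond; apply: eq_integral => x _.
by rewrite epatch_indic muleC.
Qed.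
End Density.

Section Gauss.
Context {R : realType}.
Notation mu := (@lebesgue_measure R).
Implicit Types (m s r x : R).

Lemma integral_normal m s (f : R -> \bar R) : measurable_fun setT f -> (forall x, 0 <= f x)%E ->
  (\int[normal_prob m s]_x f x = \int[mu]_x (f x * (normal_pdf m s x)%:E))%E.
Proof.
move=> mf f0; apply: (@integral_density _ _ _ mu (normal_prob m s)) => //.
- exact: measurable_normal_pdf.
- by move=> x; exact: normal_pdf_ge0.
Qed.

Lemma tail_affine_subst (G : R -> R) (k e c : R) : 0 < k -> continuous G -> (forall x, 0 <= G x) ->
  (\int[mu]_(x in `[(k * c + e)%R, +oo[) (G x)%:E = \int[mu]_(x in `[c, +oo[) (G (k * x + e) * k)%R%:E)%E.
Proof.
move=> k0 cG G0; pose F : R^o -> R^o := (k *: (@id R^o)) + cst e.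
have dF x : is_derive x 1 F k.
  by apply: is_derive_eq; rewrite addr0 -[RHS]mulr1.
have F' : F^`()%classic = cst k by apply/funext => x; rewrite derive1E; apply: derive_val.
have cF : continuous F by move=> x; apply/differentiable_continuous/derivable1_diffP; exact: ex_derive.
have FE x : F x = k * x + e by [].
have := @increasing_ge0_integration_by_substitutiony R F G c.
rewrite F' FE => ->//.
- by move=> x y _ _ xy; rewrite !FE ltrD2r ltr_pM2l.
- by move=> x _; exact: cst_continuous.
- by apply: is_cvg_cst.
- by apply: is_cvg_cst.
- split; first by move=> x _; exact: ex_derive.
  exact: cvg_at_right_filter (cF c).
- rewrite (_ : F = (fun x => (x + e / k) * k)); last first.
    by apply/funext => x; rewrite FE mulrDl divfK ?gt_eqF// mulrC.
  by apply: gt0_cvgMly => //; exact: cvg_addrr.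
- exact: continuous_subspaceT.
Qed.

Definition gtail r : R := fine (normal_prob 0 1 `[r, +oo[%classic).

Lemma gtailE r : (gtail r)%:E = normal_prob 0 1 `[r, +oo[%classic.
Proof. by rewrite fineK// fin_num_measure. Qed.

Let pdfE m s x : s != 0 -> normal_pdf m s x = normal_peak s * normal_fun m s x.
Proof. by move=> s0; rewrite normal_pdfE. Qed.

Lemma normal_ge m r : normal_prob m 1 `[(r + m)%R, +oo[%classic = (gtail r)%:E.
Proof.
rewrite gtailE /normal_prob; have := @tail_affine_subst (normal_pdf m 1) 1 m r ltr01.
rewrite mul1r => ->.
- apply: eq_integral => x _; rewrite mulr1 !pdfE ?oner_neq0//; congr (_ * expR _)%:E.
  by congr (_ * _); congr (- _); rewrite subr0 mul1r addrK.
- by apply: continuous_normal_pdf; exact: oner_neq0.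
- by move=> x; exact: normal_pdf_ge0.
Qed.

Lemma normal_le m r : normal_prob m 1 `]-oo, (m - r)%R]%classic = (gtail r)%:E.
Proof.
rewrite -(normal_ge (- m) r) /normal_prob -[(m - r)]opprK ge0_integration_by_substitutionNy.
- rewrite opprB; apply: eq_integral => x _; rewrite /= !pdfE ?oner_neq0//; congr (_ * expR _)%:E.
  congr (_ * _); congr (- _).
  by rewrite opprK -sqrrN opprB opprK addrC.
- by apply/continuous_subspaceT/continuous_normal_pdf; exact: oner_neq0.
- by move=> x _; exact: normal_pdf_ge0.
Qed.

(** Exponential tilting: completing the square turns the integrand into a multiple of the density of
    N(m + s, 1). *)
Lemma normal_mgf m s : (\int[normal_prob m 1]_x (expR (s * (x - m)))%:E = (expR (s ^+ 2 / 2))%:E)%E.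
Proof.
rewrite integral_normal; last 2 first.
- apply/measurable_EFinP; apply: measurableT_comp => //; apply: measurable_funM => //.
  exact: measurable_funB.
- by move=> x; rewrite lee_fin expR_ge0.
transitivity (\int[mu]_x ((expR (s ^+ 2 / 2))%:E * (normal_pdf (m + s) 1 x)%:E))%E.
  apply: eq_integral => x _; rewrite -!EFinM !pdfE ?oner_neq0// /normal_fun.
  rewrite mulrCA [in RHS]mulrCA -!expRD; congr (_ * expR _)%:E.
  by field.
rewrite ge0_integralZl ?lee_fin ?expR_ge0//.
- by rewrite integral_normal_pdf mule1.
- apply/measurable_EFinP; exact: measurable_normal_pdf.
- by move=> x _; rewrite lee_fin normal_pdf_ge0.
Qed.

Lemma gtail_nincr r s : r <= s -> gtail s <= gtail r.
Proof.
move=> rs; rewrite -lee_fin !gtailE le_measure ?inE//.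
by move=> x /=; rewrite !in_itv/= !andbT; exact: le_trans.
Qed.

Lemma gtailN r : gtail (- r) = 1 - gtail r.
Proof.
have e1 : normal_prob 0 1 `]-oo, (- r)%R[%classic = (gtail r)%:E.
  rewrite -(normal_le 0 r) sub0r /normal_prob integral_itv_bndo_bndc//.
  apply/measurable_EFinP/measurable_funTS; exact: measurable_normal_pdf.
have := @probability_setC _ _ _ (normal_prob 0 1) `]-oo, (- r)%R[%classic (measurable_itv _).
by rewrite setCitvl; move: e1 => /= ->; rewrite -gtailE -EFinD => -[].
Qed.

Lemma gtail0 : gtail 0 = 2^-1.
Proof. by have := gtailN 0; rewrite oppr0; lra. Qed.

Lemma gtail_split r s : r <= s ->
  ((gtail r)%:E = normal_prob 0 1 `[r, s[%classic + (gtail s)%:E)%E.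
Proof.
move=> rs; rewrite !gtailE -measureU//.
  congr (normal_prob 0 1 _); apply/seteqP; split => x /=; rewrite !in_itv/= !andbT.
    by case: (ltP x s) => [xs rx|xs _]; [left; rewrite rx|right].
  by case=> [/andP[]//|]; exact: le_trans.
by apply/seteqP; split => // x []/=; rewrite !in_itv/= !andbT => /andP[_ /lt_geF ->].
Qed.

Lemma normal_peak1_le1 : normal_peak (1:R) <= 1.
Proof.
rewrite /normal_peak invf_le1.
  rewrite -[leLHS]sqrtr1 ler_sqrt; last by rewrite expr1n mul1r mulrn_wge0// pi_ge0.
  by rewrite expr1n mul1r mulr2n; have := @pi_ge2 R; lra.
by rewrite sqrtr_gt0 expr1n mul1r pmulrn_lgt0// pi_gt0.
Qed.

(** The standard normal density is at most 1. *)
Lemma gtail_lip r a : 0 <= a -> gtail (r - a) <= gtail r + a.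
Proof.
move=> a0; rewrite -lee_fin (@gtail_split (r - a) r) ?gerBl// [gtail r + a]addrC EFinD; apply: leeD2r.
rewrite /normal_prob (@le_trans _ _ (\int[mu]_(x in `[(r - a)%R, r[) (cst 1 x)))%E//.
  apply: ge0_le_integral => //.
  - by move=> x _; rewrite lee_fin normal_pdf_ge0.
  - apply/measurable_EFinP/measurable_funTS; exact: measurable_normal_pdf.
  - move=> x _; rewrite lee_fin; apply: le_trans (normal_pdf_ub _ _ (oner_neq0 _)) _.
    exact: normal_peak1_le1.
rewrite integral_cst//= mul1e lebesgue_measure_itv/=; case: ifPn => _; last by rewrite lee_fin.
by rewrite -EFinD lee_fin; lra.
Qed.

(** The minimum of the standard normal density on [0, 1]: the guaranteed rate at which depth is lost
    when moving away from the mean. *)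
Definition gdens : R := normal_pdf 0 1 1.

Lemma gdens_gt0 : 0 < gdens.
Proof. by rewrite /gdens pdfE ?oner_neq0// mulr_gt0 ?expR_gt0// normal_peak_gt0 ?oner_neq0. Qed.

Lemma gtail_anti r : 0 <= r -> r <= 1 -> gtail r <= 2^-1 - gdens * r.
Proof.
move=> r0 r1; suff : gdens * r + gtail r <= gtail 0 by rewrite gtail0; lra.
rewrite -lee_fin (gtail_split r0) EFinD; apply: leeD2r.
rewrite /normal_prob (@le_trans _ _ (\int[mu]_(x in `[0%R, r[) (cst gdens%:E x)))%E//.
  rewrite integral_cst//= lebesgue_measure_itv/=; case: ifPn => [_|].
    by rewrite -EFinD -EFinM lee_fin subr0.
  rewrite lte_fin -leNgt => rn; have -> : r = 0 by apply/eqP; rewrite eq_le r0 rn.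
  by rewrite mulr0 mule0.
apply: ge0_le_integral => //.
- by move=> x _; rewrite lee_fin ltW// gdens_gt0.
- apply/measurable_EFinP/measurable_funTS; exact: measurable_normal_pdf.
- move=> x; rewrite /= in_itv/= => /andP[x0 xr]; rewrite lee_fin /gdens !pdfE ?oner_neq0//.
  rewrite ler_pM2l ?normal_peak_gt0 ?oner_neq0// /normal_fun ler_expR !subr0 !expr1n.
  rewrite !mulNr lerN2 ler_pM2r ?invr_gt0//.
  by rewrite expr_le1// (le_trans (ltW xr)).
Qed.

(** Chernoff's bound with parameter 1; exponential decay is enough for the chaining. *)
Lemma gtail_exp r : gtail r <= expR (2^-1 - r).
Proof.
rewrite -lee_fin gtailE.
have := @normal_mgf 0 1; rewrite expr1n div1r => mgf.
rewrite expRD EFinM -mgf -ge0_integralZr ?lee_fin ?expR_ge0//; last first.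
  apply/measurable_EFinP; apply: measurableT_comp => //; apply: measurable_funM => //.
  exact: measurable_funB.
have := integral_indic (normal_prob 0 1) measurableT (measurable_itv `[r, +oo[).
rewrite setIT => <-; apply: ge0_le_integral => //.
- exact/measurable_EFinP.
- apply: emeasurable_funM => //; apply/measurable_EFinP; apply: measurableT_comp => //; apply: measurable_funM => //.
  exact: measurable_funB.
- move=> x _; rewrite -EFinM lee_fin indicE; case: (boolP (x \in _)); last first.
    by move=> _; rewrite mulr_ge0 ?expR_ge0.
  rewrite inE/= in_itv/= andbT => rx; rewrite -expRD -[leLHS]expR0 ler_expR.
  by rewrite mul1r subr0 subr_ge0.
Qed.

End Gauss.

Section TupleRec.
Context {d0 : measure_display} {T : measurableType d0} {R : realType}.

(** Recovers the recursive structure of the chosen product measure from its uniqueness, for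
    inductions on the dimension. *)
Lemma tuple_product_recl n (P : 'I_n.+1 -> probability T R) E : measurable E ->
  tuple_product P E =
  (\int[P ord0]_x tuple_product (fun i => P (lift ord0 i)) [set y : n.-tuple T | E [tuple of x :: y]])%E.
Proof.
move=> mE; pose phi (x : T * n.-tuple T) := [tuple of x.1 :: x.2].
have mphi : measurable_fun setT phi by apply: measurable_cons.
pose mphi' := isMeasurableFun.Build _ _ _ _ _ mphi.
pose phi' : {mfun _ >-> _} := HB.pack phi mphi'.
pose Q := tuple_product (fun i => P (lift ord0 i)).
have mT : (@measurable _ T) = <<s measurable >>.
  by rewrite sigma_algebra_id//; exact: sigma_algebra_measurable.
transitivity (distribution (P ord0 \x Q)%E phi' E); last first.
  rewrite /distribution /pushforward /= /product_measure1.
  apply: eq_integral => x _ /=; congr (Q _); apply/seteqP; split => y /=.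
    by rewrite /xsection/= inE.
  by rewrite /xsection/= inE.
apply: (@tuple_measure_unique _ _ _ _ _ (tuple_product P) (distribution (P ord0 \x Q)%E phi') mT) => //.
- exact: measurableI.
- exact: (le_lt_trans (probability_le1 _ _) (ltry _)).
move=> A mA; transitivity (\prod_(i < n.+1) fine (P i (A i)))%:E; first exact: tuple_product_rect.
transitivity ((P ord0 \x Q)%E (A ord0 `*` rect (fun i => A (lift ord0 i)))).
  rewrite product_measure1E//; last by apply: measurable_rect => i.
  rewrite big_ord_recl EFinM fineK ?fin_num_measure//; congr (_ * _)%E.
  by apply/esym; exact: tuple_product_rect.
congr ((P ord0 \x Q)%E _); apply/seteqP; split => -[x y] /=.
  move=> [Ax Ay] i; case: (unliftP ord0 i) => [j|] ->.
    by have := Ay j; rewrite !(tnth_nth x).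
  by rewrite (tnth_nth x).
move=> h; split; first by have := h ord0; rewrite (tnth_nth x).
move=> j; have := h (lift ord0 j).
by rewrite !(tnth_nth x).
Qed.
End TupleRec.

Section GaussVec.
Context {R : realType}.
Notation leb := (@lebesgue_measure R).

(* [normal_prob] lives on [measurableTypeR R]; its image under the identity lives on the default structure of [R]. *)
Let idR : measurableTypeR R -> R := idfun.

Let measurable_idR : measurable_fun setT idR. Proof. by move=> _ Y mY; rewrite setTI. Qed.

Definition nprob (m s : R) : probability R R :=
  distribution (normal_prob m s) (HB.pack idR (isMeasurableFun.Build _ _ _ _ _ measurable_idR)).

Lemma nprobE m s A : nprob m s A = normal_prob m s A. Proof. by []. Qed.

Lemma integral_nprob m s (f : R -> \bar R) : measurable_fun setT f -> (forall x, 0 <= f x)%E ->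
  (\int[nprob m s]_x f x = \int[normal_prob m s]_x f x)%E.
Proof. by move=> mf f0; rewrite ge0_integral_distribution. Qed.

Definition gauss_vec d (m : 'I_d -> R) : probability (d.-tuple R) R :=
  tuple_product (fun k => nprob (m k) 1).

Definition cdot d (m v : 'I_d -> R) (x : d.-tuple R) : R := \sum_(k < d) v k * (tnth x k - m k).

Lemma measurable_cdot d (m v : 'I_d -> R) : measurable_fun setT (cdot m v).
Proof.
apply: measurable_sum => k; apply: measurable_funM => //; apply: measurable_funB => //.
exact: measurable_tnth.
Qed.

Lemma measurable_cdot_ge d (m v : 'I_d -> R) r : measurable [set x | r <= cdot m v x].
Proof.
rewrite -[X in measurable X]setTI (_ : [set x | _] = cdot m v @^-1` `[r, +oo[%classic).
  exact: measurable_cdot.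
by apply/seteqP; split => x /=; rewrite in_itv/= andbT.
Qed.

Lemma normal_peak_scale (k : R) : 0 < k -> normal_peak k = normal_peak 1 / k.
Proof.
move=> k0; rewrite /normal_peak expr1n mul1r -mulrnAr sqrtrM ?sqr_ge0//.
by rewrite sqrtr_sqr gtr0_norm// invfM mulrC.
Qed.

(** Let [u] be the normalised sum of a (x - m) and an independent N(0, s'^2) variable. The joint
    density of [x] and [u] is factored in its two orders: [u] given [x] on the left; on the right
    [u] standard and [x] given [u] normal with mean m + a u / s and deviation s' / s. *)
Lemma normal_fun_rotate (m s s' a x u : R) : 0 < s -> 0 < s' -> s ^+ 2 = a ^+ 2 + s' ^+ 2 ->
  normal_fun 0 1 (s / s' * u + - (a * (x - m)) / s') * normal_fun m 1 x =
  normal_fun 0 1 u * normal_fun (m + a * u / s) (s' / s) x.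
Proof.
move=> s0 s'0 ss'; rewrite /normal_fun -!expRD; congr expR.
have h0 : s ^+ 2 - a ^+ 2 - s' ^+ 2 = 0 by rewrite ss'; ring.
apply/eqP; rewrite -subr_eq0; apply/eqP.
transitivity ((s ^+ 2 - a ^+ 2 - s' ^+ 2) * ((x - m) ^+ 2 - u ^+ 2) / (2 * s' ^+ 2)); last by rewrite h0 !mul0r.
by field; rewrite !gt_eqF.
Qed.

(** A linear functional of a Gaussian vector is Gaussian. Induction on [d]: condition on the first
    coordinate, apply the induction hypothesis to the others, and exchange the integrals by
    Tonelli. *)
Lemma gauss_vec_tail d (m v : 'I_d -> R) (r s : R) : 0 < s -> \sum_(k < d) v k ^+ 2 = s ^+ 2 ->
  gauss_vec m [set x | r <= cdot m v x] = (gtail (r / s))%:E.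
Proof.
elim: d m v r s => [|d IH] m v r s s0.
  by rewrite big_ord0 => /esym/eqP; rewrite sqrf_eq0 gt_eqF.
rewrite big_ord_recl => vs; rewrite /gauss_vec tuple_product_recl; last exact: measurable_cdot_ge.
pose v' k := v (lift ord0 k); pose m' k := m (lift ord0 k).
set a := v ord0.
have cE x (y : d.-tuple R) : cdot m v [tuple of x :: y] = a * (x - m ord0) + cdot m' v' y.
  rewrite /cdot big_ord_recl (tnth_nth x)/=; congr (_ + _).
  by apply: eq_bigr => k _; rewrite !(tnth_nth x).
(* If the other coefficients vanish, the conditional law is degenerate; then [a] is [s] or [- s] and
   the claim is one-dimensional. *)
have [v'0|v'0] := eqVneq (\sum_(k < d) v' k ^+ 2) 0.
  have v'k k : v' k = 0.
    have := v'0; move/eqP; rewrite psumr_eq0; last by move=> i _; exact: sqr_ge0.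
    by move/allP/(_ k (mem_index_enum _)); rewrite /= sqrf_eq0 => /eqP.
  have as2 : a ^+ 2 = s ^+ 2 by rewrite -vs v'0 addr0.
  transitivity (nprob (m ord0) 1 [set x | r <= a * (x - m ord0)]).
    have mA : measurable [set x | r <= a * (x - m ord0)].
      rewrite -[X in measurable X]setTI (_ : [set x | _] = (fun x => a * (x - m ord0)) @^-1` `[r, +oo[%classic).
        by apply: measurable_funM => //; exact: measurable_funB.
      by apply/seteqP; split => x /=; rewrite in_itv/= andbT.
    have := integral_indic (nprob (m ord0) 1) measurableT mA; rewrite setIT => <-.
    apply: eq_integral => x _; rewrite indicE.
    have c0 y : cdot m' v' y = 0 by rewrite /cdot big1// => k _; rewrite v'k mul0r.
    have [hx|hx] := pselect (r <= a * (x - m ord0)).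
      rewrite (@mem_set _ [set x | r <= a * (x - m ord0)] x hx) (_ : [set y | _] = setT) ?probability_setT//.
      by apply/seteqP; split => // y _ /=; rewrite cE c0 addr0.
    rewrite (@memNset _ [set x | r <= a * (x - m ord0)] x hx) (_ : [set y | _] = set0) ?measure0//.
    by apply/seteqP; split => // y /=; rewrite cE c0 addr0.
  move/eqP: as2; rewrite eqf_sqr => /orP[/eqP as1|/eqP as1].
    rewrite as1 -(normal_ge (m ord0)); rewrite nprobE; congr (normal_prob _ _ _).
    by apply/seteqP; split => x /=; rewrite in_itv/= andbT -lerBrDr ler_pdivrMr// mulrC.
  rewrite as1 -(normal_le (m ord0)); rewrite nprobE; congr (normal_prob _ _ _).
  apply/seteqP; split => x /=; rewrite in_itv/= mulNr -mulrN opprB lerBrDl -lerBrDr ler_pdivrMr// mulrC//.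
have : 0 < \sum_(k < d) v' k ^+ 2.
  by rewrite lt_def v'0 sumr_ge0// => k _; exact: sqr_ge0.
set q := \sum_(k < d) v' k ^+ 2 => q0.
pose s' := Num.sqrt q.
have s'0 : 0 < s' by rewrite sqrtr_gt0.
have s'2 : q = s' ^+ 2 by rewrite sqr_sqrtr// ltW.
have ss' : s ^+ 2 = a ^+ 2 + s' ^+ 2 by rewrite -s'2 -vs.
pose D : set R := `[r / s, +oo[%classic.
have mD : measurable D by exact: measurable_itv.
(* The conditional density, given the first coordinate [x], of [cdot m v] divided by [s], restricted
   to the tail event. *)
pose F (x u : R) : R := normal_pdf 0 1 (s / s' * u + (- (a * (x - m ord0)) / s')) * (s / s') * \1_D u.
have F0 x u : 0 <= F x u by rewrite !mulr_ge0 ?normal_pdf_ge0 ?invr_ge0// ltW.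
have mF : measurable_fun [set: R * measurableTypeR R] (fun xu => (F xu.1 xu.2)%:E).
  apply/measurable_EFinP; apply: measurable_funM => //; last first.
    exact: (measurableT_comp (measurable_indic mD)).
  apply: measurable_funM => //.
  apply: measurableT_comp; first exact: measurable_normal_pdf.
  apply: measurable_funD; first by apply: measurable_funM.
  apply: measurable_funM => //; apply: measurableT_comp => //.
  by apply: measurable_funM => //; exact: measurable_funB.
(* [mF] again, with the first factor in the structure that carries [normal_prob]. *)
have mF' : measurable_fun [set: measurableTypeR R * measurableTypeR R] (fun xu => (F xu.1 xu.2)%:E).
  apply/measurable_EFinP; apply: measurable_funM => //; last first.
    exact: (measurableT_comp (measurable_indic mD)).
  apply: measurable_funM => //.
  apply: measurableT_comp; first exact: measurable_normal_pdf.
  apply: measurable_funD; first by apply: measurable_funM.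
  apply: measurable_funM => //; apply: measurableT_comp => //.
  by apply: measurable_funM => //; exact: measurable_funB.
transitivity (\int[nprob (m ord0) 1]_x \int[leb]_u (F x u)%:E)%E.
  apply: eq_integral => x _.
  transitivity (gauss_vec m' [set y | r - a * (x - m ord0) <= cdot m' v' y]).
    by congr (gauss_vec m' _); apply/seteqP; split => y /=; rewrite cE lerBlDl.
  rewrite (IH _ _ _ s')// gtailE /normal_prob.
  have -> : (r - a * (x - m ord0)) / s' = s / s' * (r / s) + (- (a * (x - m ord0)) / s').
    by field; rewrite !gt_eqF.
  rewrite tail_affine_subst ?divr_gt0//.
  - rewrite integral_mkcond; apply: eq_integral => u _.
    by rewrite epatch_indic -EFinM.
  - by apply: continuous_normal_pdf; exact: oner_neq0.
  - by move=> y; exact: normal_pdf_ge0.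
rewrite integral_nprob; last 2 first.
- by apply: (measurable_fun_fubini_tonelli_F (m2 := leb) _ mF) => xu; rewrite lee_fin.
- by move=> x; apply: integral_ge0 => u _; rewrite lee_fin.
rewrite integral_normal; last 2 first.
- by apply: (measurable_fun_fubini_tonelli_F (m2 := leb) _ mF') => xu; rewrite lee_fin.
- by move=> x; apply: integral_ge0 => u _; rewrite lee_fin.
pose G (xu : measurableTypeR R * measurableTypeR R) := (F xu.1 xu.2 * normal_pdf (m ord0) 1 xu.1)%:E.
have mG : measurable_fun setT G.
  apply/measurable_EFinP; apply: measurable_funM; first exact/measurable_EFinP.
  by apply: measurableT_comp; first exact: measurable_normal_pdf.
have G0 xu : (0 <= G xu)%E by rewrite lee_fin mulr_ge0// normal_pdf_ge0.
transitivity (\int[leb]_x \int[leb]_u G (x, u))%E.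
  apply: eq_integral => x _; rewrite -ge0_integralZr ?lee_fin ?normal_pdf_ge0//.
  - exact: (measurable_fun_pair2 x mF').
  - by move=> u _; rewrite lee_fin.
rewrite (fubini_tonelli G)// gtailE /normal_prob [RHS]integral_mkcond.
apply: eq_integral => u _; rewrite epatch_indic.
transitivity (\int[leb]_x ((normal_pdf 0 1 u * \1_D u)%:E * (normal_pdf (m ord0 + a * u / s) (s' / s) x)%:E))%E.
  apply: eq_integral => x _; rewrite -EFinM /G /F /=; congr EFin.
  have k0 : 0 < s' / s by rewrite divr_gt0.
  rewrite !normal_pdfE ?gt_eqF ?oner_neq0//= (normal_peak_scale k0).
  have XYZW := @normal_fun_rotate (m ord0) s s' a x u s0 s'0 ss'.
  set c := normal_peak 1; set X := normal_fun _ _ _ in XYZW *; set Y := normal_fun _ _ _ in XYZW *.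
  set Z := normal_fun _ _ _ in XYZW *; set W := normal_fun _ _ _ in XYZW *.
  transitivity (c * c * (s / s') * \1_D u * (X * Y)); first by ring.
  by rewrite XYZW invf_div; ring.
rewrite ge0_integralZl ?lee_fin ?mulr_ge0 ?normal_pdf_ge0//.
- by rewrite integral_normal_pdf mule1 EFinM.
- by apply/measurable_EFinP; exact: measurable_normal_pdf.
- by move=> x _; rewrite lee_fin normal_pdf_ge0.
Qed.

End GaussVec.

(** * Bernstein's inequality for empirical counts *)

Section Chernoff.
Context {d0 : measure_display} {T : measurableType d0} {R : realType}.
Variables (n : nat) (P : probability T R) (g : pred 'I_n).
Notation Q := (tuple_product (fun _ : 'I_n => P)).

Lemma measurable_tuple_sum_ge (f : T -> R) (x : R) : measurable_fun setT f ->
  measurable [set t : n.-tuple T | x <= \sum_(i < n | g i) f (tnth t i)].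
Proof.
move=> mf; rewrite -[X in measurable X]setTI.
rewrite (_ : [set t | _] = (fun t : n.-tuple T => \sum_(i < n | g i) f (tnth t i)) @^-1` `[x, +oo[%classic).
  have mS : measurable_fun setT (fun t : n.-tuple T => \sum_(i < n) (if g i then f (tnth t i) else 0)).
    apply: measurable_sum => i; case: (g i) => //.
    by apply: measurableT_comp => //; exact: measurable_tnth.
  under [X in X @^-1` _]eq_fun do rewrite big_mkcond.
  exact: mS.
by apply/seteqP; split => t /=; rewrite in_itv/= andbT.
Qed.

Lemma chernoff (f : T -> R) (c x : R) : measurable_fun setT f ->
  (\int[P]_x (expR (f x))%:E <= c%:E)%E ->
  (Q [set t | (x <= \sum_(i < n | g i) f (tnth t i))%R] <= (expR (- x) * c ^+ #|g|)%:E)%E.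
Proof.
move=> mf fc.
have mE : measurable_fun setT (fun y => expR (f y)) by exact: measurableT_comp.
pose C := fine (\int[P]_x (expR (f x))%:E).
have C0 : (0 <= \int[P]_x (expR (f x))%:E)%E by apply: integral_ge0 => y _; rewrite lee_fin expR_ge0.
have CE : (\int[P]_x (expR (f x))%:E = C%:E)%E.
  by rewrite fineK// ge0_fin_numE// (le_lt_trans fc)// ltry.
(* Samples outside [g] contribute the factor 1, so the exponent of the final bound is the size of
   [g]. *)
pose F (i : 'I_n) (y : T) : R := if g i then expR (f y) else 1.
have mF i : measurable_fun setT (F i) by rewrite /F; case: (g i).
have F0 i y : 0 <= F i y by rewrite /F; case: (g i) => //; exact: expR_ge0.
have intF := @integral_tuple_product _ T R n (fun _ => P) F (fun i => if g i then C else 1) mF F0.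
have prodF (t : n.-tuple T) : \prod_(i < n) F i (tnth t i) = expR (\sum_(i < n | g i) f (tnth t i)).
  by rewrite /F -big_mkcond/= expR_sum.
have := integral_indic Q measurableT (measurable_tuple_sum_ge x mf); rewrite setIT => <-.
apply: (@le_trans _ _ (\int[Q]_t ((expR (- x))%:E * (\prod_(i < n) F i (tnth t i))%:E))%E).
  apply: ge0_le_integral => //.
  - by apply/measurable_EFinP/measurable_indic; exact: measurable_tuple_sum_ge.
  - by apply: emeasurable_funM => //; apply/measurable_EFinP; exact: measurable_tuple_prod.
  - move=> t _; rewrite -EFinM lee_fin prodF -expRD.
    have [h|h] := pselect ([set t : n.-tuple T | x <= \sum_(i < n | g i) f (tnth t i)] t).
      rewrite indicE (mem_set h) -[leLHS]expR0 ler_expR addrC subr_ge0; exact: h.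
    by rewrite indicE (memNset h) expR_ge0.
rewrite ge0_integralZl ?lee_fin ?expR_ge0//; last 2 first.
- by apply/measurable_EFinP; exact: measurable_tuple_prod.
- by move=> t _; rewrite lee_fin prodr_ge0.
rewrite intF; last first.
  move=> i; rewrite /F; case: (g i) => //.
  by rewrite integral_cst// mul1e; exact: probability_setT.
rewrite -EFinM lee_fin ler_pM2l ?expR_gt0// -big_mkcond/= prodr_const.
by rewrite lerXn2r ?nnegrE ?fine_ge0// -lee_fin -?CE// (le_trans C0).
Qed.

(** From exp(- y) >= 1 - y and (1 + y + 2 y^2)(1 - y) = 1 + y^2 (1 - 2 y). *)
Lemma expR_le_quadratic (y : R) : y <= 2^-1 -> expR y <= 1 + y + 2 * y ^+ 2.
Proof.
move=> y2; rewrite -[y in expR y]opprK expRN.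
have h : 0 < 1 - y by lra.
apply: (@le_trans _ _ (1 - y)^-1).
  by rewrite lef_pV2 ?posrE ?expR_gt0//; have := expR_ge1Dx (- y).
rewrite -[leLHS]mul1r ler_pdivrMr//.
have : 0 <= y ^+ 2 * (1 - 2 * y) by rewrite mulr_ge0 ?sqr_ge0//; lra.
nra.
Qed.

(** The square of the difference of the indicators is the indicator of the symmetric difference, so
    the quadratic term carries the small probability [q]. *)
Lemma indic_diff_mgf (A B : set T) (s q : R) : measurable A -> measurable B ->
  0 <= s <= 2^-1 -> (P ((A `\` B) `|` (B `\` A)) <= q%:E)%E ->
  (\int[P]_x (expR (s * (\1_A x - \1_B x)))%:E <=
    (expR (s * (fine (P A) - fine (P B)) + 2 * s ^+ 2 * q))%:E)%E.
Proof.
move=> mA mB /andP[s0 s2] Pq.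
have mD : measurable ((A `\` B) `|` (B `\` A)) by apply: measurableU; exact: measurableD.
have m1 : measurable_fun setT (fun x => (expR (s * (\1_A x - \1_B x)))%:E).
  apply/measurable_EFinP; apply: measurableT_comp => //; apply: measurable_funM => //.
  exact: measurable_funB.
have mi (C : set T) : measurable C -> measurable_fun setT (fun x => (s * \1_C x : R)%:E).
  by move=> mC; apply/measurable_EFinP; exact: measurable_funM.
have intk (k : R) (C : set T) : 0 <= k -> measurable C -> (\int[P]_x (k * \1_C x)%:E = (k * fine (P C))%:E)%E.
  move=> k0 mC; under eq_integral do rewrite EFinM.
  rewrite ge0_integralZl//; last by apply/measurable_EFinP; exact: measurable_indic.
  by rewrite integral_indic// setIT EFinM fineK ?fin_num_measure.
(* The term for [B] is moved to the left, so that all integrands stay nonnegative. *)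
have key : (\int[P]_x (expR (s * (\1_A x - \1_B x)))%:E + (s * fine (P B))%:E <=
  (1 + s * fine (P A) + 2 * s ^+ 2 * q)%:E)%E.
  rewrite -intk// -ge0_integralD//; last 2 first.
  - by move=> x _; rewrite lee_fin mulr_ge0.
  - exact: mi.
  apply: (@le_trans _ _ (\int[P]_x (1%:E + (s * \1_A x)%:E + (2 * s ^+ 2 * \1_((A `\` B) `|` (B `\` A)) x)%:E))%E).
    apply: ge0_le_integral => //.
    - by move=> x _; rewrite adde_ge0// lee_fin ?expR_ge0// mulr_ge0.
    - exact: emeasurable_funD (m1) (mi _ mB).
    - apply: emeasurable_funD; last by apply/measurable_EFinP; apply: measurable_funM.
      by apply: emeasurable_funD => //; exact: mi.
    - move=> x _; rewrite -!EFinD lee_fin.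
      have yb : s * (\1_A x - \1_B x) <= 2^-1.
        rewrite !indicE; case: (x \in A); case: (x \in B); rewrite /=; lra.
      have h := expR_le_quadratic yb.
      have e2 : (\1_A x - \1_B x) ^+ 2 = \1_((A `\` B) `|` (B `\` A)) x :> R.
        rewrite !indicE in_setU !in_setD; case: (x \in A); case: (x \in B); rewrite /=; lra.
      by move: h; rewrite exprMn -e2; lra.
  rewrite ge0_integralD//; last 4 first.
  - by move=> x _; rewrite adde_ge0// lee_fin mulr_ge0.
  - by apply: emeasurable_funD => //; exact: mi.
  - by move=> x _; rewrite lee_fin mulr_ge0// mulr_ge0// sqr_ge0.
  - by apply/measurable_EFinP; apply: measurable_funM.
  rewrite ge0_integralD//; last 2 first.
  - by move=> x _; rewrite lee_fin mulr_ge0.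
  - exact: mi.
  have one : (\int[P]_x 1%:E = 1%E)%E by rewrite integral_cst// mul1e; exact: probability_setT.
  rewrite one !intk ?mulr_ge0 ?sqr_ge0// -!EFinD lee_fin.
  rewrite lerD2l ler_wpM2l ?mulr_ge0 ?sqr_ge0//.
  by rewrite -lee_fin fineK ?fin_num_measure.
move: key; case: (integral _ _ _) => [r| |].
- rewrite -EFinD !lee_fin => h; apply: le_trans (expR_ge1Dx _); lra.
- by rewrite addye// leye_eq.
- by move=> _; rewrite leNye.
Qed.

(* Taking [B = set0] gives the count of a single event. *)
Lemma indic_diff_bernstein (A B : set T) (s q x : R) : measurable A -> measurable B ->
  0 <= s <= 2^-1 -> (P ((A `\` B) `|` (B `\` A)) <= q%:E)%E ->
  (Q [set t | (#|g|%:R * (fine (P A) - fine (P B)) + x <= \sum_(i < n | g i) (\1_A (tnth t i) - \1_B (tnth t i)))%R]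
    <= (expR (- s * x + 2 * s ^+ 2 * q * #|g|%:R))%:E)%E.
Proof.
move=> mA mB s12 Pq; have /andP[s0 s2] := s12.
have [->|sn0] := eqVneq s 0.
  rewrite oppr0 expr0n/= mulr0 !mul0r addr0 expR0; apply: probability_le1.
  apply: (@measurable_tuple_sum_ge (fun y => \1_A y - \1_B y)); exact: measurable_funB.
have sp : 0 < s by rewrite lt_def sn0.
set p := fine (P A) - fine (P B).
have mf : measurable_fun setT (fun y => s * (\1_A y - \1_B y) : R).
  by apply: measurable_funM => //; exact: measurable_funB.
have := @chernoff (fun y => s * (\1_A y - \1_B y)) _ (s * (#|g|%:R * p + x)) mf (indic_diff_mgf mA mB s12 Pq).
rewrite -/p -expRM_natl -expRD (_ : [set t | _] =
  [set t : n.-tuple T | #|g|%:R * p + x <= \sum_(i < n | g i) (\1_A (tnth t i) - \1_B (tnth t i))]).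
  move=> /le_trans; apply; rewrite lee_fin ler_expR le_eqVlt; apply/orP; left; apply/eqP; ring.
by apply/seteqP; split => t /=; rewrite -mulr_sumr ler_pM2l.
Qed.

End Chernoff.

(** * Nets of the sphere and chaining *)

Section Net.
Context {R : realType}.

(** Half of Stirling's formula, by induction from (1 + 1/d)^d <= e. *)
Lemma natpow_le_fact d : (d%:R ^+ d : R) <= expR 1 ^+ d * (d`!)%:R.
Proof.
elim: d => [|d IH]; first by rewrite !expr0 mul1r.
have [->|d0] := eqVneq d 0%N.
  by rewrite expr1 mulr1; have := expR_ge1Dx (1 : R); lra.
have dp : 0 < (d%:R : R) by rewrite ltr0n lt0n.
have h : d.+1%:R ^+ d <= expR 1 * d%:R ^+ d :> R.
  have -> : (d.+1%:R : R) = d%:R * (1 + d%:R^-1).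
    by rewrite -natr1 mulrDr mulr1 divff ?gt_eqF.
  rewrite exprMn mulrC ler_pM2r ?exprn_gt0//.
  have -> : expR 1 = expR (d%:R^-1) ^+ d :> R by rewrite -expRM_natl mulfV ?gt_eqF.
  by apply: lerXn2r; rewrite ?nnegrE ?expR_ge0 ?addr_ge0 ?invr_ge0//; exact: expR_ge1Dx.
rewrite exprS factS natrM exprS mulrACA.
rewrite (le_trans (ler_wpM2l _ h))//.
set E := expR 1; set F := (d`!)%:R; set D := d%:R ^+ d; set N := d.+1%:R.
have -> : N * (E * D) = E * N * D by ring.
by rewrite ler_wpM2l// mulr_ge0 ?expR_ge0.
Qed.

Lemma ffact_le_exp (n m : nat) : (n ^_ m <= n ^ m)%N.
Proof.
elim: m n => [|m IH] n //; rewrite ffactnS expnS leq_mul2l (leq_trans (IH _)) ?orbT//.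
by case: m {IH} => // m; rewrite leq_exp2r// leq_pred.
Qed.

Lemma bin_entropy d M : ('C(d + d * M, d)%:R : R) <= (expR 1 * (M.+1)%:R) ^+ d.
Proof.
have h : ('C(d + d * M, d) * d`! <= (d * M.+1) ^ d)%N.
  by rewrite bin_ffact mulnS ffact_le_exp.
rewrite -(ler_pM2r (x := (d`!)%:R)) ?ltr0n ?fact_gt0// -natrM.
apply: (@le_trans _ _ ((d * M.+1) ^ d)%:R); first by rewrite ler_nat.
rewrite natrX natrM !exprMn; have := natpow_le_fact d.
set E := expR 1 ^+ d; set F := (d`!)%:R; set D := d%:R ^+ d; set N := M.+1%:R ^+ d => h1.
have -> : E * N * F = (E * F) * N by ring.
by rewrite ler_wpM2r// exprn_ge0.
Qed.

(** The net comes from counting, not from volumes: record the signs of v and the integer parts of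
    |v_j| w with w = M sqrt d. These integers have sum at most d M, so there are at most 2^d C(d + d
    M, d) cells. One unit vector is kept per cell; two vectors of a cell differ by at most 1/w in
    each coordinate, hence by 1/M in norm. The constant uses 2 (M + 1) <= 4 M. *)
Lemma sphere_net d M : (0 < d)%N -> (0 < M)%N ->
  exists (I : finType) (u : I -> 'I_d -> R),
  [/\ forall i, dotp (u i) (u i) = 1,
     (#|I|%:R : R) <= (4 * expR 1 * M%:R) ^+ d &
     forall v : 'I_d -> R, dotp v v = 1 -> exists i, sqdist v (u i) <= (M%:R^-1) ^+ 2].
Proof.
move=> d0 M0; pose S := (d * M)%N.
pose I := {x : d.-tuple 'I_S.+1 * {ffun 'I_d -> bool} | (\sum_(i <- x.1) i <= S)%N}.
pose w : R := M%:R * Num.sqrt d%:R.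
have dp : 0 < (d%:R : R) by rewrite ltr0n.
have Mp : 0 < (M%:R : R) by rewrite ltr0n.
have w0 : 0 < w by rewrite mulr_gt0 ?sqrtr_gt0.
pose incell (v : 'I_d -> R) (x : d.-tuple 'I_S.+1 * {ffun 'I_d -> bool}) :=
  dotp v v = 1 /\ forall j, (tnth x.1 j : nat) = Num.truncn (`|v j| * w) /\ x.2 j = (0 <= v j).
pose e0 : 'I_d -> R := fun j => if j == Ordinal d0 then 1 else 0.
have e01 : dotp e0 e0 = 1.
  rewrite /dotp (bigD1 (Ordinal d0))//= big1 ?addr0 /e0 ?eqxx ?mulr1//.
  by move=> j /negbTE ->; rewrite mulr0.
(* Cells that miss the sphere get the default [e0]. *)
have /choice[u uP] : forall i : I, exists y : 'I_d -> R, dotp y y = 1 /\ ((exists v, incell v (val i)) -> incell y (val i)).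
  move=> i.
  have [[v hv]|h] := pselect (exists v, incell v (val i)); first by exists v; split => //; case: hv.
  by exists e0.
exists I, u; split.
- by move=> i; have [] := uP i.
- rewrite card_sig.
  rewrite (_ : #|_| = #|finset.setX [set t : d.-tuple 'I_S.+1 | (\sum_(i <- t) i <= S)%N]%SET [set: {ffun 'I_d -> bool}]%SET|); last first.
    by apply: eq_card => x; rewrite !inE andbT.
  rewrite cardsX card_partial_ord_partitions cardsT card_ffun card_bool card_ord natrM natrX.
  rewrite (le_trans (ler_wpM2r _ (bin_entropy d M)))// -exprMn lerXn2r ?nnegrE ?mulr_ge0 ?expR_ge0//.
  rewrite mulrAC [leRHS]mulrAC -[leLHS]mulrA [leLHS]mulrC ler_wpM2r ?expR_ge0//.
  by rewrite -natrM -natrM ler_nat -[4%N]/(2 * 2)%N -mulnA leq_mul2l /= mul2n -addnn -addn1 leq_add2l.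
- move=> v v1.
  pose a j := Num.truncn (`|v j| * w).
  (* From |v_j| sqrt d <= (d v_j^2 + 1) / 2, summed over a unit vector. *)
  have ab : \sum_(j < d) (a j)%:R <= S%:R :> R.
    apply: (@le_trans _ _ (\sum_(j < d) (M%:R * (d%:R * v j ^+ 2 + 1) / 2))).
      apply: ler_sum => j _; apply: (@le_trans _ _ (`|v j| * w)).
        by rewrite truncn_le mulr_ge0// ltW.
      rewrite /w mulrCA -mulrA; apply: (ler_wpM2l (ltW Mp)).
      have -> : d%:R * v j ^+ 2 = (`|v j| * Num.sqrt d%:R) ^+ 2.
        by rewrite exprMn sqr_sqrtr ?real_normK ?num_real// 1?mulrC// ltW.
      have := sqr_ge0 (`|v j| * Num.sqrt d%:R - 1); rewrite sqrrB1; lra.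
    rewrite -mulr_suml -mulr_sumr big_split/= -mulr_sumr.
    have -> : \sum_(i < d) v i ^+ 2 = 1 by rewrite -v1; apply: eq_bigr => i _; rewrite expr2.
    rewrite sumr_const card_ord mulr1 natrM le_eqVlt; apply/orP; left; apply/eqP; by field.
  have aS j : (a j < S.+1)%N.
    rewrite ltnS -(ler_nat R); apply: le_trans ab.
    by rewrite (bigD1 j)//= lerDl sumr_ge0.
  pose x : d.-tuple 'I_S.+1 * {ffun 'I_d -> bool} := ([tuple Ordinal (aS j) | j < d], [ffun j => 0 <= v j]).
  have xS : (\sum_(i <- x.1) i <= S)%N.
    rewrite (_ : (\sum_(i <- x.1) i)%N = (\sum_(j < d) a j)%N).
      by rewrite -(ler_nat R) natr_sum.
    by rewrite big_tuple; apply: eq_bigr => j _; rewrite tnth_mktuple.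
  pose i : I := Sub x xS.
  have vi : incell v (val i) by split => // j; rewrite /= tnth_mktuple ffunE.
  exists i; have [_ /(_ (ex_intro _ v vi)) [_ ui]] := uP i.
  rewrite /sqdist (@le_trans _ _ (\sum_(k < d) w^-1 ^+ 2))//; last first.
    have wd : (w^-1 ^+ 2) *+ d = M%:R^-1 ^+ 2.
      rewrite -[LHS]mulr_natl /w exprVn exprMn sqr_sqrtr ?(ltW dp)//.
      by field; rewrite !gt_eqF.
    by rewrite sumr_const card_ord wd.
  apply: ler_sum => k _; rewrite -[(v k - u i k)^+2]real_normK ?num_real//.
  rewrite lerXn2r ?nnegrE ?invr_ge0 ?(ltW w0)//.
  have [_ /(_ k) [vk sk]] := vi; have [uk tk] := ui k.
  have wv := @truncn_itv R (`|v k| * w) (mulr_ge0 (normr_ge0 _) (ltW w0)).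
  have wu := @truncn_itv R (`|u i k| * w) (mulr_ge0 (normr_ge0 _) (ltW w0)).
  rewrite -uk vk in wu; move: wv wu => /andP[v1' v2'] /andP[u1' u2'].
  have hw : `| `|v k| - `|u i k| | < w^-1.
    rewrite -(ltr_pM2r w0) mulVf ?gt_eqF// -[X in _ * X](gtr0_norm w0) -normrM mulrBl ltr_norml.
    move: v1' v2' u1' u2'; rewrite -natr1; lra.
  (* The signs agree within a cell, so closeness of absolute values is closeness of coordinates. *)
  apply: ltW; move: hw; rewrite sk in tk.
  have [vk0|vk0] := leP 0 (v k).
    by move: tk; rewrite vk0 => /esym uk0; rewrite (ger0_norm vk0) (ger0_norm uk0).
  have uk0 : u i k < 0 by rewrite ltNge -tk -ltNge.
  by rewrite (ltr0_norm vk0) (ltr0_norm uk0) -normrN; congr (`|_| < _); ring.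
Qed.
End Net.

Section HalfSpace.
Context {R : realType}.
Variables (d : nat) (m : 'I_d -> R).
Notation P := (gauss_vec m).

Definition halfspace (v : 'I_d -> R) (r : R) : set (d.-tuple R) := [set x | r <= cdot m v x].

Lemma measurable_halfspace v r : measurable (halfspace v r).
Proof. exact: measurable_cdot_ge. Qed.

Lemma dotp_sumsq (v : 'I_d -> R) : dotp v v = \sum_(k < d) v k ^+ 2.
Proof. by apply: eq_bigr => k _; rewrite expr2. Qed.

Lemma dotp_ge0 (v : 'I_d -> R) : 0 <= dotp v v.
Proof. by rewrite dotp_sumsq sumr_ge0// => k _; exact: sqr_ge0. Qed.

Lemma sqdist_dotp (u v : 'I_d -> R) : sqdist u v = dotp (fun k => u k - v k) (fun k => u k - v k).
Proof. by rewrite dotp_sumsq. Qed.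

Lemma halfspace_unit v r : dotp v v = 1 -> P (halfspace v r) = (gtail r)%:E.
Proof. by move=> v1; rewrite (gauss_vec_tail m r ltr01) ?divr1// -dotp_sumsq v1 expr1n. Qed.

Lemma cdotB (u w : 'I_d -> R) x : cdot m (fun k => u k - w k) x = cdot m u x - cdot m w x.
Proof. by rewrite /cdot -sumrB; apply: eq_bigr => k _; rewrite mulrBl. Qed.

Lemma cdotZ (c : R) (u : 'I_d -> R) x : cdot m (fun k => c * u k) x = c * cdot m u x.
Proof. by rewrite /cdot mulr_sumr; apply: eq_bigr => k _; rewrite mulrA. Qed.

Lemma expR_half_le2 : expR (2^-1) <= 2 :> R.
Proof. by apply: le_trans (expR_le_quadratic (lexx _)) _; lra. Qed.

Lemma gtail_inv (a y : R) : 0 < a -> a^-1 <= y -> gtail y <= 2 * a.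
Proof.
move=> a0 ay; apply: le_trans (gtail_nincr ay) _; apply: le_trans (gtail_exp _) _.
rewrite expRD expRN; apply: ler_pM; rewrite ?expR_ge0 ?invr_ge0 ?expR_ge0 ?expR_half_le2//.
rewrite -[leRHS]invrK lef_pV2 ?posrE ?expR_gt0 ?invr_gt0//.
by have := expR_ge1Dx a^-1; lra.
Qed.

(** A point of the difference has projection at least [a] on u - w, or projection on w in [r - a,
    r). Since u - w has norm at most a^2, the first has probability at most gtail(1/a) <= 2 a; the
    second has at most [a]. *)
Lemma halfspace_setD (u w : 'I_d -> R) (a r : R) : 0 < a -> dotp u u = 1 -> dotp w w = 1 ->
  sqdist u w <= (a ^+ 2) ^+ 2 -> (P (halfspace u r `\` halfspace w r) <= (3 * a)%:E)%E.
Proof.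
move=> a0 u1 w1 uw; pose z k := u k - w k.
have mz : measurable (halfspace z a) by exact: measurable_halfspace.
have Pz : (P (halfspace z a) <= (2 * a)%:E)%E.
  have [z0|z0] := eqVneq (dotp z z) 0.
    rewrite (_ : halfspace z a = set0) ?measure0 ?lee_fin; first by rewrite mulr_ge0// ltW.
    apply/seteqP; split => // x; rewrite /halfspace/= /cdot big1 => [|k _].
      by move=> /(lt_le_trans a0); rewrite ltxx.
    move: z0; rewrite dotp_sumsq => /eqP; rewrite psumr_eq0; last by move=> i _; exact: sqr_ge0.
    by move/allP/(_ k (mem_index_enum _)); rewrite /= sqrf_eq0 => /eqP ->; rewrite mul0r.
  have zp : 0 < dotp z z by rewrite lt_def z0 dotp_ge0.
  have sp : 0 < Num.sqrt (dotp z z) by rewrite sqrtr_gt0.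
  rewrite (gauss_vec_tail m a sp) ?lee_fin; last by rewrite sqr_sqrtr ?dotp_ge0// dotp_sumsq.
  apply: gtail_inv => //; rewrite ler_pdivlMr// mulrC ler_pdivrMr//.
  rewrite -expr2 -(ler_pXn2r (n := 2)) ?nnegrE ?sqrtr_ge0 ?sqr_ge0//.
  by rewrite sqr_sqrtr ?dotp_ge0// -sqdist_dotp.
have Pw : (P (halfspace w (r - a) `\` halfspace w r) <= a%:E)%E.
  have Pr1 := halfspace_unit (r - a) w1; have Pr := halfspace_unit r w1.
  rewrite measureD; try exact: measurable_halfspace; last first.
    by apply: (le_lt_trans (probability_le1 _ _) (ltry _)); exact: measurable_halfspace.
  rewrite (_ : _ `&` _ = halfspace w r).
    by move: Pr1 Pr => /= -> ->; rewrite -EFinB lee_fin lerBlDl gtail_lip// ltW.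
  apply/seteqP; split => x /=; first by case.
  by rewrite /halfspace/= => h; split => //; apply: le_trans h; rewrite gerBl ltW.
apply: (@le_trans _ _ (P (halfspace z a `|` (halfspace w (r - a) `\` halfspace w r)))).
  apply: le_measure; rewrite ?inE.
  - by apply: measurableD; exact: measurable_halfspace.
  - by apply: measurableU => //; apply: measurableD; exact: measurable_halfspace.
  - move=> x [/= ux wx]; have [h|h] := leP a (cdot m z x); first by left.
    right; split => //; move: h ux; rewrite /halfspace/= cdotB; lra.
apply: (@le_trans _ _ (P (halfspace z a) + P (halfspace w (r - a) `\` halfspace w r))%E).
  by apply: measureU2 => //; apply: measurableD; exact: measurable_halfspace.
by rewrite (_ : 3 * a = 2 * a + a) ?EFinD ?leeD//; ring.
Qed.

Lemma halfspace_symdiff (u w : 'I_d -> R) (a r : R) : 0 < a -> dotp u u = 1 -> dotp w w = 1 ->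
  sqdist u w <= (a ^+ 2) ^+ 2 ->
  (P ((halfspace u r `\` halfspace w r) `|` (halfspace w r `\` halfspace u r)) <= (6 * a)%:E)%E.
Proof.
move=> a0 u1 w1 uw.
apply: (@le_trans _ _ (P (halfspace u r `\` halfspace w r) + P (halfspace w r `\` halfspace u r))%E).
  by apply: measureU2; apply: measurableD; exact: measurable_halfspace.
rewrite (_ : 6 * a = 3 * a + 3 * a); last by ring.
rewrite EFinD leeD ?halfspace_setD//.
by rewrite (_ : sqdist w u = sqdist u w)//; apply: eq_bigr => k _; rewrite -sqrrN opprB.
Qed.

Lemma gauss_vec_mgf (v : 'I_d -> R) : dotp v v = 1 ->
  (\int[P]_x (expR (cdot m v x))%:E = (expR (2^-1))%:E)%E.
Proof.
move=> v1.
have := @integral_tuple_product _ _ R d (fun k => nprob (m k) 1) (fun k y => expR (v k * (y - m k)))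
  (fun k => expR (v k ^+ 2 / 2)).
rewrite -expR_sum -mulr_suml -dotp_sumsq v1 mul1r => <-.
- by apply: eq_integral => x _; rewrite -expR_sum.
- by move=> k; apply: measurableT_comp => //; apply: measurable_funM => //; exact: measurable_funB.
- by move=> k y; exact: expR_ge0.
- move=> k; rewrite integral_nprob ?normal_mgf//; last 1 first.
    apply/measurable_EFinP; apply: measurableT_comp => //; apply: measurable_funM => //; exact: measurable_funB.
Qed.

(** exp|y| <= exp(y) + exp(- y), and 2 exp(1/2) <= exp(2). *)
Lemma gauss_vec_abs_mgf (v : 'I_d -> R) : dotp v v = 1 ->
  (\int[P]_x (expR `|cdot m v x|)%:E <= (expR 2)%:E)%E.
Proof.
move=> v1; pose v' k := - 1 * v k.
have v'1 : dotp v' v' = 1 by rewrite -v1; apply: eq_bigr => k _; rewrite /v'; ring.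
have mc w : measurable_fun setT (fun x => (expR (cdot m w x))%:E).
  by apply/measurable_EFinP; apply: measurableT_comp => //; exact: measurable_cdot.
apply: (@le_trans _ _ (\int[P]_x ((expR (cdot m v x))%:E + (expR (cdot m v' x))%:E))%E).
  apply: ge0_le_integral => //.
  - apply/measurable_EFinP; apply: measurableT_comp => //; apply: measurableT_comp => //; exact: measurable_cdot.
  - exact: emeasurable_funD.
  - move=> x _; rewrite -EFinD lee_fin cdotZ mulN1r.
    by case: (ger0P (cdot m v x)) => _; rewrite ?lerDl ?lerDr expR_ge0.
rewrite ge0_integralD//.
rewrite !gauss_vec_mgf// -EFinD lee_fin (_ : 2 = 1 + 1 :> R)//.
have h1 := expR_half_le2; have h2 := expR_ge1Dx (1 : R).
rewrite expRD (_ : 1 + 1 = 2 :> R)//; nra.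
Qed.

Lemma measure_exists_le dd (T : measurableType dd) (Q : probability T R) (I : finType) (A : I -> set T) (c : R) :
  (forall i, measurable (A i)) -> (forall i, (Q (A i) <= c%:E)%E) ->
  (Q [set t | exists i, A i t] <= (#|I|%:R * c)%:E)%E.
Proof.
move=> mA Ac.
suff h (s : seq I) : measurable [set t | exists2 i, i \in s & A i t] /\
   (Q [set t | exists2 i, i \in s & A i t] <= ((size s)%:R * c)%:E)%E.
  have [_] := h (enum I); rewrite -cardE (_ : [set t | _] = [set t | exists i, A i t])//.
  by apply/seteqP; split => t /= [i]; [exists i|move=> ?; exists i => //; rewrite mem_enum].
elim: s => [|i s [ms IH]].
  rewrite (_ : [set t | _] = set0) ?measure0 ?mul0r//.
  by apply/seteqP; split => // t [].
rewrite (_ : [set t | _] = A i `|` [set t | exists2 i, i \in s & A i t]).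
  split; first exact: measurableU.
  apply: (@le_trans _ _ (Q (A i) + Q [set t | exists2 i, i \in s & A i t])%E).
    exact: measureU2.
  by rewrite /= -natr1 mulrDl mul1r addrC EFinD leeD.
apply/seteqP; split => t /=.
  by move=> [j]; rewrite inE => /orP[/eqP ->|js Aj]; [left|right; exists j].
by move=> [Ai|[j js Aj]]; [exists i => //; rewrite inE eqxx|exists j => //; rewrite inE js orbT].
Qed.

End HalfSpace.

Section Chain.
Context {R : realType}.
Variables (d n : nat) (m : 'I_d -> R) (g : pred 'I_n) (sigma : R).
Hypotheses (d0 : (0 < d)%N) (sigma0 : 0 < sigma) (sigmaN : sigma ^+ 2 * #|g|%:R = d%:R).
Notation P := (gauss_vec m).
Notation Q := (tuple_product (fun _ : 'I_n => P)).
Notation N := (#|g|%:R : R).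

Definition hcount (v : 'I_d -> R) (r : R) (t : n.-tuple (d.-tuple R)) : R :=
  \sum_(i < n | g i) \1_(halfspace m v r) (tnth t i).

Lemma expR1_le4 : expR 1 <= 4 :> R.
Proof.
have h := @expR_half_le2 R; have h0 := @expR_ge0 R (2^-1).
rewrite (_ : 1 = 2^-1 + 2^-1 :> R); last by lra.
by rewrite expRD; nra.
Qed.

(** Since 4^k >= k + 1, the exponential is at most L^((k + 1) d) with L = exp(- 1728) <= 1/1729, and
    16 L <= 1/80, 256 L <= 1/2. The bounds 2^-k / 80 add up to 1/40 over all levels. *)
Lemma net_entropy (k : nat) :
  (4 * expR 1 * (256 ^ k)%:R) ^+ d * expR (- (1728 * 4 ^+ k) * d%:R) <= 80^-1 * 2^-1 ^+ k :> R.
Proof.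
rewrite expRM_natr -exprMn natrX.
have [c hc] : exists c : R, c = 1728 by exists 1728.
have [w hw] : exists w : R, w = 256 by exists 256.
rewrite -hc -hw.
have e0 := @expR_gt0 R.
have hk : (k.+1)%:R <= 4 ^+ k :> R.
  elim: (k) => [|j IH]; first by rewrite expr0.
  rewrite exprS -natr1; have : 1 <= 4 ^+ j :> R by rewrite exprn_ege1//; lra.
  lra.
have c0 : 0 <= c by lra.
have w0 : 0 <= w by lra.
have wk0 : 0 <= w ^+ k by exact: exprn_ge0.
have e4 := expR1_le4; have e1 := e0 1.
have [L hL] : exists L : R, L = expR (- c) by exists (expR (- c)).
have L1 : expR (- (c * 4 ^+ k)) <= L ^+ k.+1.
  rewrite hL -expRM_natl ler_expR mulrN lerN2 mulrC; apply: ler_wpM2l; [exact: c0|exact: hk].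
have L0 : 0 < L by rewrite hL; exact: e0.
have L2 : L * (1 + c) <= 1.
  have h := expR_ge1Dx c; have h2 : 0 < 1 + c by lra.
  rewrite hL expRN mulrC ler_pdivrMr; last exact: e0.
  by rewrite mul1r.
have L16 : 16 * L <= 80^-1 by nra.
have Lw : w * L <= 2^-1 by nra.
have lhs0 : 0 <= 4 * expR 1 * w ^+ k.
  by apply: mulr_ge0; [lra|].
have bb : 4 * expR 1 * w ^+ k * expR (- (c * 4 ^+ k)) <= 80^-1 * 2^-1 ^+ k.
  apply: (@le_trans _ _ (16 * w ^+ k * L ^+ k.+1)).
    apply: ler_pM; [exact: lhs0|exact: expR_ge0| |exact: L1].
    by apply: ler_wpM2r; [exact: wk0|lra].
  rewrite exprS mulrACA -exprMn; apply: ler_pM; [lra| |exact: L16|].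
    by apply: exprn_ge0; apply: mulr_ge0; lra.
  by apply: lerXn2r; rewrite ?nnegrE; [apply: mulr_ge0; lra|lra|exact: Lw].
have b0 : 0 <= 4 * expR 1 * w ^+ k * expR (- (c * 4 ^+ k)).
  by apply: mulr_ge0; [exact: lhs0|exact: expR_ge0].
move: bb b0; set b := (X in X <= _) => bb b0.
apply: (le_trans _ bb); rewrite -[leRHS]expr1.
apply: ler_wiXn2l; [exact: b0| |exact: d0].
apply: (le_trans bb); have h2 : 2^-1 ^+ k <= 1 :> R by apply: exprn_ile1; lra.
have h3 : 0 <= 2^-1 ^+ k :> R by apply: exprn_ge0; lra.
nra.
Qed.

(* The union bound of one chaining level: the deviation [x = 1152 sigma 2^-k N] exceeds its
   Bernstein threshold with probability [exp (- 1728 4^k d)], which beats the squared-exponential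
   size of the net. *)
Lemma chain_level (k : nat) (I : finType) (A B : I -> set (d.-tuple R)) :
  (#|I|%:R <= (4 * expR 1 * (256 ^ k)%:R) ^+ d :> R) ->
  (forall i, measurable (A i)) -> (forall i, measurable (B i)) ->
  (forall i, (P ((A i `\` B i) `|` (B i `\` A i)) <= (96 * 16^-1 ^+ k)%:E)%E) ->
  3 * sigma * 8 ^+ k <= 2^-1 ->
  exists E : set (n.-tuple (d.-tuple R)), [/\ measurable E, (Q E <= (80^-1 * 2^-1 ^+ k)%:E)%E &
    forall t, ~ E t -> forall i,
      \sum_(j < n | g j) (\1_(A i) (tnth t j) - \1_(B i) (tnth t j)) <=
        N * (fine (P (A i)) - fine (P (B i))) + 1152 * sigma * 2^-1 ^+ k * N].
Proof.
move=> Ik mA mB PAB sk.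
(* [s] = x / (4 q N) minimises the exponent - s x + 2 s^2 q N, whose minimum is - x^2 / (8 q N). *)
pose s := 3 * sigma * 8 ^+ k; pose q := 96 * 16^-1 ^+ k : R; pose x := 1152 * sigma * 2^-1 ^+ k * N.
have s0 : 0 < s by rewrite mulr_gt0 ?exprn_gt0// mulr_gt0.
pose E i := [set t : n.-tuple (d.-tuple R) | N * (fine (P (A i)) - fine (P (B i))) + x <=
  \sum_(j < n | g j) (\1_(A i) (tnth t j) - \1_(B i) (tnth t j))].
have mE i : measurable (E i).
  by apply: (@measurable_tuple_sum_ge _ _ _ _ g (fun y => \1_(A i) y - \1_(B i) y)); apply: measurable_funB.
exists [set t | exists i, E i t]; split.
- exact: measurable_exists.
- have PE i : (Q (E i) <= (expR (- (1728 * 4 ^+ k) * d%:R))%:E)%E.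
    have := @indic_diff_bernstein _ _ _ n P g (A i) (B i) s q x (mA i) (mB i) _ (PAB i).
    rewrite (ltW s0) sk => /(_ isT) /le_trans; apply.
    rewrite lee_fin ler_expR -sigmaN le_eqVlt; apply/orP; left; apply/eqP.
    have e16 : (16^-1 : R) ^+ k = (4^-1) ^+ k * 4^-1 ^+ k by rewrite -exprMn; congr (_ ^+ _); lra.
    have e8 : (8 : R) ^+ k = 4 ^+ k * 2 ^+ k by rewrite -exprMn; congr (_ ^+ _); lra.
    have e2 : (2 : R) ^+ k * 2^-1 ^+ k = 1 by rewrite -exprMn mulfV ?expr1n.
    have e4 : (4 : R) ^+ k * 4^-1 ^+ k = 1 by rewrite -exprMn mulfV ?expr1n.
    have e22 : (2 : R) ^+ k * 2 ^+ k = 4 ^+ k by rewrite -exprMn; congr (_ ^+ _); lra.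
    rewrite /s /x /q e16 e8; move: e2 e4 e22.
    set F := 4 ^+ k; set T := 2 ^+ k; set f := 4^-1 ^+ k; set h := 2^-1 ^+ k => e2 e4 e22.
    transitivity (- 3456 * sigma ^+ 2 * F * (T * h) * N + 1728 * sigma ^+ 2 * (F * f) ^+ 2 * (T * T) * N).
      by ring.
    by rewrite e2 e4 e22; ring.
  apply: le_trans (measure_exists_le mE PE) _; rewrite lee_fin.
  apply: le_trans (net_entropy k); rewrite ler_wpM2r ?expR_ge0//.
- move=> t nE i; rewrite leNgt; apply/negP => h; apply: nE; exists i; exact: ltW.
Qed.

(** The mesh 256^-k is the square of 16^-k, as [halfspace_symdiff] requires for symmetric
    differences of probability at most 6 * 16^-k. *)
Definition is_net (k : nat) (I : finType) (u : I -> 'I_d -> R) : Prop :=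
  [/\ forall i, dotp (u i) (u i) = 1,
     (#|I|%:R : R) <= (4 * expR 1 * (256 ^ k)%:R) ^+ d &
     forall v : 'I_d -> R, dotp v v = 1 -> exists i, sqdist v (u i) <= (16^-1 ^+ k) ^+ 2 ^+ 2].

Lemma net_exists k : exists (I : finType) (u : I -> 'I_d -> R), is_net k u.
Proof.
have [I [u [u1 uI uv]]] := @sphere_net R d (256 ^ k)%N d0 (expn_gt0 _ _ ).
exists I, u; split => // v v1; have [i hi] := uv v v1; exists i; apply: le_trans hi _.
rewrite natrX -exprVn (_ : (256 : R)^-1 = 16^-1 ^+ 2); last by rewrite expr2; lra.
by rewrite (exprAC _ 2 k).
Qed.

(** 2 - 2^-k is the partial geometric sum, both for the deviations 1152 sigma 2^-j and for the
    probabilities 2^-j / 80. The condition on [K] keeps the Bernstein parameter at most 1/2 at every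
    level. *)
Lemma chain (r : R) (K : nat) : 3 * sigma * 8 ^+ K <= 2^-1 -> forall k, (k <= K)%N ->
  exists (I : finType) (u : I -> 'I_d -> R) (E : set (n.-tuple (d.-tuple R))),
  [/\ is_net k u, measurable E, (Q E <= (40^-1 - 80^-1 * 2^-1 ^+ k)%:E)%E &
    forall t, ~ E t -> forall i, hcount (u i) r t <= N * (gtail r + 1152 * sigma * (2 - 2^-1 ^+ k))].
Proof.
move=> sK; elim => [|k IH] kK.
  have [I [u nu]] := net_exists 0; have [u1 uI _] := nu.
  have s0 : 3 * sigma * 8 ^+ 0 <= 2^-1.
    apply: le_trans sK; apply: ler_wpM2l; first by rewrite mulr_ge0 ?(ltW sigma0).
    apply: ler_weXn2l => //; lra.
  (* Level 0 compares with the empty set, where the probability bound 96 is trivial. *)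
  have [|E [mE QE hE]] := @chain_level 0 I (fun i => halfspace m (u i) r) (fun=> set0) uI
     (fun i => measurable_halfspace _ _ _) (fun=> measurable0) _ s0.
    move=> i; rewrite setD0 set0D setU0 expr0 mulr1 (@le_trans _ _ 1%:E)//; last by rewrite lee_fin; lra.
    by apply: probability_le1; exact: measurable_halfspace.
  exists I, u, E; split => //.
    by apply: le_trans QE _; rewrite lee_fin !expr0; lra.
  move=> t /hE h i; apply: le_trans (le_trans _ (h i)) _.
    by rewrite /hcount; apply: ler_sum => j _; rewrite indic0 subr0.
  rewrite measure0 (halfspace_unit m r (u1 i)) /= !expr0 subr0; lra.
have [I [u [E [nu mE QE hE]]]] := IH (ltnW kK).
have [u1 uI uv] := nu.
have [I' [u' nu']] := net_exists k.+1; have [u'1 u'I _] := nu'.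
have /choice[p pP] : forall i', exists i, sqdist (u' i') (u i) <= (16^-1 ^+ k) ^+ 2 ^+ 2.
  by move=> i'; exact: uv.
have sk : 3 * sigma * 8 ^+ k.+1 <= 2^-1.
  apply: le_trans sK; apply: ler_wpM2l; first by rewrite mulr_ge0 ?(ltW sigma0).
  apply: ler_weXn2l => //; lra.
have [|E' [mE' QE' hE']] := @chain_level k.+1 I' (fun i => halfspace m (u' i) r) (fun i => halfspace m (u (p i)) r) u'I
     (fun i => measurable_halfspace _ _ _) (fun i => measurable_halfspace _ _ _) _ sk.
  move=> i; have a0 : 0 < (16^-1 : R) ^+ k by rewrite exprn_gt0// invr_gt0.
  apply: le_trans (halfspace_symdiff m r a0 (u'1 i) (u1 (p i)) (pP i)) _.
  (* 6 * 16^-k = 96 * 16^-(k+1): the origin of the 96. *)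
  by rewrite lee_fin exprS; lra.
exists I', u', (E `|` E'); split => //.
- exact: measurableU.
- apply: (@le_trans _ _ (Q E + Q E')%E); first exact: measureU2.
  apply: le_trans (leeD QE QE') _; rewrite -EFinD lee_fin exprS; lra.
- move=> t nEE i; have nE : ~ E t by move=> h; apply: nEE; left.
  have nE' : ~ E' t by move=> h; apply: nEE; right.
  have h1 := hE _ nE (p i); have := hE' _ nE' i.
  (* Both half-spaces have mass [gtail r], so passing to the parent leaves the centring
     unchanged. *)
  rewrite (halfspace_unit m r (u'1 i)) (halfspace_unit m r (u1 (p i))) subrr mulr0 add0r.
  rewrite sumrB -/(hcount (u' i) r t) -/(hcount (u (p i)) r t) exprS; move: h1; nra.
Qed.

End Chain.

(** * From a net to all directions *)

Section Uniform.
Context {R : realType}.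
Variables (d n : nat) (m : 'I_d -> R) (g : pred 'I_n) (sigma : R).
Hypotheses (d0 : (0 < d)%N) (sigma0 : 0 < sigma) (sigmaN : sigma ^+ 2 * #|g|%:R = d%:R).
Hypothesis (sigma_small : sigma <= 16^-1 ^+ 7).
Notation P := (gauss_vec m).
Notation Q := (tuple_product (fun _ : 'I_n => P)).
Notation N := (#|g|%:R : R).

Definition abs_sum (v : 'I_d -> R) (t : n.-tuple (d.-tuple R)) : R :=
  \sum_(i < n | g i) `|cdot m v (tnth t i)|.

Let sigma1 : sigma <= 1.
Proof. by apply: le_trans sigma_small _; rewrite exprn_ile1//; lra. Qed.

Lemma N_ge_d : d%:R <= N.
Proof. by rewrite -sigmaN ler_piMl// exprn_ile1// ltW. Qed.

Lemma N_ge1 : 1 <= N.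
Proof. by apply: le_trans N_ge_d; rewrite ler1n. Qed.

(** A net of mesh 1/2 has at most exp(4 d) <= exp(4 N) points, and Chernoff's bound gives exp(- 43
    N) for each. *)
Lemma abs_sum_netP : exists (I : finType) (u : I -> 'I_d -> R) (E : set (n.-tuple (d.-tuple R))),
  [/\ forall i, dotp (u i) (u i) = 1,
     forall v : 'I_d -> R, dotp v v = 1 -> exists i, sqdist v (u i) <= 2^-1 ^+ 2,
     measurable E, (Q E <= (40^-1)%:E)%E &
     forall t, ~ E t -> forall i, abs_sum (u i) t <= 45 * N].
Proof.
have [I [u [u1 uI uv]]] := @sphere_net R d 2 d0 isT.
pose A i := [set t : n.-tuple (d.-tuple R) | 45 * N <= \sum_(j < n | g j) `|cdot m (u i) (tnth t j)|].
have mf i : measurable_fun setT (fun x => `|cdot m (u i) x|).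
  by apply: measurableT_comp => //; exact: measurable_cdot.
have mA i : measurable (A i) by exact: (@measurable_tuple_sum_ge _ _ _ _ g _ _ (mf i)).
exists I, u, [set t | exists i, A i t]; split => //.
- exact: measurable_exists.
- have PA i : (Q (A i) <= (expR (- (43 * N)))%:E)%E.
    apply: le_trans (@chernoff _ _ _ n P g _ _ _ (mf i) (gauss_vec_abs_mgf m (u1 i))) _.
    by rewrite lee_fin -expRM_natl -expRD ler_expR le_eqVlt; apply/orP; left; apply/eqP; ring.
  apply: le_trans (measure_exists_le mA PA) _; rewrite lee_fin.
  have e8 : 4 * expR 1 * 2%:R <= expR 4 :> R.
    have h1 : 8 <= expR 3 :> R.
      rewrite (_ : 3 = 3%:R * 1)//; last by rewrite mulr1.
      rewrite expRM_natl; have h := expR_ge1Dx (1 : R).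
      by rewrite (_ : 8 = 2 ^+ 3); [apply: lerXn2r; rewrite ?nnegrE ?expR_ge0//; lra|ring].
    rewrite (_ : expR 4 = expR 3 * expR 1 :> R); last by rewrite -expRD; congr expR; ring.
    rewrite (_ : _ * 2 = 8 * expR 1); last by ring.
    by apply: ler_wpM2r; [exact: expR_ge0|exact: h1].
  have : (#|I|%:R : R) <= expR (4 * N).
    apply: le_trans uI _; apply: (@le_trans _ _ (expR 4 ^+ d)).
      by apply: lerXn2r; rewrite ?nnegrE ?mulr_ge0 ?expR_ge0.
    by rewrite -expRM_natl ler_expR mulrC ler_wpM2l//; exact: N_ge_d.
  move=> IN; apply: (@le_trans _ _ (expR (4 * N) * expR (- (43 * N)))).
    by rewrite ler_wpM2r ?expR_ge0.
  rewrite -expRD (_ : _ + _ = - (39 * N)); last by ring.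
  rewrite expRN lef_pV2 ?posrE ?expR_gt0//.
  by apply: le_trans (expR_ge1Dx _); have := N_ge1; lra.
- move=> t nE i; rewrite leNgt; apply/negP => h; apply: nE; exists i; exact: ltW.
Qed.

Lemma abs_sumD (u v : 'I_d -> R) t : abs_sum v t <= abs_sum u t + abs_sum (fun k => v k - u k) t.
Proof.
rewrite /abs_sum -big_split/=; apply: ler_sum => i _; rewrite cdotB.
by apply: le_trans (ler_normD _ _); rewrite addrC subrK.
Qed.

Lemma abs_sumZ c (v : 'I_d -> R) t : abs_sum (fun k => c * v k) t = `|c| * abs_sum v t.
Proof. by rewrite /abs_sum mulr_sumr; apply: eq_bigr => i _; rewrite cdotZ normrM. Qed.

Lemma abs_sum_ge0 v t : 0 <= abs_sum v t. Proof. exact: sumr_ge0. Qed.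

Lemma unit_coord (v : 'I_d -> R) k : dotp v v = 1 -> `|v k| <= 1.
Proof.
move=> v1; rewrite -(ler_pXn2r (n := 2)) ?nnegrE// expr1n real_normK ?num_real// -v1 dotp_sumsq.
by rewrite (bigD1 k)//= lerDl sumr_ge0// => i _; exact: sqr_ge0.
Qed.

Lemma normalize (z : 'I_d -> R) : 0 < dotp z z ->
  let s := Num.sqrt (dotp z z) in dotp (fun k => s^-1 * z k) (fun k => s^-1 * z k) = 1.
Proof.
move=> z0 s; rewrite dotp_sumsq; under eq_bigr do rewrite exprMn.
by rewrite -mulr_sumr -dotp_sumsq exprVn sqr_sqrtr ?ltW// mulVf ?gt_eqF.
Qed.

Lemma dotp0_eq (z : 'I_d -> R) : dotp z z = 0 -> forall k, z k = 0.
Proof.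
move=> /eqP; rewrite dotp_sumsq psumr_eq0; last by move=> i _; exact: sqr_ge0.
by move=> /allP h k; have := h k (mem_index_enum _); rewrite /= sqrf_eq0 => /eqP.
Qed.

Lemma abs_sum_scale_bound (B : R) t : (forall v, dotp v v = 1 -> abs_sum v t <= B) ->
  forall z, abs_sum z t <= Num.sqrt (dotp z z) * B.
Proof.
move=> hB z; have [z0|z0] := eqVneq (dotp z z) 0.
  rewrite z0 sqrtr0 mul0r /abs_sum big1// => i _; apply/eqP; rewrite normr_eq0 /cdot.
  by rewrite big1// => k _; rewrite (dotp0_eq z0) mul0r.
have zp : 0 < dotp z z by rewrite lt_def z0 dotp_ge0.
have s0 : 0 < Num.sqrt (dotp z z) by rewrite sqrtr_gt0.
have h := hB _ (normalize zp); move: h; rewrite /= abs_sumZ gtr0_norm ?invr_gt0//.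
by rewrite mulrC ler_pdivrMr// mulrC.
Qed.

(** The supremum B over the sphere satisfies B <= 45 N + B / 2 by approximation from the net. A
    crude coordinate bound first shows that B is finite. *)
Lemma abs_sum_bound : exists E : set (n.-tuple (d.-tuple R)),
  [/\ measurable E, (Q E <= (40^-1)%:E)%E &
     forall t, ~ E t -> forall z, abs_sum z t <= Num.sqrt (dotp z z) * (90 * N)].
Proof.
have [I [u [E [u1 uv mE QE hE]]]] := abs_sum_netP; exists E; split => // t nE.
apply: abs_sum_scale_bound => v v1.
pose S := [set abs_sum w t | w in [set w | dotp w w = 1]].
have Sn : S !=set0 by exists (abs_sum v t), v.
have Sb : has_ubound S.
  exists (\sum_(i < n | g i) \sum_(k < d) `|tnth (tnth t i) k - m k|) => _ [w w1 <-].
  apply: ler_sum => i _; apply: le_trans (ler_norm_sum _ _ _) _.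
  by apply: ler_sum => k _; rewrite normrM ler_piMl// unit_coord.
have supS : has_sup S by split.
pose B := sup S.
have SB w : dotp w w = 1 -> abs_sum w t <= B by move=> w1; apply: ub_le_sup => //; exists w.
have B0 : 0 <= B by apply: le_trans (SB v v1); exact: abs_sum_ge0.
have key w : dotp w w = 1 -> abs_sum w t <= 45 * N + 2^-1 * B.
  move=> w1; have [i hi] := uv w w1.
  apply: le_trans (abs_sumD (u i) w t) _; apply: lerD; first exact: hE.
  apply: le_trans (abs_sum_scale_bound SB _) _; rewrite ler_wpM2r//.
  rewrite -(ler_pXn2r (n := 2)) ?nnegrE ?sqrtr_ge0 ?invr_ge0//.
  by rewrite sqr_sqrtr ?dotp_ge0// -sqdist_dotp.
have BB : B <= 45 * N + 2^-1 * B.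
  by apply: ge_sup => // _ [w w1 <-]; exact: key.
by apply: le_trans (SB v v1) _; lra.
Qed.

(** The least K with 16^-K <= sigma. Then 3 sigma 8^K <= 48 * 2^-K, which is at most 1/2 because K
    >= 7; this is the reason for the bound 16^-7 on [sigma]. *)
Lemma chain_depth : exists K : nat, [/\ (7 <= K)%N, 16^-1 ^+ K <= sigma & sigma <= 16 * 16^-1 ^+ K].
Proof.
have ex : exists K, (16^-1 : R) ^+ K <= sigma.
  pose k := Num.truncn sigma^-1; exists k.
  rewrite exprVn -[leRHS]invrK lef_pV2 ?posrE ?exprn_gt0 ?invr_gt0//.
  apply: le_trans (ltW (truncnS_gt _)) _; rewrite -/k -natrX ler_nat.
  exact: ltn_expl.
pose K := ex_minn ex; have := ex_minnP ex; rewrite -/(ex_minn ex) => -[K' hK' minK'].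
have K7 : (7 <= K')%N.
  rewrite leqNgt; apply/negP => h; have : (16^-1 : R) ^+ 7 < 16^-1 ^+ K' by rewrite ltr_iXn2l//; lra.
  by move=> /lt_le_trans/(_ hK')/lt_le_trans/(_ sigma_small); rewrite ltxx.
exists K'; split => //.
have K0 : (0 < K')%N by exact: leq_trans K7.
have : ~~ (16^-1 ^+ K'.-1 <= sigma) by apply/negP => /minK'; rewrite leqNgt ltn_predL K0.
rewrite -ltNge => /ltW/le_trans; apply.
by rewrite -{2}(prednK K0) exprS mulrA mulfV ?mul1r.
Qed.

(* Moving [v] to the nearest net point [u i] and [r] to [r - sigma] loses only points with [sigma <= |cdot m (v - u i) x|];
   Markov's inequality counts them by [abs_sum]. *)
Lemma halfspace_uniform_bound (r : R) : exists E : set (n.-tuple (d.-tuple R)),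
  [/\ measurable E, (Q E <= (20^-1)%:E)%E &
    forall t, ~ E t -> forall v, dotp v v = 1 -> hcount m g v r t <= N * (gtail r + 2400 * sigma)].
Proof.
have [K [K7 K1 K2]] := chain_depth.
have sK : 3 * sigma * 8 ^+ K <= 2^-1.
  have e16 : (16^-1 : R) ^+ K * 8 ^+ K = 2^-1 ^+ K by rewrite -exprMn; congr (_ ^+ _); lra.
  have e2 : (2^-1 : R) ^+ K <= 2^-1 ^+ 7 by rewrite ler_wiXn2l//; lra.
  have e27 : (2^-1 : R) ^+ 7 = 128^-1 by rewrite exprVn; congr (_^-1); ring.
  rewrite (@le_trans _ _ (3 * (16 * 16^-1 ^+ K) * 8 ^+ K))//.
    by rewrite ler_wpM2r ?exprn_ge0// ler_wpM2l.
  by rewrite -mulrA -mulrA e16; lra.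
have [I [u [E1 [[u1 _ uv] mE1 QE1 hE1]]]] := chain m d0 sigma0 sigmaN (r - sigma) sK (leqnn K).
have [E2 [mE2 QE2 hE2]] := abs_sum_bound.
exists (E1 `|` E2); split; first exact: measurableU.
  apply: (@le_trans _ _ (Q E1 + Q E2)%E); first exact: measureU2.
  apply: le_trans (leeD QE1 QE2) _; rewrite -EFinD lee_fin.
  have : 0 <= (2^-1 : R) ^+ K by rewrite exprn_ge0.
  lra.
move=> t nE v v1.
have nE1 : ~ E1 t by move=> h; apply: nE; left.
have nE2 : ~ E2 t by move=> h; apply: nE; right.
have [i hi] := uv v v1; pose z k := v k - u i k.
have hz : Num.sqrt (dotp z z) <= sigma ^+ 2.
  rewrite -(ler_pXn2r (n := 2)) ?nnegrE ?sqrtr_ge0 ?sqr_ge0//.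
  rewrite sqr_sqrtr ?dotp_ge0// -sqdist_dotp; apply: le_trans hi _.
  by rewrite ler_pXn2r ?nnegrE ?sqr_ge0// ler_pXn2r ?nnegrE ?exprn_ge0// ltW.
have c1 : hcount m g v r t <= hcount m g (u i) (r - sigma) t + sigma^-1 * abs_sum z t.
  rewrite /hcount /abs_sum mulr_sumr -big_split/=; apply: ler_sum => j _.
  set x := tnth t j; have [h|h] := pselect (halfspace m v r x); last first.
    by rewrite indicE (memNset h) addr_ge0// mulr_ge0// invr_ge0 ltW.
  rewrite indicE (mem_set h); have [h'|h'] := pselect (halfspace m (u i) (r - sigma) x).
    by rewrite indicE (mem_set h') lerDl mulr_ge0// invr_ge0 ltW.
  rewrite indicE (memNset h') add0r mulrC ler_pdivlMr// mul1r.
  apply: le_trans (ler_norm _); rewrite cdotB; move: h h'; rewrite /halfspace/= => h /negP; rewrite -ltNge.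
  lra.
have c2 := hE1 _ nE1 i; have c3 := hE2 _ nE2 z.
have c4 : sigma^-1 * abs_sum z t <= 90 * N * sigma.
  rewrite mulrC ler_pdivrMr//; apply: le_trans c3 _.
  have N90 : 0 <= 90 * N by apply: mulr_ge0; [lra|exact: ler0n].
  apply: le_trans (ler_wpM2r N90 hz) _; have -> : sigma ^+ 2 * (90 * N) = 90 * N * sigma * sigma by ring.
  exact: lexx.
have c5 := gtail_lip r (ltW sigma0).
have c6 : N * gtail (r - sigma) <= N * (gtail r + sigma) by rewrite ler_wpM2l.
have c7 : 0 <= N * (1152 * sigma * 2^-1 ^+ K).
  apply: mulr_ge0; first exact: ler0n.
  apply: mulr_ge0; last by apply: exprn_ge0; lra.
  by apply: mulr_ge0; [lra|exact: ltW].
have c8 : 0 <= N * sigma by apply: mulr_ge0; [exact: ler0n|exact: ltW].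
have c9 : N * (gtail (r - sigma) + 1152 * sigma * (2 - 2^-1 ^+ K)) =
  N * gtail (r - sigma) + 2304 * (N * sigma) - N * (1152 * sigma * 2^-1 ^+ K) by ring.
have c10 : N * (gtail r + 2400 * sigma) = N * gtail r + 2400 * (N * sigma) by ring.
have c11 : N * (gtail r + sigma) = N * gtail r + N * sigma by ring.
have c12 : 90 * N * sigma = 90 * (N * sigma) by ring.
(* 2304 from the chain, 90 from Markov's inequality and 1 from shifting the offset stay below
   2400. *)
rewrite c10; rewrite c9 in c2; rewrite c11 in c6; rewrite c12 in c4.
apply: le_trans c1 _; lra.
Qed.

End Uniform.

(** * Depth and outliers in a contaminated sample *)

Section Law.
Context {R : realType}.

Definition sample_tuple (n d : nat) (x : 'I_n -> 'I_d -> R) : n.-tuple (d.-tuple R) :=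
  [tuple [tuple x i k | k < d] | i < n].

Lemma sample_tupleE n d (x : 'I_n -> 'I_d -> R) i k : tnth (tnth (sample_tuple x) i) k = x i k.
Proof. by rewrite !tnth_mktuple. Qed.

Lemma measurable_sample_tuple n d (dO : measure_display) (Om : measurableType dO) (X : Om -> 'I_n -> 'I_d -> R) :
  (forall i k, measurable_fun setT (fun w => X w i k)) ->
  measurable_fun setT (fun w => sample_tuple (X w)).
Proof.
move=> mX; apply/measurable_fun_tnthP => i; apply/measurable_fun_tnthP => k.
rewrite (_ : _ \o _ = fun w => X w i k)//.
by apply/funext => w /=; rewrite sample_tupleE.
Qed.

Lemma tuple2_product_rect n d (nu : 'I_n -> 'I_d -> probability R R) (A : 'I_n -> 'I_d -> set R) :
  (forall i k, measurable (A i k)) ->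
  tuple_product (fun i => tuple_product (nu i)) [set t | forall i k, A i k (tnth (tnth t i) k)] =
  (\prod_(i < n) \prod_(k < d) fine (nu i k (A i k)))%:E.
Proof.
move=> mA; transitivity (\prod_(i < n) fine (tuple_product (nu i) (rect (A i))))%:E.
  by apply: (@tuple_product_rect _ _ R n (fun i => tuple_product (nu i)) (fun i => rect (A i))) => i; exact: measurable_rect.
by congr EFin; apply: eq_bigr => i _; rewrite tuple_product_rect.
Qed.

(** The clean sample is not touched by the adversary: events about it can be evaluated under the
    product law. The variables [B] are integrated out by taking [setT] in the independence
    hypothesis. *)
Lemma contam_setup_law n d (lam : 'I_n -> R) (mu : 'I_d -> R)
    (dO : measure_display) (Om : measurableType dO) (P : probability Om R)
    (X : Om -> 'I_n -> 'I_d -> R) (B : Om -> 'I_n -> bool) (Xt : Om -> 'I_n -> 'I_d -> R) :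
  contam_setup lam mu P X B Xt ->
  forall E, measurable E ->
  P [set w | E (sample_tuple (X w))] = tuple_product (fun _ : 'I_n => gauss_vec mu) E.
Proof.
move=> [[mX mB mXt] XN BL ind] E mE.
have mF := measurable_sample_tuple mX.
pose FM := isMeasurableFun.Build _ _ _ _ _ mF.
pose F : {mfun Om >-> n.-tuple (d.-tuple R)} := HB.pack (fun w => sample_tuple (X w)) FM.
apply: (@tuple2_measure_unique _ _ _ n d (distribution P F) (tuple_product (fun _ : 'I_n => gauss_vec mu))) => //.
  exact: (le_lt_trans (probability_le1 _ _) (ltry _)).
move=> A mA; transitivity (\prod_(i < n) \prod_(k < d) fine (nprob (mu k) 1 (A i k)))%:E; last first.
  by apply/esym; exact: (tuple2_product_rect (fun _ k => nprob (mu k) 1) mA).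
have mrA : measurable [set w | forall i k, A i k (X w i k)].
  apply: measurable_forall => i; apply: measurable_forall => k.
  by rewrite -[X in measurable X]setTI; exact: mX.
rewrite [LHS](_ : _ = P [set w | forall i k, A i k (X w i k)]); last first.
  congr (P _); apply/seteqP; split => w /= h i k; first by rewrite -(sample_tupleE (X w)); exact: h.
  by rewrite sample_tupleE; exact: h.
rewrite -[LHS]fineK ?fin_num_measure//; congr EFin.
pose A' (j : ('I_n * 'I_d) + 'I_n) : set R := match j with inl ik => A ik.1 ik.2 | inr _ => setT end.
have mA' (j : ('I_n * 'I_d) + 'I_n) : measurable (A' j) by case: j => [ik|i]; [exact: mA|exact: measurableT].
have := ind A' mA'; rewrite (_ : [set w | _] = [set w | forall i k, A i k (X w i k)]); last first.
  apply/seteqP; split => w /= h; first by move=> i k; exact: (h (inl (i, k))).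
  by move=> [[i k]|i] //; exact: h.
move=> ->; rewrite big_sumType/= [X in _ * X]big1 ?mulr1; last first.
  move=> i _; rewrite (_ : [set w | _] = setT); first by rewrite probability_setT.
  by apply/seteqP; split.
rewrite pair_big/=; apply: eq_bigr => -[i k] _ /=.
by rewrite XN.
Qed.

End Law.

Section Vectors.
Context {R : realType} (d : nat).
Implicit Types u v z : 'I_d -> R.

Lemma dotpBr u v z : dotp u (fun k => v k - z k) = dotp u v - dotp u z.
Proof. by rewrite /dotp -sumrB; apply: eq_bigr => k _; rewrite mulrBr. Qed.

Lemma dotpZl c u v : dotp (fun k => c * u k) v = c * dotp u v.
Proof. by rewrite /dotp mulr_sumr; apply: eq_bigr => k _; rewrite mulrA. Qed.

Lemma dotpC u v : dotp u v = dotp v u.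
Proof. by apply: eq_bigr => k _; rewrite mulrC. Qed.

(** Cauchy-Schwarz, by expanding the squared norm of s v - z. *)
Lemma dotp_le_unit v z s : 0 <= s -> dotp v v = 1 -> dotp z z <= s ^+ 2 -> dotp v z <= s.
Proof.
move=> s0 v1 zs; have [s00|sn0] := eqVneq s 0.
  rewrite s00 expr0n/= in zs *; have z0 : dotp z z = 0 by apply/eqP; rewrite eq_le zs dotp_ge0.
  by rewrite /dotp big1// => k _; rewrite (dotp0_eq z0) mulr0.
have sp : 0 < s by rewrite lt_def sn0.
have h : 0 <= dotp (fun k => s * v k - z k) (fun k => s * v k - z k) by exact: dotp_ge0.
have e : dotp (fun k => s * v k - z k) (fun k => s * v k - z k) = s ^+ 2 * dotp v v + dotp z z - 2 * s * dotp v z.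
  rewrite /dotp !mulr_sumr -!big_split/= -sumrB; apply: eq_bigr => k _; ring.
rewrite e v1 in h; rewrite -(ler_pM2l sp); nra.
Qed.

Lemma direction z : 0 < dotp z z -> exists v, dotp v v = 1 /\ dotp v z = Num.sqrt (dotp z z).
Proof.
move=> z0; exists (fun k => (Num.sqrt (dotp z z))^-1 * z k); split; first exact: normalize.
have s0 : 0 < Num.sqrt (dotp z z) by rewrite sqrtr_gt0.
rewrite dotpZl -[X in _ * X]sqr_sqrtr ?ltW// expr2 mulrA mulVf ?mul1r// gt_eqF//.
Qed.

Lemma cdot_sample n (mu v : 'I_d -> R) (x : 'I_n -> 'I_d -> R) i :
  cdot mu v (tnth (sample_tuple x) i) = dotp v (fun k => x i k - mu k).
Proof. by apply: eq_bigr => k _; rewrite sample_tupleE. Qed.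

End Vectors.

Section Depth.
Context {R : realType} (n d : nat).
Variables (g : pred 'I_n).
Notation N := (#|g|%:R : R).

Definition zcount (Z : 'I_n -> 'I_d -> R) (eta v : 'I_d -> R) : R :=
  \sum_(i < n | g i) (if 0 <= dotp v (fun k => Z i k - eta k) then 1 else 0).

Definition bcount (b : 'I_n -> bool) : R := \sum_(i < n | g i) (b i)%:R.

Variables (mu : 'I_d -> R) (x xt z : 'I_n -> 'I_d -> R) (b : 'I_n -> bool).
Hypothesis zE : forall i, z i = if b i then xt i else x i.

(** Contaminated indices are charged to [bcount]; a clean point counted at [eta] lies beyond offset
    [r] as seen from the mean. *)
Lemma zcount_le eta v r : r <= dotp v (fun k => eta k - mu k) ->
  zcount z eta v <= hcount mu g v r (sample_tuple x) + bcount b.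
Proof.
move=> rv; rewrite -big_split/=; apply: ler_sum => i _; rewrite indicE.
rewrite zE; case: (b i) => /=.
  by case: ifP => _; rewrite ?lerDr// addr_ge0.
rewrite addr0; case: ifPn => // h; rewrite mem_set//=.
rewrite /halfspace/= cdot_sample; apply: le_trans rv _; rewrite -subr_ge0 -dotpBr.
by apply: le_trans h _; rewrite le_eqVlt; apply/orP; left; apply/eqP; apply: eq_bigr => k _; congr (_ * _); ring.
Qed.

(** A clean point that is not counted lies in the opposite half-space of offset - s, so upper bounds
    on [hcount] also bound the depth from below. *)
Lemma zcount_ge eta v s : dotp v (fun k => eta k - mu k) <= s ->
  N <= zcount z eta v + hcount mu g (fun k => - 1 * v k) (- s) (sample_tuple x) + bcount b.
Proof.
move=> vs; have -> : N = \sum_(i < n | g i) 1 by rewrite sumr_const.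
rewrite -!big_split/=; apply: ler_sum => i _; rewrite indicE zE; case: (b i) => /=.
  by rewrite lerDr addr_ge0//; case: ifP.
rewrite addr0; case: ifPn => h; first by rewrite lerDl.
rewrite add0r mem_set//=; rewrite /halfspace/= cdot_sample dotpZl mulN1r lerN2.
move: h; rewrite -ltNge => /ltW h; rewrite -subr_le0.
have e : dotp v (fun k => x i k - mu k) - dotp v (fun k => eta k - mu k) = dotp v (fun k => x i k - eta k).
  by rewrite -dotpBr; apply: eq_bigr => k _; congr (_ * _); ring.
by have := vs; move: e h; lra.
Qed.

Variables (sigma t : R).
Hypotheses (sigma0 : 0 < sigma) (t0 : 0 <= t) (N0 : 0 < N).
Hypothesis small : sigma + t <= gdens / 5000.

(** 2400 sigma from the uniform bound, sigma from [gtail_lip], and sigma + 20 t from the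
    outliers. *)
Definition delta : R := 2402 * sigma + 20 * t.
(** At this distance the Gaussian tail has dropped by 5000 (sigma + t), more than [delta] plus the
    errors 2401 sigma + 20 t of the far point. *)
Definition radius : R := 5000 / gdens * (sigma + t).

Lemma radius_le1 : radius <= 1.
Proof.
rewrite /radius -(ler_pM2l (x := gdens)) ?gdens_gt0// mulrA (mulrCA gdens) mulfV ?gt_eqF ?gdens_gt0//.
have g0 := @gdens_gt0 R; move: small; lra.
Qed.

Lemma radius_gt0 : 0 < radius.
Proof. by rewrite mulr_gt0 ?divr_gt0 ?gdens_gt0 ?ltr0n// ltr_wpDr. Qed.

Hypothesis hlow : forall v, dotp v v = 1 -> hcount mu g v (- sigma) (sample_tuple x) <= N * (gtail (- sigma) + 2400 * sigma).
Hypothesis hup : forall v, dotp v v = 1 -> hcount mu g v radius (sample_tuple x) <= N * (gtail radius + 2400 * sigma).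
Hypothesis hb : bcount b < N * (20 * t + sigma).

Lemma depth_near eta v : sqdist eta mu <= sigma ^+ 2 -> dotp v v = 1 -> N * (2^-1 - delta) <= zcount z eta v.
Proof.
move=> em v1; have vs : dotp v (fun k => eta k - mu k) <= sigma.
  by apply: (dotp_le_unit (ltW sigma0) v1); rewrite -sqdist_dotp.
have v1' : dotp (fun k => - 1 * v k) (fun k => - 1 * v k) = 1.
  by rewrite dotpZl dotpC dotpZl v1; ring.
have h1 := zcount_ge vs; have h2 := hlow v1'.
have h3 := gtail_lip sigma (ltW sigma0); rewrite subrr gtail0 in h3.
rewrite gtailN in h2.
have h4 : N * 2^-1 <= N * (gtail sigma + sigma) by rewrite ler_wpM2l.
move: hb h1 h2 h4; rewrite /delta; nra.
Qed.

Lemma depth_far eta v : dotp v v = 1 -> radius <= dotp v (fun k => eta k - mu k) ->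
  zcount z eta v < N * (2^-1 - delta).
Proof.
move=> v1 rv; have h1 := zcount_le rv; have h2 := hup v1.
have h3 := gtail_anti (ltW radius_gt0) radius_le1.
have e : gdens * radius = 5000 * (sigma + t).
  by rewrite /radius mulrA (mulrCA gdens) mulfV ?mulr1// gt_eqF// gdens_gt0.
rewrite e in h3.
have h4 : N * gtail radius <= N * (2^-1 - 5000 * (sigma + t)) by rewrite ler_wpM2l.
have h5 : 0 < N * sigma by rewrite mulr_gt0.
have h6 : 0 <= N * t by rewrite mulr_ge0// ltW.
move: hb h1 h2 h4; rewrite /delta; nra.
Qed.

End Depth.

Section Good.
Context {R : realType} (n d : nat).
Variables (lam : 'I_n -> R) (mu : 'I_d -> R) (dO : measure_display) (Om : measurableType dO)
  (P : probability Om R) (X : Om -> 'I_n -> 'I_d -> R) (B : Om -> 'I_n -> bool)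
  (Xt : Om -> 'I_n -> 'I_d -> R).
Hypothesis setup : contam_setup lam mu P X B Xt.
Variable t : R.
Let g : pred 'I_n := fun i => lam i <= t.
Notation N := (#|g|%:R : R).

Lemma bcount_indic w : bcount g (B w) = \sum_(i < n | g i) \1_[set w | B w i] w :> R.
Proof.
apply: eq_bigr => i _; rewrite indicE; congr (_%:R).
by case: (boolP (B w i)) => h; [rewrite mem_set|rewrite memNset//; exact/negP].
Qed.

Lemma measurable_bcount : measurable_fun setT (fun w => bcount g (B w) : R).
Proof.
have [[_ mB _] _ _ _] := setup.
rewrite (_ : (fun w => _) = (fun w => \sum_(i < n) (if g i then \1_[set w | B w i] w else 0 : R))).
  by apply: measurable_sum => i; case: (g i) => //; exact: measurable_indic.
by apply/funext => w; rewrite bcount_indic big_mkcond.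
Qed.

Lemma measurable_bcount_ge x : measurable [set w | x <= bcount g (B w) :> R].
Proof.
rewrite -[X in measurable X]setTI (_ : [set w | _] = (fun w => bcount g (B w) : R) @^-1` `[x, +oo[%classic).
  exact: measurable_bcount.
by apply/seteqP; split => w /=; rewrite in_itv/= andbT.
Qed.

Lemma bcount_markov x : 0 < x -> (P [set w | (x <= bcount g (B w))%R] <= (N * t / x)%:E)%E.
Proof.
move=> x0; have [[_ mB _] _ BL _] := setup.
pose A := [set w | x <= bcount g (B w) :> R].
have mA : measurable A := measurable_bcount_ge x.
have mbE : measurable_fun setT (fun w => (bcount g (B w) : R)%:E) by apply/measurable_EFinP; exact: measurable_bcount.
have mBi i : measurable_fun setT (fun w => (\1_[set w | B w i] w : R)%:E).
  by apply/measurable_EFinP; exact: measurable_indic.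
have b0 w : 0 <= bcount g (B w) :> R by apply: sumr_ge0.
have := integral_indic P measurableT mA; rewrite setIT => <-.
apply: (@le_trans _ _ (\int[P]_w (x^-1%:E * (bcount g (B w))%:E))%E).
  apply: ge0_le_integral => //.
  - exact/measurable_EFinP/measurable_indic.
  - exact: emeasurable_funM.
  - move=> w _; rewrite -EFinM lee_fin.
    have [h|h] := pselect (A w); last by rewrite indicE (memNset h) mulr_ge0// invr_ge0 ltW.
    by rewrite indicE (mem_set h) mulrC ler_pdivlMr// mul1r.
rewrite ge0_integralZl ?lee_fin ?invr_ge0 ?(ltW x0)//; last by move=> w _; rewrite lee_fin.
pose F i w : \bar R := if g i then (\1_[set w | B w i] w : R)%:E else 0%E.
have -> : (\int[P]_w (bcount g (B w))%:E = \int[P]_w \sum_(i < n) F i w)%E.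
  by apply: eq_integral => w _; rewrite bcount_indic -sumEFin big_mkcond.
rewrite ge0_integral_sum//; last 2 first.
- by move=> i; rewrite /F; case: (g i).
- by move=> i w _; rewrite /F; case: (g i); rewrite ?lee_fin.
rewrite (eq_bigr (fun i => if g i then (lam i)%:E else 0%E)); last first.
  move=> i _; rewrite /F; case: (g i); last by rewrite integral0.
  by rewrite integral_indic// setIT; exact: BL.
rewrite -big_mkcond/=.
rewrite sumEFin -EFinM lee_fin mulrC ler_wpM2r ?invr_ge0 ?(ltW x0)//.
by rewrite mulr_natl -sumr_const; exact: ler_sum.
Qed.

Variable sigma : R.
Hypotheses (d0 : (0 < d)%N) (t0 : 0 <= t) (sigma0 : 0 < sigma) (sigmaN : sigma ^+ 2 * N = d%:R).
Hypothesis sigma_small : sigma <= 16^-1 ^+ 7.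

(** Three bad events of probability at most 1/20 each: the two offsets and the number of
    outliers. *)
Lemma good_event r : exists E : set Om, [/\ measurable E, (P E <= (3 / 20)%:E)%E &
  forall w, ~ E w -> [/\
    forall v, dotp v v = 1 -> hcount mu g v (- sigma) (sample_tuple (X w)) <= N * (gtail (- sigma) + 2400 * sigma),
    forall v, dotp v v = 1 -> hcount mu g v r (sample_tuple (X w)) <= N * (gtail r + 2400 * sigma) &
    bcount g (B w) < N * (20 * t + sigma)]].
Proof.
have [[mX _ _] _ _ _] := setup.
have N0 : 0 < N.
  rewrite lt_def ler0n andbT; apply/negP => /eqP N0; move: sigmaN; rewrite N0 mulr0 => /esym/eqP.
  by rewrite pnatr_eq0 -leqn0 leqNgt d0.
have [E1 [mE1 QE1 hE1]] := halfspace_uniform_bound mu d0 sigma0 sigmaN sigma_small (- sigma).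
have [E2 [mE2 QE2 hE2]] := halfspace_uniform_bound mu d0 sigma0 sigmaN sigma_small r.
pose A1 := [set w | E1 (sample_tuple (X w))]; pose A2 := [set w | E2 (sample_tuple (X w))].
(* The summand [sigma] keeps the threshold positive when t = 0, as Markov's inequality needs. *)
pose A3 := [set w | N * (20 * t + sigma) <= bcount g (B w) :> R].
have mA1 : measurable A1 by rewrite -[A1]setTI; exact: (measurable_sample_tuple mX).
have mA2 : measurable A2 by rewrite -[A2]setTI; exact: (measurable_sample_tuple mX).
have mA3 : measurable A3 := measurable_bcount_ge _.
have PA1 : (P A1 <= (20^-1)%:E)%E by rewrite (contam_setup_law setup).
have PA2 : (P A2 <= (20^-1)%:E)%E by rewrite (contam_setup_law setup).
have PA3 : (P A3 <= (20^-1)%:E)%E.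
  have x0 : 0 < N * (20 * t + sigma) by rewrite mulr_gt0// ltr_wpDl// mulr_ge0.
  apply: le_trans (bcount_markov x0) _; rewrite lee_fin ler_pdivrMr//.
  have : 0 <= N * sigma by rewrite mulr_ge0// ltW.
  nra.
exists ((A1 `|` A2) `|` A3); split.
- by do 2 apply: measurableU => //.
- apply: (@le_trans _ _ (P (A1 `|` A2) + P A3)%E).
    by apply: measureU2 => //; exact: measurableU.
  apply: (@le_trans _ _ ((P A1 + P A2) + P A3)%E).
    by apply: leeD => //; exact: measureU2.
  apply: le_trans (leeD (leeD PA1 PA2) PA3) _; rewrite -!EFinD lee_fin; lra.
- move=> w nE; split.
  + by apply: hE1 => h; apply: nE; left; left.
  + by apply: hE2 => h; apply: nE; left; right.
  + by rewrite ltNge; apply/negP => h; apply: nE; right.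
Qed.

End Good.

Section TukeyMedian.
Context {R : realType} (n d : nat).
Variables (lam : 'I_n -> R) (t : R).
Let g : pred 'I_n := fun i => lam i <= t.
Notation N := (#|g|%:R : R).

Lemma NcountE : Ncount lam t = #|g|.
Proof.
apply: eq_card => i; rewrite -[LHS]/(i \in [set i0 | lam i0 <= t]).
by apply/idP/idP => [|h]; rewrite in_setE.
Qed.

Lemma weighted_count (z : 'I_n -> 'I_d -> R) (eta v : 'I_d -> R) :
  \sum_(i < n) wthr lam t i * (if 0 <= dotp v (fun k => z i k - eta k) then 1 else 0) = zcount g z eta v / N.
Proof.
rewrite /zcount mulr_suml [RHS]big_mkcond/=; apply: eq_bigr => i _.
by rewrite /wthr /g NcountE; case: ifP; rewrite ?mul0r// mulrC.
Qed.

Lemma tukey_depth_le (z : 'I_n -> 'I_d -> R) (eta v : 'I_d -> R) : dotp v v = 1 ->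
  tukey_depth (wthr lam t) z eta <= zcount g z eta v / N.
Proof.
move=> v1; rewrite /tukey_depth; apply: ge_inf; last first.
  by exists v => //; exact: weighted_count.
exists 0 => _ [u _ <-]; rewrite weighted_count divr_ge0//.
by apply: sumr_ge0 => i _; case: ifP.
Qed.

Lemma tukey_depth_ge (z : 'I_n -> 'I_d -> R) (eta : 'I_d -> R) (a : R) : (0 < d)%N -> 0 < N ->
  (forall v, dotp v v = 1 -> N * a <= zcount g z eta v) -> a <= tukey_depth (wthr lam t) z eta.
Proof.
move=> d0 N0 h; apply: lb_le_inf.
  (* The infimum must range over a nonempty sphere; otherwise [inf] takes a default value. *)
  pose e0 : 'I_d -> R := fun j => if j == Ordinal d0 then 1 else 0.
  exists (\sum_(i < n) wthr lam t i * (if 0 <= dotp e0 (fun k => z i k - eta k) then 1 else 0)), e0 => //.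
  rewrite /sphere/= /dotp (bigD1 (Ordinal d0))//= big1 ?addr0 /e0 ?eqxx ?mulr1//.
  by move=> j /negbTE ->; rewrite mulr0.
move=> _ [v v1 <-]; rewrite weighted_count ler_pdivlMr// mulrC; exact: h.
Qed.

End TukeyMedian.

Section TukeyRisk.
Context {R : realType} (n d : nat).
Variables (lam : 'I_n -> R) (t sigma : R).
Let g : pred 'I_n := fun i => lam i <= t.
Notation N := (#|g|%:R : R).
Hypotheses (d0 : (0 < d)%N) (t0 : 0 <= t) (sigma0 : 0 < sigma) (sigmaN : sigma ^+ 2 * N = d%:R).
Hypothesis sigma_small : sigma <= 16^-1 ^+ 7.
Hypothesis small : sigma + t <= gdens / 5000.
Variables (mu : 'I_d -> R) (dO : measure_display) (Om : measurableType dO)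
  (P : probability Om R) (X : Om -> 'I_n -> 'I_d -> R) (B : Om -> 'I_n -> bool)
  (Xt : Om -> 'I_n -> 'I_d -> R).
Hypothesis setup : contam_setup lam mu P X B Xt.

Lemma card_good_gt0 : 0 < N.
Proof.
rewrite lt_def ler0n andbT; apply/negP => /eqP N0; move: sigmaN; rewrite N0 mulr0 => /esym/eqP.
by rewrite pnatr_eq0 -leqn0 leqNgt d0.
Qed.

Lemma measurable_contaminate i k : measurable_fun setT (fun w => contaminate X B Xt w i k).
Proof.
have [[mX mB mXt] _ _ _] := setup.
rewrite (_ : (fun w => _) = (fun w => if B w i then Xt w i k else X w i k)); last first.
  by apply/funext => w; rewrite /contaminate; case: (B w i).
by apply: measurable_fun_ifT => //; apply: (measurable_fun_bool true); rewrite setTI; exact: mB.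
Qed.

(* [K] leaves room for the grid estimator ([K = 2]), whose depth is only tested in rational directions. *)
Lemma deep_point_risk (M : estimator R n d) (s : R) (K : R) : measurable_estimator M -> 1 <= K -> (K * radius sigma t) ^+ 2 <= s ->
  (forall x xt z b, (forall i, z i = if b i then xt i else x i) ->
    (forall eta v, sqdist eta mu <= sigma ^+ 2 -> dotp v v = 1 -> N * (2^-1 - delta sigma t) <= zcount g z eta v) ->
    (K * radius sigma t) ^+ 2 <= sqdist (M z) mu ->
    exists2 v, dotp v v = 1 /\ radius sigma t <= dotp v (fun k => M z k - mu k) &
       N * (2^-1 - delta sigma t) <= zcount g z (M z) v) ->
  (P [set w | (s <= sqdist (M (contaminate X B Xt w)) mu)%R] <= (5^-1)%:E)%E.
Proof.
move=> mM K1 Ks hM.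
have [E [mE PE hE]] := good_event setup d0 t0 sigma0 sigmaN sigma_small (radius sigma t).
apply: (@le_trans _ _ (P E)); last by apply: le_trans PE _; rewrite lee_fin; lra.
have mS : measurable_fun setT (fun w => sqdist (M (contaminate X B Xt w)) mu).
  apply: measurable_sum => k; apply: measurable_funX; apply: measurable_funB => //.
  by apply: mM => i j; exact: measurable_contaminate.
apply: le_measure; rewrite ?inE//.
  rewrite -[X in measurable X]setTI (_ : [set w | _] = (fun w => sqdist (M (contaminate X B Xt w)) mu) @^-1` `[s, +oo[%classic).
    exact: mS.
  by apply/seteqP; split => w /=; rewrite in_itv/= andbT.
move=> w /= sw; apply: contrapT => /hE[h1 h2 h3].
have zE i : contaminate X B Xt w i = if B w i then Xt w i else X w i by apply/funext => k; rewrite /contaminate; case: (B w i).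
have near eta v := @depth_near _ _ _ _ _ _ _ _ _ zE _ _ sigma0 h1 h3 eta v.
have [v [v1 rv] hv] := hM _ _ _ _ zE near (le_trans Ks sw).
have := depth_far zE sigma0 t0 card_good_gt0 small h2 h3 v1 rv.
by rewrite ltNge hv.
Qed.

(** A median is at least as deep as the mean, and the direction from the mean to the median tests
    its depth. *)
Lemma tukey_median_risk (M : estimator R n d) (s : R) : measurable_estimator M ->
  (forall z, is_tukey_median (wthr lam t) z (M z)) -> radius sigma t ^+ 2 <= s ->
  (P [set w | (s <= sqdist (M (contaminate X B Xt w)) mu)%R] <= (5^-1)%:E)%E.
Proof.
move=> mM tM rs; apply: (deep_point_risk (K := 1)) => //; first by rewrite mul1r.
move=> x xt z b zE near; rewrite mul1r => far.
have r0 : 0 < radius sigma t by exact: radius_gt0.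
pose u k := M z k - mu k.
have u0 : 0 < dotp u u by rewrite -sqdist_dotp; apply: lt_le_trans far; rewrite exprn_gt0.
have [v [v1 vu]] := direction u0; exists v.
  split => //; rewrite vu -(ler_pXn2r (n := 2)) ?nnegrE ?sqrtr_ge0 ?(ltW r0)//.
  by rewrite sqr_sqrtr ?(ltW u0)// -sqdist_dotp.
have h1 : 2^-1 - delta sigma t <= tukey_depth (wthr lam t) z mu.
  apply: tukey_depth_ge => //; first exact: card_good_gt0.
  move=> v' v'1; apply: near => //; rewrite /sqdist big1 ?sqr_ge0// => k _.
  by rewrite subrr expr0n.
have h2 := le_trans (le_trans h1 (tM z mu)) (tukey_depth_le lam t z (M z) v1).
by move: h2; rewrite ler_pdivlMr ?card_good_gt0// mulrC.
Qed.

End TukeyRisk.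

(** * A measurable substitute for the Tukey median *)

Section RationalEstimator.
Context {R : realType} (n d : nat).
Variables (g : pred 'I_n) (level : R).

Let ratvec (q : {ffun 'I_d -> rat}) : 'I_d -> R := fun k => ratr (q k).

(** Testing only rational directions makes this a countable intersection of measurable events.
    Directions are not normalised, since the count depends on them only up to a positive factor. *)
Let deep (Z : 'I_n -> 'I_d -> R) (q : {ffun 'I_d -> rat}) : Prop :=
  forall p : {ffun 'I_d -> rat}, level <= zcount g Z (ratvec q) (ratvec p).

Let deepn Z (j : nat) : Prop := if unpickle j is Some q then deep Z q else False.

(** The first deep point in the enumeration of rational vectors, and 0 if there is none. *)
Definition grid_estimator : estimator R n d := fun Z =>
  if pselect (exists j, `[< deepn Z j >]) is left ex
  then (if unpickle (ex_minn ex) is Some q then ratvec q else fun=> 0) else fun=> 0.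

Lemma grid_estimatorP Z (q : {ffun 'I_d -> rat}) : (forall p : {ffun 'I_d -> rat}, level <= zcount g Z (fun k => ratr (q k)) (fun k => ratr (p k))) ->
  forall p : {ffun 'I_d -> rat}, level <= zcount g Z (grid_estimator Z) (fun k => ratr (p k)).
Proof.
move=> hq p; rewrite /grid_estimator; case: pselect => [ex|nex]; last first.
  exfalso; apply: nex; exists (pickle (q : {ffun 'I_d -> rat})); apply/asboolP.
  by rewrite /deepn pickleK.
case: ex_minnP => j /asboolP; rewrite /deepn; case: (unpickle j) => [q'|]// h _.
exact: h.
Qed.

Lemma measurable_zcount_ge (dO : measure_display) (Om : measurableType dO) (Z : Om -> 'I_n -> 'I_d -> R) (eta v : 'I_d -> R) :
  (forall i k, measurable_fun setT (fun w => Z w i k)) -> measurable [set w | level <= zcount g (Z w) eta v].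
Proof.
move=> mZ.
have mS : measurable_fun setT (fun w => \sum_(i < n) (if g i then \1_[set w | 0 <= dotp v (fun k => Z w i k - eta k)] w else 0 : R)).
  apply: measurable_sum => i; case: (g i) => //; apply: measurable_indic.
  have mD : measurable_fun setT (fun w => dotp v (fun k => Z w i k - eta k)).
    by apply: measurable_sum => k; apply: measurable_funM => //; exact: measurable_funB.
  rewrite -[X in measurable X]setTI (_ : [set w | _] = (fun w => dotp v (fun k => Z w i k - eta k)) @^-1` `[0, +oo[%classic).
    exact: mD.
  by apply/seteqP; split => w /=; rewrite in_itv/= andbT.
rewrite -[X in measurable X]setTI (_ : [set w | _] = (fun w => \sum_(i < n) (if g i then \1_[set w | 0 <= dotp v (fun k => Z w i k - eta k)] w else 0 : R)) @^-1` `[level, +oo[%classic).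
  exact: mS.
have e w : zcount g (Z w) eta v = \sum_(i < n) (if g i then \1_[set w | 0 <= dotp v (fun k => Z w i k - eta k)] w else 0 : R).
  rewrite /zcount -big_mkcond/=; apply: eq_bigr => i _; rewrite indicE.
  by case: ifP => h; [rewrite mem_set|rewrite memNset// => h'; move: h; rewrite h'].
by apply/seteqP; split => w /=; rewrite in_itv/= andbT e.
Qed.

Lemma measurable_grid_estimator : measurable_estimator grid_estimator.
Proof.
move=> dO Om Z mZ k.
have mdeepn j : measurable [set w | deepn (Z w) j].
  rewrite /deepn; case: (unpickle j) => [q|]; last by rewrite (_ : [set w | _] = set0)//; apply/seteqP; split.
  rewrite (_ : [set w | _] = \bigcap_i [set w | if unpickle i is Some p then level <= zcount g (Z w) (ratvec q) (ratvec p) else True]).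
    apply: bigcapT_measurable => i; case: (unpickle i) => [p|].
      exact: measurable_zcount_ge.
    by rewrite (_ : [set w | _] = setT)//; apply/seteqP; split.
  apply/seteqP; split => w /=.
    by move=> h i _ /=; case: (unpickle i) => // p; exact: h.
  by move=> h p; have := h (pickle p) I; rewrite /= pickleK.
(* On [F j] the index [j] is the first success, so the estimator is constant there. *)
pose F j := [set w | deepn (Z w) j] `\` \bigcup_(i in [set i | (i < j)%N]) [set w | deepn (Z w) i].
have mF j : measurable (F j).
  by apply: measurableD => //; apply: bigcup_measurable => i _.
pose val j : R := if unpickle j is Some q then ratvec q k else 0.
have estF w j : F j w -> grid_estimator (Z w) k = val j.
  move=> [dj ndj]; rewrite /grid_estimator; case: pselect => [ex|nex]; last first.
    by exfalso; apply: nex; exists j; apply/asboolP.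
  case: ex_minnP => i /asboolP di imin.
  have -> : i = j.
    apply/eqP; rewrite eqn_leq imin ?andTb; last exact/asboolP.
    rewrite leqNgt; apply/negP => ij; apply: ndj; exists i => //.
  by rewrite /val; case: (unpickle j).
have estN w : (forall j, ~ deepn (Z w) j) -> grid_estimator (Z w) k = 0.
  move=> h; rewrite /grid_estimator; case: pselect => // ex; exfalso.
  by have [j /asboolP] := ex; exact: h.
have Fex w j : deepn (Z w) j -> exists i, F i w.
  move=> dj; have ex : exists j, `[< deepn (Z w) j >] by exists j; apply/asboolP.
  have [i /asboolP di imin] := ex_minnP ex; exists i; split => // -[l /= li dl].
  by move: (imin l (asboolT dl)); rewrite leqNgt li.
move=> _ Y mY; rewrite setTI.
rewrite (_ : _ @^-1` Y = \bigcup_j (if `[< Y (val j) >] then F j else set0) `|`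
   (if `[< Y 0 >] then ~` (\bigcup_j [set w | deepn (Z w) j]) else set0)).
  apply: measurableU.
    by apply: bigcup_measurable => j _; case: ifP.
  by case: ifP => // _; apply: measurableC; apply: bigcup_measurable => j _.
apply/seteqP; split => w /=.
  move=> Yw; have [[j dj]|nd] := pselect (exists j, deepn (Z w) j).
    have [i Fi] := Fex w j dj; left; exists i => //=.
    by rewrite (estF w i Fi) in Yw; case: asboolP.
  have nd' j : ~ deepn (Z w) j by move=> h; apply: nd; exists j.
  rewrite (estN w nd') in Yw; right; case: asboolP => // _ /= [j _ dj]; exact: (nd' j).
case=> [[j _]|].
  by case: asboolP => //= Yj Fj; rewrite (estF w j Fj).
by case: asboolP => //= Y0 nd; rewrite (estN w)// => j dj; apply: nd; exists j.
Qed.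

End RationalEstimator.

(** * The upper bound *)

Section GridRisk.
Context {R : realType} (n d : nat).

Lemma rat_approx (x : 'I_d -> R) (e : R) : 0 < e ->
  exists q : {ffun 'I_d -> rat}, sqdist (fun k => ratr (q k)) x <= e ^+ 2.
Proof.
move=> e0; pose h := e / (d.+1)%:R.
have h0 : 0 < h by rewrite divr_gt0.
have /choice[q hq] : forall k, exists q : rat, `|ratr q - x k| <= h.
  move=> k; have [|q] := @rat_in_itvoo R (x k - h) (x k + h); first by lra.
  by rewrite in_itv/= => /andP[h1 h2]; exists q; rewrite ler_norml; lra.
exists [ffun k => q k]; apply: (@le_trans _ _ (\sum_(k < d) h ^+ 2)).
  apply: ler_sum => k _; rewrite ffunE -[leLHS]real_normK ?num_real//.
  by rewrite ler_pXn2r ?nnegrE ?(ltW h0)//; exact: hq.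
rewrite sumr_const card_ord -mulr_natl /h exprMn mulrCA ler_piMr ?sqr_ge0//.
rewrite exprVn ler_pdivrMr ?exprn_gt0// mul1r -natrX ler_nat.
by rewrite -mulnn (leq_trans (leqnSn d))// leq_pmulr.
Qed.

Lemma zcountZ (g : pred 'I_n) (z : 'I_n -> 'I_d -> R) (eta v : 'I_d -> R) (c : R) : 0 < c ->
  zcount g z eta (fun k => c * v k) = zcount g z eta v.
Proof. by move=> c0; apply: eq_bigr => i _; rewrite dotpZl pmulr_rge0. Qed.

Variables (lam : 'I_n -> R) (t sigma : R).
Let g : pred 'I_n := fun i => lam i <= t.
Notation N := (#|g|%:R : R).
Hypotheses (d0 : (0 < d)%N) (t0 : 0 <= t) (sigma0 : 0 < sigma) (sigmaN : sigma ^+ 2 * N = d%:R).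
Hypothesis sigma_small : sigma <= 16^-1 ^+ 7.
Hypothesis small : sigma + t <= gdens / 5000.
Variables (mu : 'I_d -> R) (dO : measure_display) (Om : measurableType dO)
  (P : probability Om R) (X : Om -> 'I_n -> 'I_d -> R) (B : Om -> 'I_n -> bool)
  (Xt : Om -> 'I_n -> 'I_d -> R).
Hypothesis setup : contam_setup lam mu P X B Xt.

Lemma grid_estimator_risk (s : R) : (2 * radius sigma t) ^+ 2 <= s ->
  (P [set w | (s <= sqdist (grid_estimator g (N * (2^-1 - delta sigma t)) (contaminate X B Xt w)) mu)%R] <= (5^-1)%:E)%E.
Proof.
move=> rs; apply: (deep_point_risk d0 t0 sigma0 sigmaN sigma_small small setup (K := 2)) => //.
- exact: measurable_grid_estimator.
- lra.
set level := N * _; set M := grid_estimator g level.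
move=> x xt z b zE near far.
have r0 : 0 < radius sigma t by exact: radius_gt0.
move: (radius sigma t) r0 far => r r0 far.
have N0 : 0 < N := card_good_gt0 d0 sigmaN.
have levelN : level <= N.
  rewrite /level ler_piMr ?(ltW N0)// /delta; move: (sigma0) (t0); lra.
(* A rational point within [sigma] of the mean is deep, so the search succeeds; this is why depth is
   controlled on a ball and not only at the mean. *)
have [q hq] := rat_approx mu sigma0.
have Mdeep : forall p : {ffun 'I_d -> rat}, level <= zcount g z (M z) (fun k => ratr (p k)).
  apply: (@grid_estimatorP _ _ _ _ _ _ q) => p; pose v k : R := ratr (p k).
  (* The zero direction counts all N samples, and [level] is at most N. *)
  have [v0|v0] := eqVneq (dotp v v) 0.
    apply: le_trans levelN _; rewrite -sumr_const; apply: ler_sum => i _.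
    have vk k : ratr (p k) = 0 :> R := dotp0_eq v0 k.
    by rewrite /dotp big1 ?lexx// => k _; rewrite vk mul0r.
  have vp : 0 < dotp v v by rewrite lt_def v0 dotp_ge0.
  rewrite -/v -(@zcountZ _ _ _ _ (Num.sqrt (dotp v v))^-1) ?invr_gt0 ?sqrtr_gt0//.
  by apply: near => //; exact: normalize.
pose u k := M z k - mu k.
have u0 : 0 < dotp u u by rewrite -sqdist_dotp; apply: lt_le_trans far; rewrite exprn_gt0// mulr_gt0.
pose L := Num.sqrt (dotp u u); have L0 : 0 < L by rewrite sqrtr_gt0.
have L2 : dotp u u = L ^+ 2 by rewrite sqr_sqrtr// ltW.
have Lr : 2 * r <= L.
  rewrite -(ler_pXn2r (n := 2)) ?nnegrE ?(ltW L0) ?mulr_ge0 ?(ltW r0)//.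
  by rewrite -L2 -sqdist_dotp.
(* A rational direction this close to [u], once normalised, has inner product at least L / 2 with
   [u]; this loss explains the factor 2 before [radius]. *)
have [p hp] : exists p : {ffun 'I_d -> rat}, sqdist (fun k => ratr (p k)) u <= (L / 4) ^+ 2.
  by apply: rat_approx; rewrite divr_gt0.
pose v k : R := ratr (p k).
have e : sqdist v u = dotp v v + dotp u u - 2 * dotp v u.
  rewrite /sqdist /dotp mulr_sumr -big_split/= -sumrB; apply: eq_bigr => k _; ring.
pose a := Num.sqrt (dotp v v); have a0 : 0 <= a by exact: sqrtr_ge0.
have a2 : dotp v v = a ^+ 2 by rewrite sqr_sqrtr// dotp_ge0.
move: hp; rewrite -/v e a2 L2 => hp.
have vu : 2^-1 * a * L <= dotp v u by nra.
have ap : 0 < a.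
  rewrite lt_def a0 andbT; apply/negP => /eqP az; move: hp; rewrite az expr0n/=.
  have v0 : dotp v v = 0 by rewrite a2 az expr0n.
  have -> : dotp v u = 0 by rewrite /dotp big1// => k _; rewrite (dotp0_eq v0) mul0r.
  nra.
exists (fun k => a^-1 * v k).
  split; first by apply: normalize; rewrite a2 exprn_gt0.
  rewrite dotpZl mulrC ler_pdivlMr//; apply: le_trans vu; nra.
rewrite zcountZ ?invr_gt0//; exact: Mdeep.
Qed.

End GridRisk.

Section UpperBound.
Context {R : realType}.

(** The first bound is needed for the chaining; the second, applied to [sigma] and to [t], gives
    [radius] at most 1. *)
Definition small_const : R := Num.min (16^-1 ^+ 7) (gdens / 10000).

Lemma small_const_gt0 : 0 < small_const.
Proof.
rewrite lt_min; apply/andP; split; first by apply: exprn_gt0; lra.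
by apply: divr_gt0; [exact: gdens_gt0|lra].
Qed.

Variables (n d : nat) (lam : 'I_n -> R).
Hypothesis d0 : (0 < d)%N.

(** [m] is any upper bound of the objective at [t], so the lemma serves near-minimisers and exact
    minimisers alike. *)
Lemma mobj_small (t m : R) : 0 <= t -> m <= small_const ^+ 2 -> (mobj d lam t <= m%:E)%E ->
  let g : pred 'I_n := fun i => lam i <= t in
  let sigma := Num.sqrt (d%:R / #|g|%:R) in
  [/\ 0 < sigma, sigma ^+ 2 * #|g|%:R = d%:R, sigma <= 16^-1 ^+ 7, sigma + t <= gdens / 5000 &
      radius sigma t ^+ 2 <= 2 * (5000 / gdens) ^+ 2 * m].
Proof.
move=> t0 mc; rewrite /mobj NcountE; set g : pred 'I_n := fun i => lam i <= t.
case: eqVneq => // gn0; rewrite lee_fin => tm /=.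
have gp : 0 < (#|g|%:R : R) by rewrite ltr0n lt0n.
have dp : 0 < (d%:R : R) by rewrite ltr0n.
have dg : 0 < d%:R / #|g|%:R :> R by rewrite divr_gt0.
set sigma := Num.sqrt _.
have s0 : 0 < sigma by rewrite sqrtr_gt0.
have s2 : sigma ^+ 2 = d%:R / #|g|%:R by rewrite sqr_sqrtr// ltW.
rewrite -s2 in tm.
have sc0 := small_const_gt0.
have sq (y : R) : 0 <= y -> y ^+ 2 <= m -> y <= small_const.
  move=> y0 ym; rewrite -(ler_pXn2r (n := 2)) ?nnegrE ?(ltW sc0)//; exact: le_trans mc.
have ssc : sigma <= small_const by apply: sq; [exact: ltW|have := sqr_ge0 t; lra].
have tsc : t <= small_const by apply: sq => //; have := sqr_ge0 sigma; lra.
have sc1 : small_const <= 16^-1 ^+ 7 by rewrite ge_min lexx.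
have sc2 : small_const <= gdens / 10000 by rewrite ge_min lexx orbT.
split.
- exact: s0.
- by rewrite s2 divfK ?gt_eqF.
- exact: le_trans sc1.
- apply: le_trans (lerD (le_trans ssc sc2) (le_trans tsc sc2)) _; lra.
rewrite /radius exprMn; move: (5000 / gdens) => k.
have h : (sigma + t) ^+ 2 <= 2 * m.
  by have := sqr_ge0 (sigma - t); move: tm; nra.
apply: le_trans (ler_wpM2l (sqr_ge0 k) h) _.
by rewrite mulrCA mulrA.
Qed.

End UpperBound.

Section Upper.
Context {R : realType}.
Variables (d n : nat) (lam : 'I_n -> R).
Hypotheses (d0 : (1 <= d)%N) (n0 : (1 <= n)%N).

Lemma m_d_lower : ((d%:R / n%:R)%:E <= m_d d lam)%E.
Proof.
apply/ereal_infP => _ [t _ <-]; rewrite /mobj; case: eqVneq => [|N0]; first by rewrite leey.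
rewrite lee_fin; apply: ler_wpDl; first exact: sqr_ge0.
rewrite ler_pM2l ?ltr0n// lef_pV2 ?posrE ?ltr0n ?lt0n//; last by rewrite -lt0n.
by rewrite ler_nat NcountE -[leqRHS]card_ord max_card.
Qed.

Lemma m_d_gt0 : (0 < m_d d lam)%E.
Proof. by apply: lt_le_trans m_d_lower; rewrite lte_fin divr_gt0// ltr0n. Qed.

(** 16 = 4 * 2 * 2: the doubled radius of the grid estimator, (sigma + t)^2 <= 2 (sigma^2 + t^2),
    and a threshold that is optimal only up to a factor 2. *)
Definition C_up : R := 16 * (5000 / gdens) ^+ 2.
Definition c_up : R := small_const ^+ 2 / 2.

Lemma C_up_gt0 : 0 < C_up.
Proof.
apply: mulr_gt0; first by lra.
by apply: exprn_gt0; apply: divr_gt0; [lra|exact: gdens_gt0].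
Qed.

Hypothesis mc : (m_d d lam <= c_up%:E)%E.

Lemma m_d_fin : m_d d lam = (fine (m_d d lam))%:E.
Proof.
rewrite fineK// ge0_fin_numE; first by apply: le_lt_trans mc _; exact: ltry.
exact: ltW m_d_gt0.
Qed.

Lemma L_PAC_upper : (L_PAC d lam <= C_up%:E * m_d d lam)%E.
Proof.
pose m := fine (m_d d lam).
have mE : m_d d lam = m%:E := m_d_fin.
have m0 : 0 < m by have := m_d_gt0; rewrite mE lte_fin.
(* Since m > 0, some threshold has objective below 2 m; the half in [c_up] makes room for it. *)
have [_ [t /= t01 <-] tm] : exists2 x, [set mobj d lam t | t in `[0, 1]%classic] x & (x < (2 * m)%:E)%E.
  apply: ereal_inf_lt; rewrite -/(m_d d lam) mE lte_fin; lra.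
move: t01; rewrite in_itv/= => /andP[t0 t1].
have m2 : 2 * m <= small_const ^+ 2.
  by move: mc; rewrite mE lee_fin /c_up; lra.
have [s0 sN s1 s2 s3] := mobj_small d0 t0 m2 (ltW tm).
rewrite mE -EFinM; apply: (@le_trans _ _ ((2 * radius (Num.sqrt (d%:R / #|(fun i => lam i <= t)|%:R)) t) ^+ 2)%:E); last first.
  rewrite lee_fin exprMn /C_up; move: s3; move: (5000 / gdens) => k; lra.
set s := Num.sqrt _ in s0 sN s1 s2 s3 *.
apply: ge_ereal_inf; exists ((2 * radius s t) ^+ 2)%:E => //.
exists ((2 * radius s t) ^+ 2) => //=.
pose g : pred 'I_n := fun i => lam i <= t.
pose M : estimator R n d := grid_estimator g (#|g|%:R * (2^-1 - delta s t)).
apply: ge_ereal_inf; exists (worst_risk lam M ((2 * radius s t) ^+ 2)).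
  by exists M => //; exact: measurable_grid_estimator.
apply/ereal_supP => _ [mu [dO [Om [P [X [B [Xt [setup ->]]]]]]]].
exact: (grid_estimator_risk d0 t0 s0 sN s1 s2 setup).
Qed.

Lemma tukey_upper (tstar : R) : 0 <= tstar <= 1 ->
  (forall t : R, 0 <= t <= 1 -> (mobj d lam tstar <= mobj d lam t)%E) ->
  forall M : estimator R n d, measurable_estimator M ->
  (forall z, is_tukey_median (wthr lam tstar) z (M z)) ->
  forall (mu : 'I_d -> R) (dO : measure_display) (Om : measurableType dO)
         (P : probability Om R) (X : Om -> 'I_n -> 'I_d -> R)
         (B : Om -> 'I_n -> bool) (Xt : Om -> 'I_n -> 'I_d -> R),
    contam_setup lam mu P X B Xt ->
    (P [set w | (C_up * fine (m_d d lam) <= sqdist (M (contaminate X B Xt w)) mu)%R]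
       <= (5%:R^-1)%:E)%E.
Proof.
move=> /andP[t0 t1] tmin M mM tM mu dO Om P X B Xt setup.
pose m := fine (m_d d lam).
have mE : m_d d lam = m%:E := m_d_fin.
have m0 : 0 < m by have := m_d_gt0; rewrite mE lte_fin.
have tm : (mobj d lam tstar <= m%:E)%E.
  by rewrite -mE; apply/ereal_infP => _ [t /= t01 <-]; apply: tmin; move: t01; rewrite in_itv.
have m2 : m <= small_const ^+ 2.
  by move: mc; rewrite mE lee_fin /c_up; have := sqr_ge0 (@small_const R); lra.
have [s0 sN s1 s2 s3] := mobj_small d0 t0 m2 tm.
apply: (tukey_median_risk d0 t0 s0 sN s1 s2 setup mM tM).
apply: le_trans s3 _; rewrite /C_up -/m ler_pM2r//; move: (5000 / gdens) => k.
by apply: ler_wpM2r; [exact: sqr_ge0|lra].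
Qed.

End Upper.

(** * Simulating a sample by rejection *)

Section Uniform01.
Context {R : realType}.
Let idR : measurableTypeR R -> R := idfun.
Let measurable_idR : measurable_fun setT idR. Proof. by move=> _ Y mY; rewrite setTI. Qed.

Definition uprob : probability R R :=
  distribution (uniform_prob (ltr01 : 0 < 1 :> R)) (HB.pack idR (isMeasurableFun.Build _ _ _ _ _ measurable_idR)).

Lemma uprob_le (c : R) : 0 <= c <= 1 -> uprob [set u | u <= c] = c%:E.
Proof.
move=> /andP[c0 c1]; rewrite /uprob /distribution /pushforward/=.
rewrite (_ : idR @^-1` _ = `]-oo, c]%classic); last by apply/seteqP; split => x /=; rewrite in_itv.
rewrite /uniform_prob integral_uniform_pdf.
rewrite (_ : _ `&` _ = `[0, c]%classic); last first.
  apply/seteqP; split => x /=; rewrite !in_itv/=; first by move=> [-> /andP[-> _]].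
  by move=> /andP[-> xc]; rewrite xc (le_trans xc).
rewrite (eq_integral (cst 1%E)).
  rewrite integral_cst//= mul1e lebesgue_measure_itv/=; case: ifPn; first by rewrite -EFinD subr0.
  by rewrite lte_fin -leNgt => cn; congr EFin; apply/eqP; rewrite eq_le c0 cn.
move=> x; rewrite inE/= in_itv/= => /andP[x0 xc].
by rewrite /uniform_pdf x0 (le_trans xc c1) subr0 invr1.
Qed.

End Uniform01.

Section Cell.
Context {R : realType}.
(* A cell [((x, u), y)] is a rejection trial: the proposal [x ~ zeta] is accepted when the uniform [u] is at most [f x];
   [y ~ N(mean, 1)] is a spare draw. *)
Definition cell := ((R * R) * R)%type.
Variables (zeta : probability R R) (f : R -> R) (beta mean : R).
Hypotheses (mf : measurable_fun setT f) (f01 : forall x, 0 <= f x <= 1).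
Hypothesis fE : forall A, measurable A -> (\int[zeta]_(x in A) (f x)%:E = beta%:E * nprob mean 1 A)%E.

Definition cell_prob : probability cell R := ((zeta \x uprob) \x nprob mean 1)%E.

Definition pass : set cell := [set c | c.1.2 <= f c.1.1].

Let pass2 : set (R * R) := [set c | c.2 <= f c.1].

Let measurable_pass2 : measurable pass2.
Proof.
have mh : measurable_fun setT (fun c : R * R => f c.1 - c.2).
  by apply: measurable_funB => //; exact: measurableT_comp.
rewrite -[X in measurable X]setTI (_ : pass2 = (fun c : R * R => f c.1 - c.2) @^-1` `[0, +oo[%classic).
  exact: mh.
by apply/seteqP; split => c /=; rewrite in_itv/= andbT subr_ge0.
Qed.

Let pass2_prob A : measurable A -> (zeta \x uprob)%E ([set c | A c.1] `&` pass2) = (beta%:E * nprob mean 1 A)%E.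
Proof.
move=> mA; rewrite -fE// /product_measure1 [RHS]integral_mkcond; apply: eq_integral => x _ /=.
have [Ax|Ax] := pselect (A x).
  rewrite patchE mem_set// -uprob_le//; congr (uprob _).
  by apply/seteqP; split => u /=; rewrite /xsection/= inE/=; [move=> [_]|].
rewrite patchE memNset// (_ : xsection _ _ = set0) ?measure0//.
by apply/seteqP; split => // u; rewrite /xsection/= inE/= => -[].
Qed.

Lemma measurable_pass : measurable pass.
Proof.
rewrite (_ : pass = pass2 `*` setT); first by exact: measurableX.
by apply/seteqP; split => c //= [].
Qed.

(** Rejection sampling: the uniform passes with probability f x, and [f] is [beta] times the density
    of the target with respect to [zeta]. *)
Lemma cell_pass_fst A : measurable A ->
  cell_prob (pass `&` [set c | A c.1.1]) = (beta%:E * nprob mean 1 A)%E.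
Proof.
move=> mA.
have mA2 : measurable ([set c : R * R | A c.1] `&` pass2).
  apply: measurableI => //; rewrite -[X in measurable X]setTI; exact: (measurable_fst measurableT).
rewrite (_ : _ `&` _ = ([set c : R * R | A c.1] `&` pass2) `*` setT).
  rewrite /cell_prob/= product_measure1E//.
  transitivity ((beta%:E * nprob mean 1 A) * 1)%E; last by rewrite mule1.
  by congr (_ * _)%E; [exact: pass2_prob|exact: probability_setT].
by apply/seteqP; split => c //=; [move=> [h1 h2]|move=> [[h1 h2] _]].
Qed.

Let pass2_prob1 : (zeta \x uprob)%E pass2 = beta%:E.
Proof.
have := pass2_prob measurableT; rewrite (_ : _ `&` _ = pass2); last by apply/seteqP; split => // c [].
by move=> ->; rewrite (_ : nprob mean 1 setT = 1%E) ?mule1//; exact: probability_setT.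
Qed.

(** The spare draw is independent of the acceptance, so it gives the same value as the accepted
    proposal. *)
Lemma cell_pass_snd A : measurable A ->
  cell_prob (pass `&` [set c | A c.2]) = (beta%:E * nprob mean 1 A)%E.
Proof.
move=> mA; rewrite (_ : _ `&` _ = pass2 `*` A).
  rewrite /cell_prob/= product_measure1E//.
  by congr (_ * _)%E; exact: pass2_prob1.
by apply/seteqP; split => c //= [].
Qed.

Lemma cell_snd A : measurable A -> cell_prob [set c | A c.2] = nprob mean 1 A.
Proof.
move=> mA; rewrite (_ : [set c | _] = setT `*` A).
  rewrite /cell_prob/= product_measure1E//.
  transitivity (1 * nprob mean 1 A)%E; last by rewrite mul1e.
  by congr (_ * _)%E; exact: probability_setT.
by apply/seteqP; split => c //= [].
Qed.

Lemma cell_fst A : measurable A -> cell_prob [set c | A c.1.1] = zeta A.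
Proof.
move=> mA; rewrite (_ : [set c | _] = (A `*` setT) `*` setT).
  rewrite /cell_prob/= product_measure1E//; last exact: measurableX.
  transitivity ((zeta \x uprob)%E (A `*` setT) * 1)%E; first by congr (_ * _)%E; exact: probability_setT.
  rewrite mule1 product_measure1E//.
  transitivity (zeta A * 1)%E; last by rewrite mule1.
  by congr (_ * _)%E; exact: probability_setT.
by apply/seteqP; split => c //= [[]].
Qed.

End Cell.

Section Simulation.
Context {R : realType}.
Variables (n d : nat) (lam : 'I_n -> R) (mu : 'I_d -> R).
Variables (zeta : 'I_n -> 'I_d -> probability R R) (f : 'I_n -> 'I_d -> R -> R) (beta : 'I_n -> 'I_d -> R).
Hypotheses (mf : forall i k, measurable_fun setT (f i k)) (f01 : forall i k x, 0 <= f i k x <= 1).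
Hypothesis fE : forall i k A, measurable A ->
  (\int[zeta i k]_(x in A) (f i k x)%:E = (beta i k)%:E * nprob (mu k) 1 A)%E.
Hypothesis betaE : forall i, \prod_(k < d) beta i k = 1 - lam i.

Notation Cell := (@cell R).
Let cprob i k : probability Cell R := cell_prob (zeta i k) (mu k).
Let Om := n.-tuple (d.-tuple Cell).
Let P : probability (n.-tuple (d.-tuple Cell)) R := tuple_product (fun i => tuple_product (cprob i)).

Let allpass i (x : d.-tuple Cell) : Prop := forall k, pass (f i k) (tnth x k).
(* The observed sample is always the vector of proposals: it is clean when all of them are accepted, and otherwise it is an
   outlier whose clean value is the vector of spare draws, so that [Xi] is independent of [Bi]. *)
Let Bi i (x : d.-tuple Cell) : bool := ~~ `[< allpass i x >].
Let Xi i (x : d.-tuple Cell) (k : 'I_d) : R := if Bi i x then (tnth x k).2 else (tnth x k).1.1.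

Let X (w : Om) i k : R := Xi i (tnth w i) k.
Let B (w : Om) i : bool := Bi i (tnth w i).
Let Xt (w : Om) i k : R := (tnth (tnth w i) k).1.1.

Let blk i (A : 'I_d -> set R) (D : set R) : set (d.-tuple Cell) :=
  [set x | (forall k, A k (Xi i x k)) /\ D (Bi i x)%:R].

(** The mass of [D] under Bernoulli(lam i). *)
Let bw i (D : set R) : R := (1 - lam i) * (`[< D 0 >])%:R + lam i * (`[< D 1 >])%:R.

(** Acceptance of all coordinates is a rectangle but its complement is not. The contaminated part of
    [blk] is therefore written as the difference of the rectangles [blk1] and [blk2]. *)
Let blk0 i (A : 'I_d -> set R) := rect (fun k => pass (f i k) `&` [set c : Cell | A k c.1.1]).
Let blk1 (A : 'I_d -> set R) : set (d.-tuple Cell) := rect (fun k => [set c : Cell | A k c.2]).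
Let blk2 i (A : 'I_d -> set R) := rect (fun k => pass (f i k) `&` [set c : Cell | A k c.2]).

Let mfst A : measurable A -> measurable [set c : Cell | A c.1.1].
Proof.
move=> mA; rewrite -[X in measurable X]setTI.
exact: (measurableT_comp (measurable_fst) (measurable_fst) measurableT).
Qed.

Let msnd A : measurable A -> measurable [set c : Cell | A c.2].
Proof. by move=> mA; rewrite -[X in measurable X]setTI; exact: (measurable_snd measurableT). Qed.

Let blkE i A D : blk i A D = (if `[< D 0 >] then blk0 i A else set0) `|` (if `[< D 1 >] then blk1 A `\` blk2 i A else set0).
Proof.
apply/seteqP; split => x; rewrite /blk/=.
  rewrite /Xi /Bi; case: asboolP => [ap|nap] /= [h hD].
    by left; rewrite asboolT// => k; split; [exact: ap|exact: h].
  by right; rewrite asboolT//; split => // h2; apply: nap => k; have [] := h2 k.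
case; case: asboolP => //= hD.
  move=> h; have ap : allpass i x by move=> k; have [] := h k.
  have Bx : Bi i x = false by rewrite /Bi asboolT.
  by rewrite /Xi Bx; split => // k; have [] := h k.
move=> [h1 h2].
have Bx : Bi i x = true.
  by rewrite /Bi asboolF// => ap; apply: h2 => k; split; [exact: ap|exact: h1].
by rewrite /Xi Bx.
Qed.

Section Block.
Variables (i : 'I_n) (A : 'I_d -> set R) (D : set R).
Hypothesis mA : forall k, measurable (A k).

Let m0 : measurable (blk0 i A).
Proof. by apply: measurable_rect => k; apply: measurableI; [exact: measurable_pass|exact: mfst]. Qed.
Let m1 : measurable (blk1 A).
Proof. by apply: measurable_rect => k; exact: msnd. Qed.
Let m2 : measurable (blk2 i A).
Proof. by apply: measurable_rect => k; apply: measurableI; [exact: measurable_pass|exact: msnd]. Qed.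

Lemma measurable_blk : measurable (blk i A D).
Proof. by rewrite blkE; apply: measurableU; case: ifP => // _; exact: measurableD. Qed.

Let NA := \prod_(k < d) fine (nprob (mu k) 1 (A k)).

Let p0 : tuple_product (cprob i) (blk0 i A) = ((1 - lam i) * NA)%:E.
Proof.
rewrite tuple_product_rect; last by move=> k; apply: measurableI; [exact: measurable_pass|exact: mfst].
rewrite -betaE /NA -big_split/=; congr EFin; apply: eq_bigr => k _.
have /= -> := cell_pass_fst (mf i k) (f01 i k) (@fE i k) (mA k).
by rewrite fineM//; exact: (@fin_num_measure _ _ _ (nprob (mu k) 1) (A k) (mA k)).
Qed.

Let p1 : tuple_product (cprob i) (blk1 A) = NA%:E.
Proof.
rewrite tuple_product_rect; last by move=> k; exact: msnd.
by congr EFin; apply: eq_bigr => k _; have /= -> := cell_snd (zeta i k) (mu k) (mA k).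
Qed.

Let p2 : tuple_product (cprob i) (blk2 i A) = ((1 - lam i) * NA)%:E.
Proof.
rewrite tuple_product_rect; last by move=> k; apply: measurableI; [exact: measurable_pass|exact: msnd].
rewrite -betaE /NA -big_split/=; congr EFin; apply: eq_bigr => k _.
have /= -> := cell_pass_snd (mf i k) (f01 i k) (@fE i k) (mA k).
by rewrite fineM//; exact: (@fin_num_measure _ _ _ (nprob (mu k) 1) (A k) (mA k)).
Qed.

(** The clean part has mass (1 - lam) NA and the contaminated part NA - (1 - lam) NA; the product
    form is the independence of clean value and contamination bit. *)
Lemma blk_prob : tuple_product (cprob i) (blk i A D) = (NA * bw i D)%:E.
Proof.
have m12 : measurable (blk1 A `\` blk2 i A) by exact: measurableD.
have p12 : tuple_product (cprob i) (blk1 A `\` blk2 i A) = (lam i * NA)%:E.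
  rewrite measureD//; last by apply: (le_lt_trans (probability_le1 _ _) (ltry _)).
  rewrite (_ : _ `&` _ = blk2 i A).
    by move: p1 p2 => /= -> ->; rewrite -EFinB; congr EFin; ring.
  apply/seteqP; split => x /=; first by case.
  by move=> h; split => // k; have [] := h k.
have disj : blk0 i A `&` (blk1 A `\` blk2 i A) = set0.
  apply/seteqP; split => // x [h0 [h1 h2]]; apply: h2 => k; split; [exact: (h0 k).1|exact: h1].
rewrite blkE /bw; case: asboolP => h0; case: asboolP => h1 /=; rewrite ?setU0 ?set0U.
- rewrite measureU//; move: p0 p12 => /= -> ->; rewrite -EFinD; congr EFin; ring.
- by rewrite p0; congr EFin; ring.
- by rewrite p12; congr EFin; ring.
- by rewrite measure0; congr EFin; ring.
Qed.

End Block.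

Let joint (A : 'I_n -> 'I_d -> set R) (D : 'I_n -> set R) : set Om :=
  [set w | forall i, (forall k, A i k (X w i k)) /\ D i (B w i)%:R].

Let joint_prob A D : (forall i k, measurable (A i k)) ->
  P (joint A D) = (\prod_(i < n) ((\prod_(k < d) fine (nprob (mu k) 1 (A i k))) * bw i (D i)))%:E.
Proof.
move=> mA; rewrite /P [LHS](@tuple_product_rect _ _ R n (fun i => tuple_product (cprob i)) (fun i => blk i (A i) (D i))).
  by congr EFin; apply: eq_bigr => i _; rewrite blk_prob.
by move=> i; exact: measurable_blk.
Qed.

Let measurable_joint A D : (forall i k, measurable (A i k)) -> measurable (joint A D).
Proof.
move=> mA; apply: (@measurable_rect _ _ n (fun i => blk i (A i) (D i))) => i.
exact: measurable_blk.
Qed.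

Let bwT i : bw i setT = 1.
Proof. by rewrite /bw !asboolT//= !mulr1 subrK. Qed.

Let NT k : fine (nprob (mu k) 1 setT) = 1.
Proof. by rewrite (_ : nprob (mu k) 1 setT = 1%E)//; exact: probability_setT. Qed.

Let NTd : \prod_(k < d) fine (nprob (mu k) 1 setT) = 1.
Proof. by apply: big1 => k _; exact: NT. Qed.

Let mX i k : measurable_fun setT (fun w : Om => X w i k).
Proof.
move=> _ Y mY; rewrite setTI.
rewrite (_ : _ @^-1` Y = joint (fun i' k' => if (i' == i) && (k' == k) then Y else setT) (fun=> setT)).
  by apply: measurable_joint => i' k'; case: ifP.
apply/seteqP; split => w /=.
  by move=> h i'; split => // k'; case: ifP => // /andP[/eqP -> /eqP ->].
by move=> /(_ i)[/(_ k)]; rewrite !eqxx.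
Qed.

Let mB i : measurable [set w : Om | B w i].
Proof.
rewrite (_ : [set w | _] = joint (fun _ _ => setT) (fun i' => if i' == i then [set 1] else setT)).
  by apply: measurable_joint.
apply/seteqP; split => w /=.
  by move=> h i'; split => //; case: eqP => // ->; rewrite /= h.
by move=> /(_ i)[_]; rewrite eqxx /=; case: (B w i) => //= /eqP; rewrite eq_sym oner_eq0.
Qed.

Let mXt i k : measurable_fun setT (fun w : Om => Xt w i k).
Proof.
apply: (measurableT_comp (measurable_fst)); apply: (measurableT_comp (measurable_fst)).
apply: (measurableT_comp (f := fun x : d.-tuple Cell => tnth x k)); exact: measurable_tnth.
Qed.

(** Every event in question is a [joint] event with [setT] in the remaining places, so all the laws
    follow from [joint_prob]. *)
Lemma simulated_setup : contam_setup lam mu P X B Xt.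
Proof.
split.
- by split.
- move=> i k A mA.
  have mA' i' k' : measurable (if (i' == i) && (k' == k) then A else setT) by case: ifP.
  rewrite [LHS](_ : _ = P (joint (fun i' k' => if (i' == i) && (k' == k) then A else setT) (fun=> setT))).
    rewrite joint_prob// (bigD1 i)//= (bigD1 k)//= !eqxx/= big1; last first.
      by move=> k' /negbTE ->; rewrite NT.
    rewrite bwT !mulr1 big1 ?mulr1 ?fineK ?fin_num_measure//.
    by move=> i' /negbTE ->; rewrite bwT mulr1 big1// => k' _; rewrite NT.
  congr (P _); apply/seteqP; split => w /=.
    by move=> h i'; split => // k'; case: ifP => // /andP[/eqP -> /eqP ->].
  by move=> /(_ i)[/(_ k)]; rewrite !eqxx.
- move=> i.
  rewrite [LHS](_ : _ = P (joint (fun _ _ => setT) (fun i' => if i' == i then [set 1] else setT))).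
    rewrite joint_prob// (bigD1 i)//= eqxx NTd big1 ?mulr1 ?mul1r; last by move=> i' /negbTE ->; rewrite bwT mulr1.
    rewrite /bw asboolF ?asboolT//=; first by congr EFin; ring.
    by move=> /esym/eqP; rewrite oner_eq0.
  congr (P _); apply/seteqP; split => w /=.
    by move=> h i'; split => //; case: eqP => // ->; rewrite /= h.
  by move=> /(_ i)[_]; rewrite eqxx /=; case: (B w i) => //= /eqP; rewrite eq_sym oner_eq0.
- move=> A mA.
  rewrite [X in fine (P X) = _](_ : _ = joint (fun i k => A (inl (i, k))) (fun i => A (inr i))); last first.
    apply/seteqP; split => w /=.
      by move=> h i; split; [move=> k; exact: (h (inl (i, k)))|exact: (h (inr i))].
    by move=> h [[i k]|i] /=; [exact: (h i).1|exact: (h i).2].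
  rewrite joint_prob//= big_split/= big_sumType/=; congr (_ * _).
    rewrite pair_big/=; apply: eq_bigr => -[i k] _ /=.
    have mA' i' k' : measurable (if (i' == i) && (k' == k) then A (inl (i, k)) else setT) by case: ifP.
    rewrite [X in _ = fine (P X)](_ : _ = joint (fun i' k' => if (i' == i) && (k' == k) then A (inl (i, k)) else setT) (fun=> setT)).
      rewrite joint_prob// (bigD1 i)//= (bigD1 k)//= !eqxx/= big1; last first.
        by move=> k' /negbTE ->; rewrite NT.
      rewrite bwT !mulr1 big1 ?mulr1//.
      by move=> i' /negbTE ->; rewrite bwT mulr1 big1// => k' _; rewrite NT.
    apply/seteqP; split => w /=.
      by move=> h i'; split => // k'; case: ifP => // /andP[/eqP -> /eqP ->].
    by move=> /(_ i)[/(_ k)]; rewrite !eqxx.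
  apply: eq_bigr => i _.
  rewrite [X in _ = fine (P X)](_ : _ = joint (fun _ _ => setT) (fun i' => if i' == i then A (inr i) else setT)).
    rewrite joint_prob// (bigD1 i)//= eqxx NTd big1 ?mulr1 ?mul1r// => i' /negbTE ->.
    by rewrite bwT mulr1.
  apply/seteqP; split => w /=.
    by move=> h i'; split => //; case: eqP => // ->.
  by move=> /(_ i)[_]; rewrite eqxx.
Qed.

Lemma simulated_law E : measurable E ->
  P [set w | E (sample_tuple (contaminate X B Xt w))] = tuple_product (fun i => tuple_product (zeta i)) E.
Proof.
move=> mE.
have mZ i k : measurable_fun setT (fun w : Om => Xt w i k) := mXt i k.
have eZ w : contaminate X B Xt w = Xt w.
  apply/funext => i; rewrite /contaminate; case: ifP => // Bw; apply/funext => k.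
  by rewrite /X /Xi -/(B w i) Bw.
have mF := measurable_sample_tuple mZ.
pose FM := isMeasurableFun.Build _ _ _ _ _ mF.
pose F : {mfun Om >-> n.-tuple (d.-tuple R)} := HB.pack (fun w => sample_tuple (Xt w)) FM.
rewrite [LHS](_ : _ = distribution P F E); last first.
  by congr (P _); apply/seteqP; split => w /=; rewrite eZ.
apply: (@tuple2_measure_unique _ _ _ n d (distribution P F) (tuple_product (fun i => tuple_product (zeta i)))) => //.
  exact: (le_lt_trans (probability_le1 _ _) (ltry _)).
move=> A mA; transitivity (\prod_(i < n) \prod_(k < d) fine (zeta i k (A i k)))%:E; last first.
  by apply/esym; exact: (tuple2_product_rect zeta mA).
rewrite [LHS](_ : _ = P (rect (fun i => rect (fun k => [set c : Cell | A i k c.1.1])))); last first.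
  by congr (P _); apply/seteqP; split => w /= h i k; have := h i k; rewrite sample_tupleE.
rewrite /P [LHS]tuple_product_rect; last first.
  by move=> i; apply: measurable_rect => k; exact: mfst.
congr EFin; apply: eq_bigr => i _; rewrite tuple_product_rect; last by move=> k; exact: mfst.
by rewrite /=; apply: eq_bigr => k _; have /= -> := cell_fst (zeta i k) (mu k) (mA i k).
Qed.

(** Replaces the adversary by a plain product law: any family [zeta] that dominates the clean law in
    the sense of [fE] and [betaE] can be presented to the estimator. *)
Lemma simulated_risk (M : estimator R n d) (s : R) : measurable_estimator M ->
  (tuple_product (fun i => tuple_product (zeta i))
    [set z | (s <= sqdist (M (fun i k => tnth (tnth z i) k)) mu)%R] <= worst_risk lam M s)%E.
Proof.
move=> mM; set E := [set z | _].
have mE : measurable E.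
  have mS : measurable_fun setT (fun z : n.-tuple (d.-tuple R) => sqdist (M (fun i k => tnth (tnth z i) k)) mu).
    apply: measurable_sum => k; apply: measurable_funX; apply: measurable_funB => //.
    apply: (mM _ _ (fun (z : n.-tuple (d.-tuple R)) i k => tnth (tnth z i) k)) => i k'.
    by apply: (measurableT_comp (f := fun x : d.-tuple R => tnth x k')); exact: measurable_tnth.
  rewrite -[X in measurable X]setTI (_ : E = (fun z : n.-tuple (d.-tuple R) => sqdist (M (fun i k => tnth (tnth z i) k)) mu) @^-1` `[s, +oo[%classic).
    exact: mS.
  by apply/seteqP; split => z /=; rewrite in_itv/= andbT.
apply: ereal_sup_ubound; exists mu, _, _, P, X, B, Xt; split; first exact: simulated_setup.
rewrite -simulated_law//; congr (P _); apply/seteqP; split => w /=; rewrite /E /=;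
  rewrite (_ : (fun i k => _) = contaminate X B Xt w)//;
  by apply/funext => i; apply/funext => k; rewrite sample_tupleE.
Qed.

End Simulation.

(** * The hypercube and the lower bound *)

Section NormalDensity.
Context {R : realType}.

Lemma nprob_density (m1 s1 m2 s2 : R) (l : R -> R) : measurable_fun setT l -> (forall x, 0 <= l x) ->
  (forall x, normal_pdf m1 s1 x = l x * normal_pdf m2 s2 x) ->
  forall A, measurable A -> (\int[nprob m2 s2]_(x in A) (l x)%:E = nprob m1 s1 A)%E.
Proof.
move=> ml l0 lE A mA; rewrite nprobE /normal_prob integral_mkcond [RHS]integral_mkcond.
have mf : measurable_fun setT (fun x : R => ((l x)%:E * (\1_A x)%:E)%E).
  by apply: emeasurable_funM; apply/measurable_EFinP.
transitivity (\int[nprob m2 s2]_x ((l x)%:E * (\1_A x)%:E))%E.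
  by apply: eq_integral => x _; rewrite epatch_indic.
rewrite integral_nprob//; last by move=> x; rewrite mule_ge0// lee_fin.
rewrite integral_normal//; last by move=> x; rewrite mule_ge0// lee_fin.
by apply: eq_integral => x _; rewrite epatch_indic -!EFinM lE; congr EFin; ring.
Qed.

Lemma normal_pdf_flip (a x : R) : normal_pdf a 1 x = expR (2 * a * x) * normal_pdf (- a) 1 x.
Proof.
rewrite !normal_pdfE ?oner_neq0//= mulrCA /normal_fun -expRD; congr (_ * expR _).
by field.
Qed.

(** The squared likelihood ratio times the density of N(- a, 1) is exp(4 a^2) times the density of
    N(3 a, 1). *)
Lemma flip_second_moment (a : R) :
  (\int[nprob (- a) 1]_x (expR (2 * a * x) ^+ 2)%:E = (expR (4 * a ^+ 2))%:E)%E.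
Proof.
have mx : measurable_fun setT (fun x : R => (expR (2 * a * x) ^+ 2)%:E).
  by apply/measurable_EFinP; apply: measurable_funX; apply: measurableT_comp => //; exact: measurable_funM.
rewrite integral_nprob//.
rewrite integral_normal//.
transitivity (\int[@lebesgue_measure R]_x ((expR (4 * a ^+ 2))%:E * (normal_pdf (3 * a) 1 x)%:E))%E.
  apply: eq_integral => x _.
  rewrite -!EFinM !normal_pdfE ?oner_neq0//= mulrCA [in RHS]mulrCA; congr (_ * _)%:E.
  by rewrite /normal_fun -expRM_natl -!expRD; congr expR; field.
rewrite ge0_integralZl ?lee_fin ?expR_ge0//.
- by rewrite integral_normal_pdf mule1.
- by apply/measurable_EFinP; exact: measurable_normal_pdf.
- by move=> x _; rewrite lee_fin normal_pdf_ge0.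
Qed.

(* The wider Gaussian N(0, 1 + a) dominates N(m, 1), m = +-a, up to the factor exp(a). *)
Definition hide_ratio (m a x : R) : R := normal_pdf m 1 x / normal_pdf 0 (Num.sqrt (1 + a)) x.

Lemma sqrt1_neq0 (a : R) : 0 < a -> Num.sqrt (1 + a) != 0.
Proof. by move=> a0; rewrite gt_eqF// sqrtr_gt0 addr_gt0. Qed.

Lemma hide_ratioE (m a x : R) : 0 < a ->
  normal_pdf m 1 x = hide_ratio m a x * normal_pdf 0 (Num.sqrt (1 + a)) x.
Proof.
move=> a0; rewrite /hide_ratio divfK// gt_eqF// normal_pdfE ?sqrt1_neq0//=.
by rewrite mulr_gt0 ?expR_gt0// normal_peak_gt0// sqrt1_neq0.
Qed.

Lemma hide_ratio_ge0 (m a x : R) : 0 <= hide_ratio m a x.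
Proof. by rewrite divr_ge0 ?normal_pdf_ge0. Qed.

Lemma measurable_hide_ratio (m a : R) : 0 < a -> measurable_fun setT (hide_ratio m a).
Proof.
move=> a0; apply: continuous_measurable_fun => x.
apply: continuousM; first by apply: continuous_normal_pdf; exact: oner_neq0.
apply: continuousV; last by apply: continuous_normal_pdf; exact: sqrt1_neq0.
rewrite gt_eqF// normal_pdfE ?sqrt1_neq0//=.
by rewrite mulr_gt0 ?expR_gt0// normal_peak_gt0// sqrt1_neq0.
Qed.

(** The ratio of the peaks is sqrt(1 + a) <= exp(a / 2). The difference of the exponents is largest
    at x = (1 + a) m / a, where it equals m^2 / (2 a) = a / 2. *)
Lemma hide_ratio_le (m a x : R) : 0 < a -> m ^+ 2 = a ^+ 2 -> expR (- a) * hide_ratio m a x <= 1.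
Proof.
move=> a0 m2; have s0 := sqrt1_neq0 a0.
have sp : 0 < Num.sqrt (1 + a) by rewrite sqrtr_gt0 addr_gt0.
have s2 : Num.sqrt (1 + a) ^+ 2 = 1 + a by rewrite sqr_sqrtr// addr_ge0// ltW.
have p0 : 0 < normal_peak (1 : R) by rewrite normal_peak_gt0 ?oner_neq0.
have pp : 0 < normal_pdf 0 (Num.sqrt (1 + a)) x.
  by rewrite normal_pdfE//= mulr_gt0 ?expR_gt0// normal_peak_gt0.
rewrite /hide_ratio mulrA ler_pdivrMr// mul1r !normal_pdfE ?oner_neq0//= (normal_peak_scale sp).
rewrite mulrCA mulrAC ler_pdivlMr//.
have ss : Num.sqrt (1 + a) <= expR (a / 2).
  rewrite -(ler_pXn2r (n := 2)) ?nnegrE ?expR_ge0 ?(ltW sp)// s2 -expRM_natl.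
  by apply: le_trans (expR_ge1Dx _) _; rewrite ler_expR; lra.
rewrite -!mulrA; apply: ler_wpM2l; first exact: ltW.
apply: (@le_trans _ _ (expR (- a) * (normal_fun m 1 x * expR (a / 2)))).
  by do 2 (apply: ler_wpM2l; first exact: expR_ge0).
rewrite /normal_fun -!expRD ler_expR s2.
have key : - (x - m) ^+ 2 / 2 + x ^+ 2 / (2 * (1 + a)) <= a / 2.
  have h : 0 <= a * (x - (1 + a) * m / a) ^+ 2 by rewrite mulr_ge0 ?sqr_ge0// ltW.
  have e : a * (x - (1 + a) * m / a) ^+ 2 = a * x ^+ 2 - 2 * (1 + a) * m * x + (1 + a) ^+ 2 * m ^+ 2 / a.
    by field; rewrite gt_eqF.
  have e2 : (1 + a) ^+ 2 * m ^+ 2 / a = (1 + a) ^+ 2 * a by rewrite m2; field; rewrite gt_eqF.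
  have a1 : 0 < 2 * (1 + a) by rewrite mulr_gt0// addr_gt0.
  rewrite -(ler_pM2r a1) mulrDl divfK ?gt_eqF//.
  rewrite e e2 in h; nra.
rewrite expr1n subr0.
have e3 : - x ^+ 2 / ((1 + a) *+ 2) = - (x ^+ 2 / (2 * (1 + a))) by rewrite mulNr -[(1 + a) *+ 2]mulr_natl.
rewrite e3; move: key; lra.
Qed.

End NormalDensity.

Section ChiSquare.
Context d (T : measurableType d) (R : realType) (Q Q' : probability T R) (L : T -> R) (e : R).
Hypotheses (mL : measurable_fun setT L) (L0 : forall x, 0 <= L x) (e0 : 0 < e).
Hypothesis QE : forall A, measurable A -> Q' A = (\int[Q]_(x in A) (L x)%:E)%E.
Hypothesis L2 : (\int[Q]_x (L x ^+ 2)%:E <= (1 + e ^+ 2)%:E)%E.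

(** The chi-square divergence is at most e^2. The pointwise bound L - 1 <= e / 2 + (L - 1)^2 / (2 e)
    takes the place of Cauchy-Schwarz. *)
Lemma chi_square_tv A : measurable A -> (Q' A <= Q A + e%:E)%E.
Proof.
move=> mA.
have mLE : measurable_fun setT (EFin \o L) by exact/measurable_EFinP.
have mD : measurable_fun setT (fun x => ((L x - 1) ^+ 2)%:E).
  by apply/measurable_EFinP; apply: measurable_funX; exact: measurable_funB.
have D0 x : (0 <= ((L x - 1) ^+ 2)%:E)%E by rewrite lee_fin sqr_ge0.
have L1 : (\int[Q]_x (L x)%:E = 1)%E by rewrite -QE//; exact: probability_setT.
have D2 : (\int[Q]_x ((L x - 1) ^+ 2)%:E <= (e ^+ 2)%:E)%E.
  (* Uses (L - 1)^2 + 2 L = L^2 + 1, an identity between nonnegative functions. *)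
  have h : (\int[Q]_x ((L x - 1) ^+ 2)%:E + 2%:E <= (1 + e ^+ 2)%:E + 1%:E)%E.
    have -> : 2%:E = (\int[Q]_x (2%:E * (L x)%:E))%E.
      rewrite ge0_integralZl//; first by rewrite L1 mule1.
      by move=> x _; rewrite lee_fin.
    rewrite -ge0_integralD//; last 2 first.
    - by move=> x _; rewrite -EFinM lee_fin mulr_ge0.
    - exact: emeasurable_funM.
    apply: (@le_trans _ _ (\int[Q]_x ((L x ^+ 2)%:E + 1%:E))%E).
      rewrite le_eqVlt; apply/orP; left; apply/eqP; apply: eq_integral => x _.
      by rewrite -EFinM -!EFinD; congr EFin; ring.
    rewrite ge0_integralD//; last 2 first.
    - by move=> x _; rewrite lee_fin sqr_ge0.
    - by apply/measurable_EFinP; exact: measurable_funX.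
    apply: leeD => //; rewrite integral_cst// mul1e; exact: probability_le1.
  move: h; case: (integral _ _ _) => [r| |].
  - by rewrite -!EFinD !lee_fin; lra.
  - by rewrite addye// leye_eq.
  - by move=> _; rewrite leNye.
apply: (@le_trans _ _ (\int[Q]_x ((\1_A x)%:E + ((e / 2)%:E + ((2 * e)^-1)%:E * ((L x - 1) ^+ 2)%:E)))%E).
  rewrite QE// integral_mkcond; apply: ge0_le_integral => //.
  - by move=> x _; rewrite epatch_indic mule_ge0// lee_fin.
  - rewrite (_ : _ \_ _ = fun x => (L x)%:E * (\1_A x)%:E)%E; last by apply/funext => x; rewrite epatch_indic.
    by apply: emeasurable_funM => //; apply/measurable_EFinP.
  - apply: emeasurable_funD; first exact/measurable_EFinP.
    by apply: emeasurable_funD => //; exact: emeasurable_funM.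
  - move=> x _; rewrite epatch_indic -!EFinM -!EFinD lee_fin.
    have q : L x - 1 <= e / 2 + (2 * e)^-1 * (L x - 1) ^+ 2.
      have h : 0 <= (2 * e)^-1 * (L x - 1 - e) ^+ 2 by rewrite mulr_ge0 ?sqr_ge0// invr_ge0 mulr_ge0// ltW.
      have -> : e / 2 + (2 * e)^-1 * (L x - 1) ^+ 2 = (2 * e)^-1 * (L x - 1 - e) ^+ 2 + (L x - 1).
        by field; rewrite gt_eqF.
      lra.
    have q0 : 0 <= e / 2 + (2 * e)^-1 * (L x - 1) ^+ 2.
      apply: addr_ge0; first by rewrite divr_ge0// (ltW e0).
      by apply: mulr_ge0; [rewrite invr_ge0 mulr_ge0// (ltW e0)|exact: sqr_ge0].
    by rewrite indicE; case: (x \in A); rewrite /= ?mulr1 ?mulr0; move: q q0; lra.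
have e20 : 0 <= (2 * e)^-1 by rewrite invr_ge0 mulr_ge0// ltW.
rewrite ge0_integralD//; last 3 first.
- exact/measurable_EFinP.
- by move=> x _; apply: adde_ge0; [rewrite lee_fin divr_ge0// (ltW e0)|apply: mule_ge0 => //; rewrite lee_fin].
- by apply: emeasurable_funD => //; exact: emeasurable_funM.
rewrite integral_indic// setIT; apply: leeD => //.
rewrite ge0_integralD//; last 3 first.
- by move=> x _; rewrite lee_fin divr_ge0// (ltW e0).
- by move=> x _; rewrite mule_ge0// lee_fin.
- exact: emeasurable_funM.
rewrite ge0_integralZl ?lee_fin//.
have -> : (e%:E = (e / 2)%:E + ((2 * e)^-1)%:E * (e ^+ 2)%:E)%E.
  by rewrite -EFinM -EFinD; congr EFin; field; rewrite gt_eqF.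
apply: leeD; last by apply: lee_wpmul2l; rewrite ?lee_fin.
by rewrite integral_cst//; rewrite -[leRHS]mule1; apply: lee_wpmul2l; [rewrite lee_fin divr_ge0// ltW|exact: probability_le1].
Qed.

End ChiSquare.

Section Hypercube.
Context {R : realType}.
Variables (n d K : nat) (lam : 'I_n -> R) (gam : R).
Hypotheses (d0 : (0 < d)%N) (Kd : (K <= d)%N) (lam01 : forall i, 0 <= lam i <= 1) (gam0 : 0 < gam).

Definition cube_mean (tau : {ffun 'I_d -> bool}) (k : 'I_d) : R :=
  if (k < K)%N then (if tau k then gam else - gam) else 0.

(** The samples with too little contamination for the adversary to hide the vertex; in [cube_law]
    all others have a law that does not depend on [tau]. *)
Definition clean : pred 'I_n := fun i => lam i <= K%:R * gam.

Definition cube_law (tau : {ffun 'I_d -> bool}) (i : 'I_n) (k : 'I_d) : probability R R :=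
  if clean i then nprob (cube_mean tau k) 1
  else if (k < K)%N then nprob 0 (Num.sqrt (1 + gam)) else nprob 0 1.

Definition cube_prob (tau : {ffun 'I_d -> bool}) : probability (n.-tuple (d.-tuple R)) R :=
  tuple_product (fun i => tuple_product (cube_law tau i)).

Lemma fine_le_add (p q : \bar R) (e : R) : p \is a fin_num -> q \is a fin_num ->
  (p <= q + e%:E)%E -> fine p <= fine q + e.
Proof. by move=> /fineK {1}<- /fineK {1}<-; rewrite -EFinD lee_fin. Qed.

Lemma card_ltK : #|[pred k : 'I_d | (k < K)%N]| = K.
Proof. by rewrite -sum1_card -(big_ord_widen d (fun=> 1%N) Kd) sum1_card card_ord. Qed.

Section Hide.
Variable tau : {ffun 'I_d -> bool}.
(** [h] is the density of the clean law with respect to the proposal, and [b] scales it to an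
    acceptance probability. *)
Let b i (k : 'I_d) : R := if clean i then 1 else if (k < K)%N then expR (- gam) else 1.
Let h i (k : 'I_d) (x : R) : R := if clean i then 1 else if (k < K)%N then hide_ratio (cube_mean tau k) gam x else 1.
Let Bi i := \prod_(k < d) b i k.
(** Accepting with [b * h] succeeds with probability [Bi i], which may exceed 1 - lam i; the excess
    is removed in the first coordinate alone. *)
Let c i := (1 - lam i) / Bi i.
Let beta i (k : 'I_d) : R := b i k * (if k == Ordinal d0 then c i else 1).

Let b0 i k : 0 < b i k. Proof. by rewrite /b; case: ifP => // _; case: ifP => // _; exact: expR_gt0. Qed.
Let h0 i k x : 0 <= h i k x.
Proof. by rewrite /h; case: ifP => // _; case: ifP => // _; exact: hide_ratio_ge0. Qed.
Let mh i k : measurable_fun setT (h i k).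
Proof. by rewrite /h; case: (clean i) => //; case: (k < K)%N => //; exact: measurable_hide_ratio. Qed.
Let bh i k x : b i k * h i k x <= 1.
Proof.
rewrite /b /h; case: ifP => _; first by rewrite mulr1.
case: ifP => kK; last by rewrite mulr1.
by apply: hide_ratio_le => //; rewrite /cube_mean kK; case: (tau k); rewrite ?sqrrN.
Qed.
Let Bi0 i : 0 < Bi i. Proof. by apply: prodr_gt0 => k _; exact: b0. Qed.
(** For a hidden sample [Bi i] is exp(- K gam) >= 1 - K gam, and lam i > K gam. *)
Let Bi_ge i : 1 - lam i <= Bi i.
Proof.
rewrite /Bi /b; have [cl|cl] := boolP (clean i).
  by rewrite big1// lerBlDr lerDl; have /andP[] := lam01 i.
move: cl; rewrite /clean -ltNge => li; rewrite -big_mkcond/= prodr_const.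
rewrite (_ : #|_| = K); last by rewrite -[RHS]card_ltK; apply: eq_card.
rewrite -expRM_natl; apply: le_trans (expR_ge1Dx _); rewrite mulrN; move: li; lra.
Qed.
Let c01 i : 0 <= c i <= 1.
Proof.
rewrite /c divr_ge0 ?(ltW (Bi0 i))//=; last by rewrite subr_ge0; have /andP[] := lam01 i.
by rewrite ler_pdivrMr// mul1r.
Qed.
Let beta0 i k : 0 <= beta i k.
Proof. by rewrite /beta mulr_ge0 ?(ltW (b0 i k))//; case: ifP => // _; have /andP[] := c01 i. Qed.

Lemma cube_risk (M : estimator R n d) (s : R) : measurable_estimator M ->
  (cube_prob tau [set z | (s <= sqdist (M (fun i k => tnth (tnth z i) k)) (cube_mean tau))%R] <= worst_risk lam M s)%E.
Proof.
move=> mM.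
apply: (@simulated_risk R n d lam (cube_mean tau) (cube_law tau) (fun i k x => beta i k * h i k x) beta) => //.
- by move=> i k; exact: measurable_funM.
- move=> i k x; rewrite mulr_ge0//= /beta mulrAC.
  have bh0 : 0 <= b i k * h i k x by rewrite mulr_ge0// (ltW (b0 i k)).
  case: ifP => _; last by rewrite mulr1; exact: bh.
  by have /andP[c0 c1] := c01 i; exact: mulr_ile1.
- move=> i k A mA; under eq_integral do rewrite EFinM.
  rewrite ge0_integralZl ?lee_fin//; last 2 first.
  + by apply/measurable_EFinP; exact: measurable_funTS.
  + by move=> x _; rewrite lee_fin.
  congr (_ * _)%E; rewrite /cube_law; case: ifPn => cl.
    apply: nprob_density => //.
    by move=> x; rewrite /h cl mul1r.
  case: ifPn => kK.
    apply: nprob_density => //.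
    by move=> x; rewrite /h (negbTE cl) kK; exact: hide_ratioE.
  apply: nprob_density => //.
  by move=> x; rewrite /h (negbTE cl) (negbTE kK) mul1r /cube_mean (negbTE kK).
- move=> i; rewrite /beta big_split/= -/(Bi i) (bigD1 (Ordinal d0))//= ?eqxx big1 ?mulr1.
    by rewrite /c mulrC divfK// gt_eqF.
  by move=> k /negbTE ->.
Qed.

End Hide.

Definition flip (j : 'I_d) (tau : {ffun 'I_d -> bool}) : {ffun 'I_d -> bool} :=
  [ffun k => if k == j then ~~ tau k else tau k].

Lemma flipK j : involutive (flip j).
Proof. by move=> tau; apply/ffunP => k; rewrite !ffunE; case: (k == j); rewrite ?negbK. Qed.

Hypothesis info : #|clean|%:R * gam ^+ 2 <= 100^-1.

(** The two laws differ only in coordinate [j] of the clean samples, so the second moment of the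
    likelihood ratio is exp(4 gam^2 N) with N the number of clean samples. By [info] the exponent is
    at most 1/25, and the moment stays below 1 + (3/10)^2. *)
Lemma cube_tv (tau : {ffun 'I_d -> bool}) (j : 'I_d) A : (j < K)%N -> tau j -> measurable A ->
  (cube_prob tau A <= cube_prob (flip j tau) A + (3 / 10)%:E)%E.
Proof.
move=> jK tj mA; pose tau' := flip j tau.
pose l i (k : 'I_d) (x : R) : R := if clean i && (k == j) then expR (2 * gam * x) else 1.
have ml i k : measurable_fun setT (l i k).
  by rewrite /l; case: (_ && _) => //; apply: measurableT_comp => //; exact: measurable_funM.
have l0 i k x : 0 <= l i k x by rewrite /l; case: ifP => // _; exact: expR_ge0.
have lE i k B : measurable B -> cube_law tau i k B = (\int[cube_law tau' i k]_(x in B) (l i k x)%:E)%E.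
  move=> mB; rewrite /cube_law /l; case: ifP => //= cl; last first.
    by case: ifP => _; rewrite (eq_integral (cst 1%E))// integral_cst// mul1e.
  apply/esym/nprob_density => //.
  + by case: (k == j) => //; apply: measurableT_comp => //; exact: measurable_funM.
  + by move=> x; case: ifP => // _; exact: expR_ge0.
  move=> x; case: eqP => [->|/eqP kj].
    by rewrite /cube_mean jK tj /tau' ffunE eqxx tj /=; exact: normal_pdf_flip.
  by rewrite mul1r /cube_mean /tau' ffunE (negbTE kj).
pose li i (t : d.-tuple R) := \prod_(k < d) l i k (tnth t k).
have mli i : measurable_fun setT (li i) by apply: measurable_tuple_prod.
have li0 i t : 0 <= li i t by apply: prodr_ge0 => k _.
have liE i B : measurable B -> tuple_product (cube_law tau i) B = (\int[tuple_product (cube_law tau' i)]_(x in B) (li i x)%:E)%E.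
  by move=> mB; apply: tuple_product_density => // k C mC; exact: lE.
apply: (@chi_square_tv _ _ R (cube_prob tau') (cube_prob tau) (fun t => \prod_(i < n) li i (tnth t i)) (3 / 10)) => //.
- exact: measurable_tuple_prod.
- by move=> t; apply: prodr_ge0.
- by move=> B mB; apply: tuple_product_density.
have inner i : (\int[tuple_product (cube_law tau' i)]_t (li i t ^+ 2)%:E =
    (\prod_(k < d) (if clean i && (k == j) then expR (4 * gam ^+ 2) else 1))%:E)%E.
  rewrite -(integral_tuple_product (P := cube_law tau' i) (f := fun k x => l i k x ^+ 2)).
  - by apply: eq_integral => t _; rewrite -prodrXl.
  - by move=> k; exact: measurable_funX.
  - by move=> k x; exact: sqr_ge0.
  - move=> k; rewrite /l; case: ifP => [/andP[cl /eqP ->]|_].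
      rewrite /cube_law cl /cube_mean jK /tau' ffunE eqxx tj/=; exact: flip_second_moment.
    rewrite (eq_integral (cst 1%E)); last by move=> x _; rewrite expr1n.
    by rewrite integral_cst// mul1e; exact: probability_setT.
have -> : (\int[cube_prob tau']_t ((\prod_(i < n) li i (tnth t i)) ^+ 2)%:E =
    (\prod_(i < n) \prod_(k < d) (if clean i && (k == j) then expR (4 * gam ^+ 2) else 1))%:E)%E.
  rewrite -(integral_tuple_product (P := fun i => tuple_product (cube_law tau' i)) (f := fun i t => li i t ^+ 2)).
  - by apply: eq_integral => t _; rewrite -prodrXl.
  - by move=> i; exact: measurable_funX.
  - by move=> i t; exact: sqr_ge0.
  - by move=> i; exact: inner.
rewrite lee_fin.
rewrite (eq_bigr (fun i => if clean i then expR (4 * gam ^+ 2) else 1)); last first.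
  move=> i _; case: ifP => cl /=; last by rewrite big1.
  by rewrite -big_mkcond/= big_pred1_eq.
rewrite -big_mkcond/= prodr_const -expRM_natl.
have y0 : #|clean|%:R * (4 * gam ^+ 2) <= 25^-1 by move: info; lra.
have yy : 0 <= #|clean|%:R * (4 * gam ^+ 2) by rewrite mulr_ge0// mulr_ge0// sqr_ge0.
apply: le_trans (expR_le_quadratic _) _; first by lra.
nra.
Qed.

(** Assouad's argument. The errors in the sign of a coordinate at two neighbouring vertices have
    total probability at least 7/10, so some vertex has at least 7 K / 20 wrong signs on average.
    Each wrong sign costs gam^2, so off the event there are at most K / 10 of them, and 7/20 - 1/10
    = 1/4. *)
Lemma cube_risk_exists (M : estimator R n d) (s : R) : (0 < K)%N -> measurable_estimator M ->
  s <= K%:R * gam ^+ 2 / 10 -> exists tau : {ffun 'I_d -> bool},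
  (4^-1%:E <= cube_prob tau [set z | (s <= sqdist (M (fun i k => tnth (tnth z i) k)) (cube_mean tau))%R])%E.
Proof.
move=> K0 mM sK.
(* From here on only the total variation bound between neighbouring vertices matters. *)
move: cube_prob cube_tv => cp cp_tv.
pose m (z : n.-tuple (d.-tuple R)) k : R := M (fun i k => tnth (tnth z i) k) k.
have mm k : measurable_fun setT (fun z => m z k).
  apply: (mM _ _ (fun (z : n.-tuple (d.-tuple R)) i k => tnth (tnth z i) k)) => i k'.
  by apply: (measurableT_comp (f := fun x : d.-tuple R => tnth x k')); exact: measurable_tnth.
pose S k := [set z | 0 <= m z k].
have mS k : measurable (S k).
  rewrite -[X in measurable X]setTI (_ : S k = (fun z => m z k) @^-1` `[0, +oo[%classic).
    exact: mm.
  by apply/seteqP; split => z /=; rewrite in_itv/= andbT.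
pose err (tau : {ffun 'I_d -> bool}) k := if tau k then ~` S k else S k.
have merr tau k : measurable (err tau k) by rewrite /err; case: ifP => // _; exact: measurableC.
pose a (tau : {ffun 'I_d -> bool}) (k : 'I_d) : R := fine (cp tau (err tau k)).
have fE (tau : {ffun 'I_d -> bool}) B : measurable B -> cp tau B = (fine (cp tau B))%:E.
  by move=> mB; rewrite fineK// fin_num_measure.
have aE tau k : (a tau k)%:E = cp tau (err tau k) by rewrite fineK// fin_num_measure.
have pair1 (tau : {ffun 'I_d -> bool}) (k : 'I_d) : (k < K)%N -> tau k -> 7 / 10 <= a tau k + a (flip k tau) k.
  move=> kK tk; have tv := cp_tv _ _ _ kK tk (mS k).
  have e1 : a tau k = 1 - fine (cp tau (S k)).
    rewrite /a /err tk probability_setC// -[X in (1 - X)%E]fineK ?fin_num_measure// -EFinB//.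
  have e2 : a (flip k tau) k = fine (cp (flip k tau) (S k)).
    by rewrite /a /err ffunE eqxx tk.
  have f1 : cp tau (S k) \is a fin_num by apply: fin_num_measure; exact: mS.
  have f2 : cp (flip k tau) (S k) \is a fin_num by apply: fin_num_measure; exact: mS.
  have := fine_le_add f1 f2 tv; rewrite -e2; move: e1; move: (a tau k) (a _ k) (fine _) => x y w; lra.
have pair (tau : {ffun 'I_d -> bool}) (k : 'I_d) : (k < K)%N -> 7 / 10 <= a tau k + a (flip k tau) k.
  move=> kK; have [tk|tk] := boolP (tau k); first exact: pair1.
  have := @pair1 (flip k tau) k kK; rewrite ffunE eqxx => /(_ tk).
  by rewrite flipK addrC.
(* Averaging over all vertices: [flip k] is a bijection, so each coordinate contributes 7/20 on
   average. *)
have [tau htau] : exists tau, K%:R * (7 / 20) <= \sum_(k < d | (k < K)%N) a tau k.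
  apply/existsP; rewrite -[X in is_true X]negbK negb_exists; apply/negP => /forallP hlt.
  have lt1 : \sum_(tau : {ffun 'I_d -> bool}) \sum_(k < d | (k < K)%N) a tau k <
    \sum_(tau : {ffun 'I_d -> bool}) K%:R * (7 / 20).
    apply: ltr_sum; last by move=> tau _; rewrite ltNge.
    by apply/hasP; exists [ffun=> true] => //; exact: mem_index_enum.
  have ge1 : \sum_(tau : {ffun 'I_d -> bool}) K%:R * (7 / 20) <=
    \sum_(tau : {ffun 'I_d -> bool}) \sum_(k < d | (k < K)%N) a tau k.
    rewrite [leRHS]exchange_big/=.
    apply: (@le_trans _ _ (\sum_(k < d | (k < K)%N) \sum_(tau : {ffun 'I_d -> bool}) (7 / 20 : R))).
      rewrite exchange_big/=; apply: ler_sum => tau _.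
      by rewrite sumr_const card_ltK mulr_natl.
    apply: ler_sum => k kK.
    have e : \sum_(tau : {ffun 'I_d -> bool}) a tau k = \sum_(tau : {ffun 'I_d -> bool}) a (flip k tau) k.
      by rewrite (reindex_inj (inv_inj (flipK k))).
    have : \sum_(tau : {ffun 'I_d -> bool}) (7 / 10 : R) <= \sum_(tau : {ffun 'I_d -> bool}) a tau k + \sum_(tau : {ffun 'I_d -> bool}) a (flip k tau) k.
      by rewrite -big_split/=; apply: ler_sum => tau _; exact: pair.
    rewrite -e !sumr_const -(mulr_natr (7 / 10)) -(mulr_natr (7 / 20)).
    move: (#|_|%:R) (\sum_(_ : {ffun 'I_d -> bool}) _) => x y; lra.
  by move: (lt_le_trans lt1 ge1); rewrite ltxx.
exists tau.
set A := [set z | _].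
have mA : measurable A.
  have mSq : measurable_fun setT (fun z => sqdist (m z) (cube_mean tau)).
    by apply: measurable_sum => k; apply: measurable_funX; exact: measurable_funB.
  rewrite -[X in measurable X]setTI (_ : A = (fun z => sqdist (m z) (cube_mean tau)) @^-1` `[s, +oo[%classic).
    exact: mSq.
  by apply/seteqP; split => z /=; rewrite in_itv/= andbT.
have point z : \sum_(k < d | (k < K)%N) \1_(err tau k) z <= K%:R * \1_A z + K%:R / 10 :> R.
  have Kp : 0 < (K%:R : R) by rewrite ltr0n.
  have errK : \sum_(k < d | (k < K)%N) \1_(err tau k) z <= K%:R :> R.
    rewrite -[leRHS](_ : \sum_(k < d | (k < K)%N) (1 : R) = _).
      by apply: ler_sum => k _; rewrite indicE; case: (_ \in _).
    by rewrite sumr_const card_ltK.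
  have [zA|zA] := pselect (A z).
    by rewrite indicE (mem_set zA) mulr1; apply: le_trans errK _; lra.
  rewrite indicE (memNset zA) mulr0 add0r; move: zA; rewrite /A/= => /negP; rewrite -ltNge => zA.
  have lower : gam ^+ 2 * \sum_(k < d | (k < K)%N) \1_(err tau k) z <= sqdist (m z) (cube_mean tau).
    rewrite mulr_sumr /sqdist big_mkcond/=; apply: ler_sum => k _; case: ifPn => kK; last exact: sqr_ge0.
    have [ez|ez] := pselect (err tau k z); last by rewrite indicE (memNset ez) mulr0 sqr_ge0.
    rewrite indicE (mem_set ez) /cube_mean kK; move: ez; rewrite /err; case: (tau k) => /=.
      move=> /negP; rewrite -ltNge => hz; move: gam0.
      rewrite mulr1; move: (m z k) hz => y; nra.
    rewrite /S/= mulr1; move: (m z k) gam0 => y; nra.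
  have g2 : 0 < gam ^+ 2 by rewrite exprn_gt0.
  rewrite -(ler_pM2l g2); apply: le_trans lower _; apply: le_trans (ltW zA) _; apply: le_trans sK _; lra.
have mi (B : set (n.-tuple (d.-tuple R))) : measurable B -> measurable_fun setT (fun z => (\1_B z : R)%:E).
  by move=> mB; apply/measurable_EFinP; exact: measurable_indic.
have int1 : ((\sum_(k < d | (k < K)%N) a tau k)%:E <= K%:R%:E * cp tau A + (K%:R / 10)%:E)%E.
  pose F (k : 'I_d) z : \bar R := if (k < K)%N then (\1_(err tau k) z : R)%:E else 0%E.
  have -> : ((\sum_(k < d | (k < K)%N) a tau k)%:E = \int[cp tau]_z \sum_(k < d) F k z)%E.
    rewrite ge0_integral_sum//; last 2 first.
    - by move=> k; rewrite /F; case: (k < K)%N => //; exact: mi.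
    - by move=> k z _; rewrite /F; case: ifP => // _; rewrite lee_fin.
    rewrite -sumEFin big_mkcond/=; apply: eq_bigr => k _; rewrite /F; case: ifP => _; last by rewrite integral0.
    by rewrite integral_indic// setIT aE.
  apply: (@le_trans _ _ (\int[cp tau]_z (K%:R%:E * (\1_A z)%:E + (K%:R / 10)%:E))%E).
    apply: ge0_le_integral => //.
    - by move=> z _; apply: sume_ge0 => k _; rewrite /F; case: ifP => // _; rewrite lee_fin.
    - by apply: emeasurable_sum => k; rewrite /F; case: (k < K)%N => //; exact: mi.
    - by apply: emeasurable_funD => //; apply: emeasurable_funM => //; exact: mi.
    - move=> z _; rewrite -EFinM -EFinD; apply: le_trans (_ : ((\sum_(k < d | (k < K)%N) \1_(err tau k) z)%:E <= _)%E).
        by rewrite -sumEFin [leRHS]big_mkcond/=.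
      by rewrite lee_fin; exact: point.
  rewrite ge0_integralD//; last by apply: emeasurable_funM => //; exact: mi.
  rewrite ge0_integralZl//; last exact: mi.
  rewrite integral_indic// setIT; apply: leeD => //.
  by rewrite integral_cst//; rewrite -[leRHS]mule1; apply: lee_wpmul2l; [rewrite lee_fin divr_ge0|exact: probability_le1].
have Kp : 0 < (K%:R : R) by rewrite ltr0n.
move: int1; rewrite (fE tau _ mA) -EFinM -EFinD !lee_fin => int1.
rewrite -(ler_pM2l Kp); move: htau int1; lra.
Qed.

End Hypercube.

Lemma nat_sqrt_exists (d : nat) : exists K, (K ^ 2 <= d < K.+1 ^ 2)%N.
Proof.
elim: d => [|d [K /andP[Kd dK]]]; first by exists 0.
have [h|h] := ltnP d.+1 (K.+1 ^ 2); first by exists K; rewrite h leqW.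
by exists K.+1; rewrite h (leq_ltn_trans dK)// ltn_exp2r.
Qed.

(** 2040 = 102 * 10 * 2: gam^2 = m / (102 d), the fraction K / 10 of wrong signs, and K >= sqrt d /
    2. *)
Definition C_low {R : realType} : R := 2040^-1.

Lemma C_low_gt0 {R : realType} : 0 < C_low :> R.
Proof. by rewrite /C_low invr_gt0; lra. Qed.

Section Lower.
Context {R : realType}.
Variables (d n : nat) (lam : 'I_n -> R).
Hypotheses (d0 : (1 <= d)%N) (n0 : (1 <= n)%N) (lam01 : forall i, 0 <= lam i <= 1).
Hypothesis mc : (m_d d lam <= c_up%:E)%E.

Lemma c_up_le1 : c_up <= 1 :> R.
Proof.
have h : small_const <= 1 :> R.
  rewrite /small_const ge_min; apply/orP; left; apply: exprn_ile1; first by rewrite invr_ge0.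
  by rewrite invf_le1// ler1n.
rewrite /c_up; have := @small_const_gt0 R; move: small_const h => x; nra.
Qed.

(* With [gam^2 = m / (102 d)] the coordinates carrying the hypercube number [K ~ sqrt d], so that
   [K gam <= 1] is an admissible threshold in [m_d]. *)
Lemma L_PAC_lower : ((C_low / Num.sqrt d%:R)%:E * m_d d lam <= L_PAC d lam)%E.
Proof.
pose m := fine (m_d d lam).
have mE : m_d d lam = m%:E := m_d_fin d0 n0 mc.
have m0 : 0 < m by have := m_d_gt0 lam d0 n0; rewrite mE lte_fin.
have m1 : m <= 1 by rewrite -lee_fin -mE; apply: le_trans mc _; rewrite lee_fin c_up_le1.
have D0 : 0 < (d%:R : R) by rewrite ltr0n.
have [K /andP[Kd dK]] := nat_sqrt_exists d.
have K0 : (0 < K)%N by case: K dK {Kd} => // ; rewrite ltnNge d0.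
have K2 : (K%:R : R) ^+ 2 <= d%:R by rewrite -natrX ler_nat.
have K1 : 1 <= (K%:R : R) by rewrite ler1n.
have KD : (K <= d)%N by apply: leq_trans Kd; rewrite expnS expn1 leq_pmulr.
have sd0 : 0 < Num.sqrt (d%:R : R) by rewrite sqrtr_gt0.
have sd2 : Num.sqrt (d%:R : R) ^+ 2 = d%:R by rewrite sqr_sqrtr// ltW.
have sdK : Num.sqrt (d%:R : R) <= 2 * K%:R.
  have h : (d%:R : R) <= (K%:R + 1) ^+ 2 by rewrite natr1 -natrX ler_nat ltnW.
  rewrite -(ler_pXn2r (_ : (0 < 2)%N))// ?nnegrE ?(ltW sd0)//.
  rewrite sd2; apply: le_trans h _; nra.
pose gam := Num.sqrt (m / (102 * d%:R)).
have q0 : 0 < m / (102 * d%:R) by rewrite divr_gt0// mulr_gt0.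
have gam0 : 0 < gam by rewrite sqrtr_gt0.
have gam2 : gam ^+ 2 = m / (102 * d%:R) by rewrite sqr_sqrtr// ltW.
have dg : 102 * d%:R * gam ^+ 2 = m by rewrite gam2 mulrC divfK// gt_eqF// mulr_gt0.
pose t := K%:R * gam.
have t2 : t ^+ 2 <= d%:R * gam ^+ 2 by rewrite exprMn ler_pM2r// exprn_gt0.
have t0 : 0 <= t by rewrite mulr_ge0// ltW.
have t1 : t <= 1.
  rewrite -(ler_pXn2r (_ : (0 < 2)%N))// ?nnegrE// expr1n; apply: le_trans t2 _.
  move: dg; have : 0 <= d%:R * gam ^+ 2 by rewrite mulr_ge0// sqr_ge0.
  move: m1; lra.
(* As m = 102 d gam^2 <= t^2 + d / N and t^2 <= d gam^2, what is left is 101 gam^2 <= 1 / N. *)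
have info : #|clean K lam gam|%:R * gam ^+ 2 <= 100^-1.
  have : (m%:E <= mobj d lam t)%E.
    by rewrite -mE; apply: ereal_inf_lbound; exists t => //=; rewrite in_itv/= t0 t1.
  rewrite /mobj NcountE -/(clean K lam gam); case: eqVneq => [->|N0].
    by rewrite mul0r invr_ge0 ler0n.
  have Np : 0 < (#|clean K lam gam|%:R : R) by rewrite ltr0n lt0n.
  rewrite lee_fin; move: (#|_|%:R) Np => N Np mN.
  have : 101 * d%:R * gam ^+ 2 <= d%:R / N by move: mN t2 dg; lra.
  rewrite ler_pdivlMr// => h.
  rewrite -(ler_pM2l D0); move: h; lra.
apply/ereal_infP => _ [s /= sM <-].
rewrite mE -EFinM lee_fin leNgt; apply/negP => sm.
have sK : s <= K%:R * gam ^+ 2 / 10.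
  apply: ltW; apply: lt_le_trans sm _; rewrite /C_low.
  have -> : 2040^-1 / Num.sqrt d%:R * m = 20^-1 * gam ^+ 2 * Num.sqrt d%:R.
    rewrite -dg; move: (Num.sqrt d%:R) sd0 sd2 => w w0 <-; field.
    by rewrite gt_eqF.
  move: sdK (sqr_ge0 gam); nra.
(* Every estimator fails with probability at least 1/4 at level [s], while [s] was assumed
   achievable with 1/5. *)
have : (4^-1%:E <= 5^-1%:E :> \bar R)%E.
  apply: le_trans sM; apply/ereal_infP => _ [M /= mM <-].
  have [tau htau] := cube_risk_exists KD gam0 info K0 mM sK.
  exact: le_trans htau (cube_risk d0 KD lam01 gam0 tau s mM).
rewrite lee_fin; lra.
Qed.

End Lower.

Theorem mainTheorem6 (R : realType) :
  exists c C1 C2 : R, [/\ 0 < c, 0 < C1, 0 < C2 &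
  forall (d n : nat) (lam : 'I_n -> R),
    (1 <= d)%N -> (1 <= n)%N ->
    (forall i, 0 <= lam i <= 1) ->
    (m_d d lam <= c%:E)%E ->
    [/\ ((C1 / Num.sqrt d%:R)%:E * m_d d lam <= L_PAC d lam)%E,
        (L_PAC d lam <= C2%:E * m_d d lam)%E &
        forall tstar : R, 0 <= tstar <= 1 ->
          (forall t : R, 0 <= t <= 1 -> (mobj d lam tstar <= mobj d lam t)%E) ->
          forall M : estimator R n d, measurable_estimator M ->
          (forall z, is_tukey_median (wthr lam tstar) z (M z)) ->
          forall (mu : 'I_d -> R) (dO : measure_display) (Om : measurableType dO)
                 (P : probability Om R) (X : Om -> 'I_n -> 'I_d -> R)
                 (B : Om -> 'I_n -> bool) (Xt : Om -> 'I_n -> 'I_d -> R),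
            contam_setup lam mu P X B Xt ->
            (P [set w | (C2 * fine (m_d d lam) <= sqdist (M (contaminate X B Xt w)) mu)%R]
               <= (5%:R^-1)%:E)%E]].
Proof.
exists c_up, C_low, C_up; split; [|exact: C_low_gt0|exact: C_up_gt0|].
  by rewrite /c_up; apply: divr_gt0; [apply: exprn_gt0; exact: small_const_gt0|lra].
move=> d n lam d0 n0 lam01 mc; split; [exact: L_PAC_lower|exact: L_PAC_upper|exact: tukey_upper].
Qed.
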